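(* For every time $t=0,N_r,2N_r,\dots$, the constrained stochastic optimal control problem of minimizing $V_t=\mathbb{E}\big[\|x_{t:N+1}\|^2_{\mathcal Q}+\|u^a_{t:N}\|^2_{\mathcal R}\mid\mathfrak{Y}^s_t\big]$ over the policies $(\eta_t,\Theta_t)$ described in the context, subject to the system dynamics and to the hard constraint $\|u^a_{t+\ell}\|_\infty\le u_{\max}$ ($\ell=0,\dots,N-1$) for all realizations of the uncertainties, can be written (up to terms of the objective independent of $(\eta_t,\Theta_t)$) as the following convex quadratic, globally feasible program (feasible for every $x_t\in\mathbb{R}^d$ and every such $t$): $$\begin{aligned}\underset{\eta_t,\Theta_t}{\text{minimize}}\quad & \eta_t^\top\Sigma_{\mathcal G}\eta_t+\operatorname{tr}\!\big(\Sigma_{\mathcal S}\Theta_t^{(:,t)}\Pi_{y_t}(\Theta_t^{(:,t)})^\top\big)+\operatorname{tr}\!\big(\Sigma_{\mathcal S}\Theta_t'\Sigma_\psi(\Theta_t')^\top\big)\\&+2\big(\eta_t^\top\Sigma_{\mathcal{GS}}+\tilde x_t^\top\mathcal Q_{\mathcal A}\mu_{\mathcal S}\big)\Theta_t^{(:,t)}\psi_0(\tilde{\mathcal I}_t)+2\tilde x_t^\top\mathcal Q_{\mathcal A}\mu_{\mathcal G}\eta_t\\&+2\operatorname{tr}\!\big(\mathcal Q_{\mathcal D}\mu_{\mathcal S}\Theta_t'\Sigma_{\psi'w}\big)+2\operatorname{tr}\!\big(\mathcal Q_{\mathcal A}\mu_{\mathcal S}\Theta_t'\Sigma_{e\psi'}\big)\\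 \text{subject to}\quad & \big|\eta_t^{(i)}\big|+\big\|\Theta_t^{(i,:)}\big\|_1\psi_{\max}\le u_{\max},\quad i=1,\dots,mN.\end{aligned}$$
   Context: System: $x_{t+1} = A x_t + B u^a_t + w_t$, $y_t = C x_t + \varsigma_t$, $t\in\mathbb{N}_0$, with $x_t\in\mathbb{R}^d$, applied control $u^a_t\in\mathbb{R}^m$, $y_t\in\mathbb{R}^q$; $(A,B)$ stabilizable, $(A,C)$ observable, $(A,\Sigma_w^{1/2})$ controllable; $x_0\sim N(0,\Sigma_{x_0})$, $w_t\sim N(0,\Sigma_w)$, $\varsigma_t\sim N(0,\Sigma_\varsigma)$ mutually independent, $\Sigma_{x_0}\succeq0$, $\Sigma_w\succeq0$, $\Sigma_\varsigma\succ0$. All eigenvalues of $A$ lie in the closed unit disk and those on the unit circle are semi-simple. The sensor-channel dropouts $(s_t)$ and control-channel dropouts $(\nu_t)$ are i.i.d. $\{0,1\}$-valued with success probabilities $p_s,p_c>0$, mutually independent and independent of the noises. $u_{\max}>0$ is given. Information: $\mathfrak{Y}_t:=\{y_0,\dots,y_t,u^a_0,\dots,u^a_{t-1}\}$, $\hat x_t:=\mathbb{E}[x_t\mid\mathfrak{Y}_t]$ (Kalman filter), $e_t:=x_t-\hat x_t$, $\mathcal I_t:=y_t-C\hat x_t$, $\tilde{\mathcal I}_t:=s_t\mathcal I_t$. Data at the controller: $\mathfrak{Y}^s_t:=\{s_ky_k,s_k\hat x_k,s_k,u^a_{k-1}: k=0,\dots,t\}$ with $u^a_{-1}=0$; $\tilde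 x_t:=\mathbb{E}[x_t\mid\mathfrak{Y}^s_t]$. Acknowledgements of successful control transmissions are causally available to the controller and estimator. Controls are computed causally from the data available at the controller. Notation: $v_{n:k}:=[v_n^\top\ \cdots\ v_{n+k-1}^\top]^\top$; $v^{(i)}$ is the $i$-th entry, $M^{(i,:)}$ the $i$-th row; $\|v\|_P^2:=v^\top Pv$. Fix horizon $N$ and recalculation interval $N_r\le N$. $Q,Q_N\succeq0$ and $R\succ0$ are given, $\mathcal Q=\operatorname{blkdiag}\{Q,\dots,Q,Q_N\}$ ($N$ copies of $Q$), $\mathcal R=\operatorname{blkdiag}\{R,\dots,R\}$ ($N$ copies). $\mathcal A,\mathcal B,\mathcal D$ are the matrices with $x_{t:N+1}=\mathcal Ax_t+\mathcal Bu^a_{t:N}+\mathcal Dw_{t:N}$. Policy: $u_{t:N}=\eta_t+\Theta_t\psi(\tilde{\mathcal I}_{t:N})$, where $\eta_t\in\mathbb{R}^{mN}$; $\Theta_t\in\mathbb{R}^{mN\times qN}$ is block lower triangular with $(\ell+1,i+1)$ block $\theta_{\ell,t+i}\in\mathbb{R}^{m\times q}$ for $0\le i\le\ell\le N-1$ and zero otherwise; $\psi(\tilde{\mathcal I}_{t:N})$ stacks $\psi_0(\tilde{\mathcal I}_t),\dots,\psi_{N-1}(\tilde{\mathcal I}_{t+N-1})$; each $\psi_i:\mathbb{R}^q\to\mathbb{R}^q$ is measurable, component-wise odd (e.g. standard saturation or sigmoidal function) and satisfies $\|\psi_i(\cdot)\|_\infty\le\psi_{\max}$. Applied control: $u^a_{t:N}=\mathcal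 G_t\eta_t+\mathcal S_t\Theta_t\psi(\tilde{\mathcal I}_{t:N})$, where $\mathcal G_t,\mathcal S_t$ are block diagonal with $m\times m$ blocks: the $i$-th block of $\mathcal G_t$ is $g_{t+i-1}I_m$ for $i\le N_r$ and $I_m$ for $i>N_r$, with $g_t=\nu_t$, $g_{t+\ell}=g_{t+\ell-1}+(1-g_{t+\ell-1})\nu_{t+\ell}$; the $i$-th block of $\mathcal S_t$ is $\nu_{t+i-1}I_m$ for $i\le N_r$ and $I_m$ for $i>N_r$. Write $\Theta_t=[\Theta_t^{(:,t)}\ \Theta_t']$, where $\Theta_t^{(:,t)}=[\theta_{0,t}^\top\ \theta_{1,t}^\top\cdots\theta_{N-1,t}^\top]^\top$ is the block of the first $q$ columns, and let $\psi'(\tilde{\mathcal I}_{t+1:N-1})$ stack $\psi_1(\tilde{\mathcal I}_{t+1}),\dots,\psi_{N-1}(\tilde{\mathcal I}_{t+N-1})$. Define $\alpha:=\mathcal B^\top\mathcal Q\mathcal B+\mathcal R$, $\mu_{\mathcal G}:=\mathbb{E}[\mathcal G_t]$, $\mu_{\mathcal S}:=\mathbb{E}[\mathcal S_t]$, $\Sigma_{\mathcal G}:=\mathbb{E}[\mathcal G_t^\top\alpha\mathcal G_t]$, $\Sigma_{\mathcal S}:=\mathbb{E}[\mathcal S_t^\top\alpha\mathcal S_t]$, $\Sigma_{\mathcal{GS}}:=\mathbb{E}[\mathcal G_t^\top\alpha\mathcal S_t]$, $\Pi_{y_t}:=\psi_0(\tilde{\mathcal I}_t)\psi_0(\tilde{\mathcal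 I}_t)^\top$, $\Sigma_\psi:=\mathbb{E}[\psi'(\tilde{\mathcal I}_{t+1:N-1})\psi'(\tilde{\mathcal I}_{t+1:N-1})^\top]$, $\Sigma_{\psi'w}:=\mathbb{E}[\psi'(\tilde{\mathcal I}_{t+1:N-1})w_{t:N}^\top]$, $\Sigma_{e\psi'}:=\mathbb{E}[\psi'(\tilde{\mathcal I}_{t+1:N-1})e_t^\top]$, $\mathcal Q_{\mathcal A}:=\mathcal A^\top\mathcal Q\mathcal B$, $\mathcal Q_{\mathcal D}:=\mathcal D^\top\mathcal Q\mathcal B$.
   Formalization: The constraint is equivalent to the hard bound over all realizations only if the ψ_i attain or approach every corner of the box of size ψ_max; for general ψ_i it is proved sufficient, and equivalent to the bound with the feedback ranging over the whole box (ψ=0 refutes the literal equivalence). *)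

(* Defs.v *)
From HB Require Import structures.
From mathcomp Require Import all_boot all_order all_algebra.
From mathcomp Require Import complex.
From mathcomp Require Import all_classical all_reals all_analysis.

Set Implicit Arguments.
Unset Strict Implicit.
Unset Printing Implicit Defensive.

Import Order.TTheory GRing.Theory Num.Theory.
Import numFieldNormedType.Exports.

Local Open Scope classical_set_scope.
Local Open Scope ring_scope.

Section LinearSystems.
Context {R : realType}.

Definition psd k (M : 'M[R]_k) : Prop :=
  M^T = M /\ forall v : 'cV[R]_k, 0 <= (v^T *m M *m v) 0 0.

Definition pd k (M : 'M[R]_k) : Prop :=
  M^T = M /\ forall v : 'cV[R]_k, v != 0 -> 0 < (v^T *m M *m v) 0 0.

Definition qform k (M : 'M[R]_k) (v : 'cV[R]_k) : R := (v^T *m M *m v) 0 0.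

Definition cplx_mx k (M : 'M[R]_k) : 'M[R[i]]_k := map_mx (real_complex R) M.

Definition schur_stable k (M : 'M[R]_k) : Prop :=
  forall l : R[i], eigenvalue (cplx_mx M) l -> `|l| < 1.

Definition stabilizable d m (A : 'M[R]_d) (B : 'M[R]_(d, m)) : Prop :=
  exists K : 'M[R]_(m, d), schur_stable (A + B *m K).

Definition controllable d m (A : 'M[R]_d) (B : 'M[R]_(d, m)) : Prop :=
  \rank (\mxrow_(i < d) (A ^+ i *m B)) = d.

Definition observable d q (A : 'M[R]_d) (C : 'M[R]_(q, d)) : Prop :=
  \rank (\mxcol_(i < d) (C *m A ^+ i)) = d.

(* Semi-simple: the geometric and the algebraic multiplicities agree. *)
Definition semisimple_eigenvalue k (M : 'M[R[i]]_k) (l : R[i]) : Prop :=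
  \rank (eigenspace M l) = mup l (char_poly M).

Definition lyapunov_stable k (M : 'M[R]_k) : Prop :=
  forall l : R[i], eigenvalue (cplx_mx M) l ->
    `|l| <= 1 /\ (`|l| = 1 -> semisimple_eigenvalue (cplx_mx M) l).

(* The PSD square root is unique. *)
Definition is_psd_sqrt k (M S : 'M[R]_k) : Prop := psd S /\ S *m S = M.

End LinearSystems.

Section Probability.
Context {R : realType}.

Definition sigma_of {T : Type} (F : set (T -> R)) : set (set T) :=
  <<s [set S | exists f, F f /\ exists B, measurable B /\ S = f @^-1` B] >>.

Definition meas_wrt {T : Type} (G : set (set T)) (f : T -> R) : Prop :=
  forall B, measurable B -> G (f @^-1` B).

Definition entries {T : Type} k (X : T -> 'cV[R]_k) : set (T -> R) :=
  [set f | exists i, f = fun x => X x i 0].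

(* The Borel sigma-algebra of R^k is generated by the coordinates. *)
Definition borel_map k l (f : 'cV[R]_k -> 'cV[R]_l) : Prop :=
  forall i, meas_wrt (sigma_of (entries (@id 'cV[R]_k))) (fun x => f x i 0).

Context {dsp : measure_display} {Omega : measurableType dsp}.
Variable P : probability Omega R.

Definition rvec k (X : Omega -> 'cV[R]_k) : Prop :=
  forall i, measurable_fun setT (fun o => X o i 0).

Definition mean_mx k l (X : Omega -> 'M[R]_(k, l)) : 'M[R]_(k, l) :=
  \matrix_(i, j) fine 'E_P[fun o => X o i j].

(* X ~ N(0, S): every linear form of X is centred normal. [normal_prob] is
   not a Dirac mass for a zero standard deviation, whence the two cases. *)
Definition centred_gaussian k (X : Omega -> 'cV[R]_k) (S : 'M[R]_k) : Prop :=
  rvec X /\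
  forall a : 'cV[R]_k,
    let s := Num.sqrt (qform S a) in
    let Y := fun o => (a^T *m X o) 0 0 in
    if s == 0 then P (Y @^-1` [set 0]) = 1%E
    else forall B, measurable B -> P (Y @^-1` B) = normal_prob 0 s B.

(* Mutual independence of a family of sigma-algebras: product rule on every
   finite subfamily. *)
Definition mutually_independent (I : Type) (F : I -> set (set Omega)) : Prop :=
  forall (k : nat) (f : 'I_k -> I), injective f ->
  forall E : 'I_k -> set Omega, (forall i, F (f i) (E i)) ->
    fine (P (\bigcap_(i in [set: 'I_k]) E i)) = \prod_(i < k) fine (P (E i)).

(* Y is a version of E[X | G]. *)
Definition is_condexp (G : set (set Omega)) (X Y : Omega -> R) : Prop :=
  [/\ P.-integrable setT (EFin \o X), P.-integrable setT (EFin \o Y),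
      meas_wrt G Y &
      forall S, G S ->
        (\int[P]_(o in S) (Y o)%:E)%E = (\int[P]_(o in S) (X o)%:E)%E].

Definition is_condexp_vec (G : set (set Omega)) k
    (X Y : Omega -> 'cV[R]_k) : Prop :=
  forall i, is_condexp G (fun o => X o i 0) (fun o => Y o i 0).

End Probability.

Section QuadraticPrograms.
Context {R : realType} {U : lmodType R}.

Record program := Program { objective : U -> R ; feasible : set U }.

(* quadratic polynomial with a positive semidefinite quadratic part *)
Definition convex_quadratic (f : U -> R) : Prop :=
  exists (b : U -> U -> R) (l : U -> R) (c : R),
    [/\ forall u, scalar (b u), forall u v, b u v = b v u,
        forall u, 0 <= b u u, scalar l &
        forall u, f u = b u u + l u + c].

Definition polyhedral (S : set U) : Prop :=
  exists (I : finType) (l : I -> U -> R) (c : I -> R),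
    (forall i, scalar (l i)) /\ forall u, S u <-> forall i, l i u <= c i.

Definition convex_quadratic_program (p : program) : Prop :=
  convex_quadratic (objective p) /\ polyhedral (feasible p).

End QuadraticPrograms.
Arguments program {R} U.

Record plant (R : realType) (d m q : nat) := Plant {
  mA : 'M[R]_d ; mB : 'M[R]_(d, m) ; mC : 'M[R]_(q, d) ;
  Sx0 : 'M[R]_d ; Sw : 'M[R]_d ; Sv : 'M[R]_q }.

Definition plant_ok (R : realType) d m q (S : plant R d m q) : Prop :=
  [/\ stabilizable (mA S) (mB S), observable (mA S) (mC S),
      exists2 h, is_psd_sqrt (Sw S) h & controllable (mA S) h,
      lyapunov_stable (mA S) &
      [/\ psd (Sx0 S), psd (Sw S) & pd (Sv S)]].

(* vs is the measurement noise; sd and nu are the sensor-channel and the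
   control-channel dropouts (true = successful transmission). *)
Record uncertainty (R : realType) (d q : nat) (Omega : Type) := Uncertainty {
  x0 : Omega -> 'cV[R]_d ;
  w : nat -> Omega -> 'cV[R]_d ;
  vs : nat -> Omega -> 'cV[R]_q ;
  sd : nat -> Omega -> bool ;
  nu : nat -> Omega -> bool }.

Inductive source :=
  SrcInit | SrcW of nat | SrcV of nat | SrcS of nat | SrcNu of nat.

Section ClosedLoop.
Context {R : realType} {d m q : nat}.
Context {dsp : measure_display} {Omega : measurableType dsp}.
Variables (P : probability Omega R) (S : plant R d m q).
Variable U : uncertainty R d q Omega.

Definition indicator_rv (b : Omega -> bool) : Omega -> R := fun o => (b o)%:R.

Definition source_sigma (i : source) : set (set Omega) :=
  match i with
  | SrcInit => sigma_of (entries (x0 U))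
  | SrcW k => sigma_of (entries (w U k))
  | SrcV k => sigma_of (entries (vs U k))
  | SrcS k => sigma_of [set indicator_rv (sd U k)]
  | SrcNu k => sigma_of [set indicator_rv (nu U k)]
  end.

Definition bernoulli_rv (p : R) (b : Omega -> bool) : Prop :=
  measurable_fun setT (indicator_rv b) /\ P [set o | b o] = p%:E.

Definition uncertainty_ok (ps pc : R) : Prop :=
  [/\ centred_gaussian P (x0 U) (Sx0 S),
      forall k, centred_gaussian P (w U k) (Sw S),
      forall k, centred_gaussian P (vs U k) (Sv S),
      (forall k, bernoulli_rv ps (sd U k)) /\
      (forall k, bernoulli_rv pc (nu U k)) &
      mutually_independent P source_sigma].

(* state, measurement, applied control u^a, state estimate x^ *)
Record loop := Loop {
  st : nat -> Omega -> 'cV[R]_d ;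
  out : nat -> Omega -> 'cV[R]_q ;
  act : nat -> Omega -> 'cV[R]_m ;
  est : nat -> Omega -> 'cV[R]_d }.

Variable L : loop.

(* sigma(y_0, ..., y_k, u^a_0, ..., u^a_{k-1}) *)
Definition filter_sigma (k : nat) : set (set Omega) :=
  sigma_of (\bigcup_(j in `I_k.+1) entries (out L j) `|`
            \bigcup_(j in `I_k) entries (act L j)).

(* The generators of the controller's data at time k; the constant
   u^a_{-1} = 0 generates nothing and is left out. *)
Definition controller_data (k : nat) : set (Omega -> R) :=
  \bigcup_(j in `I_k.+1)
    (entries (fun o => (sd U j o)%:R *: out L j o) `|`
     entries (fun o => (sd U j o)%:R *: est L j o) `|`
     [set indicator_rv (sd U j)]) `|`
  \bigcup_(j in `I_k) entries (act L j).

Definition controller_sigma (k : nat) : set (set Omega) :=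
  sigma_of (controller_data k).

(* s_k (y_k - C x^_k) *)
Definition innov (k : nat) (o : Omega) : 'cV[R]_q :=
  (sd U k o)%:R *: (out L k o - mC S *m est L k o).

Definition est_err (k : nat) (o : Omega) : 'cV[R]_d := st L k o - est L k o.

(* L obeys the dynamics and the filter up to time T. *)
Definition is_loop (T : nat) : Prop :=
  [/\ st L 0%N = x0 U,
      forall k o, (k < T)%N ->
        st L k.+1 o = mA S *m st L k o + mB S *m act L k o + w U k o,
      forall k o, (k <= T)%N -> out L k o = mC S *m st L k o + vs U k o &
      forall k, (k <= T)%N -> is_condexp_vec P (filter_sigma k) (st L k) (est L k)].

(* Up to time T the applied controls are causal (functions of the controller's
   data and of the control-channel dropouts so far) and obey the hard bound. *)
Definition admissible_operation (umax : R) (T : nat) : Prop :=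
  forall k, (k < T)%N ->
    (forall i, meas_wrt (sigma_of (controller_data k `|`
                 \bigcup_(j in `I_k.+1) [set indicator_rv (nu U j)]))
               (fun o => act L k o i 0)) /\
    (forall o i, `|act L k o i 0| <= umax).

End ClosedLoop.
Arguments loop R d m q {dsp} Omega.

(* From here on the horizon is N = n.+1. *)

Notation stacked k N := (\sum_(i < N) k)%N.

(* the decision variables (eta, Theta) *)
Notation decision R m q n :=
  ('cV[R]_(stacked m n.+1) * 'M[R]_(stacked m n.+1, stacked q n.+1))%type.

Record weights (R : realType) (d m : nat) := Weights {
  wQ : 'M[R]_d ; wQN : 'M[R]_d ; wR : 'M[R]_m }.

Definition weights_ok (R : realType) d m (W : weights R d m) : Prop :=
  [/\ psd (wQ W), psd (wQN W) & pd (wR W)].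

Section Horizon.
Context {R : realType} {d m q : nat} {n : nat}.
Variables (S : plant R d m q) (W : weights R d m).

Definition calA : 'M[R]_(stacked d n.+2, d) :=
  \mxcol_(i < n.+2) (mA S ^+ i).

Definition calB : 'M[R]_(stacked d n.+2, stacked m n.+1) :=
  \mxblock_(i < n.+2, j < n.+1)
    (if (j < i)%N then mA S ^+ (i - j.+1) *m mB S else 0).

Definition calD : 'M[R]_(stacked d n.+2, stacked d n.+1) :=
  \mxblock_(i < n.+2, j < n.+1)
    (if (j < i)%N then mA S ^+ (i - j.+1) else 0).

Definition calQ : 'M[R]_(stacked d n.+2) :=
  \mxdiag_(i < n.+2) (if (i < n.+1)%N then wQ W else wQN W).

Definition calR : 'M[R]_(stacked m n.+1) := \mxdiag_(i < n.+1) (wR W).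

Definition alpha : 'M[R]_(stacked m n.+1) := calB^T *m calQ *m calB + calR.
Definition calQA : 'M[R]_(d, stacked m n.+1) := calA^T *m calQ *m calB.
Definition calQD : 'M[R]_(stacked d n.+1, stacked m n.+1) :=
  calD^T *m calQ *m calB.

(* g_{t+l}, for a realization nu of the control-channel dropouts *)
Fixpoint gate (nu : nat -> bool) (t l : nat) : R :=
  if l is l'.+1 then
    gate nu t l' + (1 - gate nu t l') * (nu (t + l)%N)%:R
  else (nu t)%:R.

Variable Nr : nat.

(* Blocks are numbered from 0. *)
Definition calG (nu : nat -> bool) (t : nat) : 'M[R]_(stacked m n.+1) :=
  \mxdiag_(i < n.+1) ((if (i < Nr)%N then gate nu t i else 1)%:M : 'M[R]_m).

Definition calS (nu : nat -> bool) (t : nat) : 'M[R]_(stacked m n.+1) :=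
  \mxdiag_(i < n.+1)
    ((if (i < Nr)%N then (nu (t + i)%N)%:R else 1)%:M : 'M[R]_m).

(* u^a_{t:N} for a realization nu of the dropouts and p of the feedback *)
Definition applied (z : decision R m q n) (nu : nat -> bool) (t : nat)
    (p : 'cV[R]_(stacked q n.+1)) : 'cV[R]_(stacked m n.+1) :=
  calG nu t *m z.1 + calS nu t *m z.2 *m p.

Definition block_lower (Th : 'M[R]_(stacked m n.+1, stacked q n.+1)) : Prop :=
  forall i j : 'I_n.+1, (i < j)%N ->
    submxblock Th i j = (0 : 'M[R]_(m, q)).

Definition head_cols (Th : 'M[R]_(stacked m n.+1, stacked q n.+1)) :
  'M[R]_(stacked m n.+1, q) := submxrow Th (ord0 : 'I_n.+1).

Definition tail_cols (Th : 'M[R]_(stacked m n.+1, stacked q n.+1)) :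
    'M[R]_(stacked m n.+1, stacked q n) :=
  \mxrow_(j < n) submxrow Th (lift ord0 j).

Variables (psi : 'I_n.+1 -> 'cV[R]_q -> 'cV[R]_q) (psimax umax : R).

(* Oddness is required componentwise: psi^(j)(-z) = - psi^(j)(z). *)
Definition psi_ok : Prop :=
  forall i, [/\ borel_map (psi i),
    forall z j, psi i (- z) j 0 = - psi i z j 0 &
    forall z j, `|psi i z j 0| <= psimax].

(* psimax is the actual saturation level: the range of each psi_i comes
   arbitrarily close to every corner of the cube [-psimax, psimax]^q. *)
Definition psi_tight : Prop :=
  forall i (sg : 'I_q -> bool) (eps : R), 0 < eps ->
    exists z, forall j, `|psi i z j 0 - (-1) ^+ sg j * psimax| < eps.

Definition stack_psi (z : 'I_n.+1 -> 'cV[R]_q) : 'cV[R]_(stacked q n.+1) :=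
  \mxcol_(i < n.+1) psi i (z i).

(* |u^a_{t+l}|_oo <= umax, l = 0, ..., N-1, for all values of the dropouts and
   of the received innovations *)
Definition hard_constraint (t : nat) (z : decision R m q n) : Prop :=
  block_lower z.2 /\
  forall (nu : nat -> bool) (zeta : 'I_n.+1 -> 'cV[R]_q) i,
    `|applied z nu t (stack_psi zeta) i 0| <= umax.

(* the same, with the feedback signal ranging over its whole bounding box *)
Definition robust_hard_constraint (t : nat) (z : decision R m q n) : Prop :=
  block_lower z.2 /\
  forall (nu : nat -> bool) (p : 'cV[R]_(stacked q n.+1)),
    (forall j, `|p j 0| <= psimax) ->
    forall i, `|applied z nu t p i 0| <= umax.

Definition program_constraint : set (decision R m q n) :=
  [set z : decision R m q n | block_lower z.2 /\
    forall i, `|z.1 i 0| + (\sum_j `|z.2 i j|) * psimax <= umax].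

End Horizon.

Section Problem.
Context {R : realType} {d m q : nat} {n : nat}.
Context {dsp : measure_display} {Omega : measurableType dsp}.
Variables (P : probability Omega R) (S : plant R d m q) (W : weights R d m).
Variables (U : uncertainty R d q Omega) (Nr t : nat).
Variables (psi : 'I_n.+1 -> 'cV[R]_q -> 'cV[R]_q) (psimax umax : R).

Definition rG (o : Omega) : 'M[R]_(stacked m n.+1) :=
  calG Nr (fun k => nu U k o) t.
Definition rS (o : Omega) : 'M[R]_(stacked m n.+1) :=
  calS Nr (fun k => nu U k o) t.

Variable L : loop R d m q Omega.

Definition psi_stack (o : Omega) : 'cV[R]_(stacked q n.+1) :=
  stack_psi psi (fun i => innov S U L (t + i) o).
Definition psi_head (o : Omega) : 'cV[R]_q := psi ord0 (innov S U L t o).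
Definition psi_tail (o : Omega) : 'cV[R]_(stacked q n) :=
  \mxcol_(i < n) psi (lift ord0 i) (innov S U L (t + lift ord0 i) o).
Definition w_stack (o : Omega) : 'cV[R]_(stacked d n.+1) :=
  \mxcol_(i < n.+1) w U (t + i) o.
Definition st_stack (o : Omega) : 'cV[R]_(stacked d n.+2) :=
  \mxcol_(i < n.+2) st L (t + i) o.
Definition act_stack (o : Omega) : 'cV[R]_(stacked m n.+1) :=
  \mxcol_(i < n.+1) act L (t + i) o.

(* the random variable whose conditional expectation is V_t *)
Definition horizon_cost (o : Omega) : R :=
  qform (calQ W) (st_stack o) + qform (calR W) (act_stack o).

Definition muG := mean_mx P rG.
Definition muS := mean_mx P rS.
Definition SigmaG := mean_mx P (fun o => (rG o)^T *m alpha S W *m rG o).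
Definition SigmaS := mean_mx P (fun o => (rS o)^T *m alpha S W *m rS o).
Definition SigmaGS := mean_mx P (fun o => (rG o)^T *m alpha S W *m rS o).
Definition Sigma_psi := mean_mx P (fun o => psi_tail o *m (psi_tail o)^T).
Definition Sigma_psi_w := mean_mx P (fun o => psi_tail o *m (w_stack o)^T).
Definition Sigma_e_psi :=
  mean_mx P (fun o => psi_tail o *m (est_err L t o)^T).

(* The objective, for the data xt of x~_t and p0 of psi_0(I~_t). *)
Definition program_cost (xt : 'cV[R]_d) (p0 : 'cV[R]_q)
    (z : decision R m q n) : R :=
  let eta := z.1 in let Th0 := head_cols z.2 in let Th' := tail_cols z.2 in
  (eta^T *m SigmaG *m eta) 0 0
  + \tr (SigmaS *m Th0 *m (p0 *m p0^T) *m Th0^T)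
  + \tr (SigmaS *m Th' *m Sigma_psi *m Th'^T)
  + 2 * ((eta^T *m SigmaGS + xt^T *m calQA S W *m muS) *m Th0 *m p0) 0 0
  + 2 * (xt^T *m calQA S W *m muG *m eta) 0 0
  + 2 * \tr (calQD S W *m muS *m Th' *m Sigma_psi_w)
  + 2 * \tr (calQA S W *m muS *m Th' *m Sigma_e_psi).

Definition mpc_program (xt : 'cV[R]_d) (p0 : 'cV[R]_q) :
    program (decision R m q n) :=
  Program (program_cost xt p0) (program_constraint psimax umax).

(* A policy may depend on the data available at time t. *)
Definition data_dependent (z : Omega -> decision R m q n) : Prop :=
  (forall i, meas_wrt (controller_sigma U L t) (fun o => (z o).1 i 0)) /\
  (forall i j, meas_wrt (controller_sigma U L t) (fun o => (z o).2 i j)).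

End Problem.

(* L' has the same past as L at time t and applies the policy z from t on.
   The feedback signal is built from the innovations of L' itself; this is not
   circular for block lower triangular gains. *)
Definition continues_with (R : realType) (d m q n : nat)
    (dsp : measure_display) (Omega : measurableType dsp)
    (P : probability Omega R) (S : plant R d m q) (U : uncertainty R d q Omega)
    (Nr t : nat) (psi : 'I_n.+1 -> 'cV[R]_q -> 'cV[R]_q)
    (L : loop R d m q Omega) (z : Omega -> decision R m q n)
    (L' : loop R d m q Omega) : Prop :=
  [/\ is_loop P S U L' (t + n.+1),
      forall k, (k < t)%N -> act L' k = act L k,
      forall k, (k <= t)%N -> est L' k = est L k &
      forall o, act_stack t L' o =
        applied Nr (z o) (fun k => nu U k o) t (psi_stack S U t psi L' o)].

(* Main.v *)
Require Import Defs.
From HB Require Import structures.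
From mathcomp Require Import all_boot all_order all_algebra.
From mathcomp Require Import complex.
From mathcomp Require Import all_classical all_reals all_analysis.
From mathcomp Require Import measurable_realfun.
From mathcomp Require Import ring lra.

(* The filtering error [post_err] obeys a recursion driven by the noises alone,
   whatever the control law; being Gaussian and uncorrelated with the
   innovations, it is independent of everything observed so far. Hence almost
   surely x^ is the state minus [post_err], and the received innovations agree
   with a process [ideal_innov] that does not depend on the controls. At time t
   all randomness splits into a past part (data, policy, x^_t) and an
   independent future part (filtering error, noises, dropouts). Freezing the
   past and integrating out the future turns the horizon cost into the program's
   quadratic form: the control dropouts are independent of the other sources,
   and psi' is centred because the innovations are symmetric and psi is odd.
   Since x^_t enters linearly, multiplied by bounded functions of the
   controller's data, it may finally be replaced by x~_t. The constraint is the
   maximum of an affine function over a cube, attained when every transmission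
   succeeds, and convexity holds because the quadratic part is a second moment
   weighted by the positive semidefinite matrix alpha. *)

Set Implicit Arguments.
Unset Strict Implicit.
Unset Printing Implicit Defensive.

Import Order.TTheory GRing.Theory Num.Theory.
Import numFieldNormedType.Exports.

Local Open Scope classical_set_scope.
Local Open Scope ring_scope.

(** * Generated sigma-algebras *)

Section GeneratedSigmaAlgebras.
Context {R : realType} {T : pointedType}.
Implicit Types (F G : set (T -> R)) (f g : T -> R).

(** The closed loop need not be Gaussian: the controls are nonlinear functions of the data and of
    the dropouts, so state and data have no joint normal law to condition on. Gaussianity is kept to
    the error recursion, and the Kalman filter is recovered from uniqueness of conditional
    expectations alone. Independence is deduced from zero covariance through real characteristic
    functions (cosines and sines), which treat degenerate covariances like all others. Estimates and
    innovations are determined only almost surely. Versions built from the sources have a definite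
    measurability with respect to past or future, and show that the moment matrices computed along
    [L] serve every continuation [L']. The hard bound is also an analytic tool: it yields the
    majorant that Fubini requires and the bounded multipliers that allow one estimate of the state
    to be exchanged for another. The additive term [c] has to be fixed before the policy. It is the
    conditional expectation of the cost without control; since [is_condexp] is only a predicate,
    existence has to be proved, by a Radon-Nikodym derivative. *)

Definition preimages F : set (set T) :=
  [set S | exists f, F f /\ exists B, measurable B /\ S = f @^-1` B].

(** A copy of [T] whose measurable sets are those of [sigma_of F]: facts about [measurable_fun]
    thereby apply to any sub-sigma-algebra. *)
Definition sigT F := g_sigma_algebraType (preimages F).

(** A one-field record, so that [meas_wrt], a universally quantified implication, stays folded under
    [apply]. *)
Record mw F f : Prop := Mw { mw_preimage : meas_wrt (sigma_of F) f }.

Lemma mwP F f : mw F f <-> measurable_fun [set: sigT F] (f : sigT F -> R).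
Proof.
split => [[h] _ B mB|h]; first by rewrite setTI; exact: h.
by split => B mB; have := h measurableT B mB; rewrite setTI.
Qed.

Lemma mw_gen F f : F f -> mw F f.
Proof.
by move=> Ff; split => B mB; apply: sub_sigma_algebra; exists f; split => //; exists B.
Qed.

Lemma sigma_of_sub F G : (forall f, F f -> mw G f) -> sigma_of F `<=` sigma_of G.
Proof.
move=> FG; apply: smallest_sub; first exact: smallest_sigma_algebra.
by move=> S [f [Ff [B [mB ->]]]]; exact: (mw_preimage (FG f Ff)).
Qed.

Lemma mw_sub F G f : (forall f, F f -> mw G f) -> mw F f -> mw G f.
Proof. by move=> FG [Ff]; split => B mB; apply: (sigma_of_sub FG); exact: Ff. Qed.

Lemma mw_subset F G f : F `<=` G -> mw F f -> mw G f.
Proof. by move=> FG; apply: mw_sub => g /FG; exact: mw_gen. Qed.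

Lemma eq_mw F f g : f =1 g -> mw F f -> mw F g.
Proof. by move=> /funext ->. Qed.

Lemma mw_cst F (c : R) : mw F (fun=> c).
Proof. by apply/mwP. Qed.

Lemma mwD F f g : mw F f -> mw F g -> mw F (fun x => f x + g x).
Proof. by move=> /mwP mf /mwP mg; apply/mwP; exact: measurable_funD. Qed.

Lemma mwN F f : mw F f -> mw F (fun x => - f x).
Proof. by move=> /mwP mf; apply/mwP; exact: measurableT_comp. Qed.

Lemma mwB F f g : mw F f -> mw F g -> mw F (fun x => f x - g x).
Proof. by move=> mf mg; apply: mwD => //; exact: mwN. Qed.

Lemma mwM F f g : mw F f -> mw F g -> mw F (fun x => f x * g x).
Proof. by move=> /mwP mf /mwP mg; apply/mwP; exact: measurable_funM. Qed.

Lemma mw_sum F I (r : seq I) (p : pred I) (h : I -> T -> R) :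
  (forall i, p i -> mw F (h i)) -> mw F (fun x => \sum_(i <- r | p i) h i x).
Proof.
move=> mh; elim: r => [|i r IH].
  by apply: eq_mw (mw_cst F 0) => x; rewrite big_nil.
case pi: (p i).
  by apply: eq_mw (mwD (mh i pi) IH) => x; rewrite big_cons pi.
by apply: eq_mw IH => x; rewrite big_cons pi.
Qed.

Lemma mw_comp F f (h : R -> R) : measurable_fun setT h -> mw F f ->
  mw F (fun x => h (f x)).
Proof. by move=> mh /mwP mf; apply/mwP; exact: measurableT_comp. Qed.

Lemma mw_set F (S : set T) : sigma_of F S -> mw F (\1_S : T -> R).
Proof.
move=> FS; apply/mwP.
by apply: (@measurable_indic _ (sigT F) R setT S); exact: FS.
Qed.

Lemma sigma_of_setI F (A B : set T) : sigma_of F A -> sigma_of F B -> sigma_of F (A `&` B).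
Proof. by move=> FA FB; exact: (@measurableI _ (sigT F) A B FA FB). Qed.

Lemma sigma_of_setT F : sigma_of F setT.
Proof. exact: (@measurableT _ (sigT F)). Qed.

End GeneratedSigmaAlgebras.

(** * Generated sigma-algebras inside an ambient one *)

Section GeneratedMeasurable.
Context {R : realType} {dsp : measure_display} {T : measurableType dsp}.
Implicit Types (F : set (T -> R)) (f : T -> R).

Definition all_meas F := forall f, F f -> measurable_fun [set: T] f.

Lemma sigma_of_measurable F : all_meas F -> sigma_of F `<=` measurable.
Proof.
move=> mF; apply: smallest_sub; first exact: sigma_algebra_measurable.
move=> S [f [Ff [B [mB ->]]]].
by have := mF f Ff measurableT B mB; rewrite setTI.
Qed.

Lemma mw_measurable F f : all_meas F -> mw F f -> measurable_fun [set: T] f.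
Proof.
move=> mF [Ff] _ B mB; rewrite setTI.
by apply: (sigma_of_measurable mF); exact: Ff.
Qed.

End GeneratedMeasurable.

(** * Entrywise measurability of random matrices *)

Section MatrixMeasurability.
Context {R : realType} {T : pointedType}.
Implicit Types (F G : set (T -> R)).

Definition mxmw F k l (X : T -> 'M[R]_(k, l)) :=
  forall i j, mw F (fun o => X o i j).

Lemma mxmw_cst F k l (M : 'M[R]_(k, l)) : mxmw F (fun=> M).
Proof. by move=> i j; exact: mw_cst. Qed.

Lemma mxmwD F k l (X Y : T -> 'M[R]_(k, l)) :
  mxmw F X -> mxmw F Y -> mxmw F (fun o => X o + Y o).
Proof.
by move=> mX mY i j; apply: eq_mw (mwD (mX i j) (mY i j)) => o; rewrite mxE.
Qed.

Lemma mxmwN F k l (X : T -> 'M[R]_(k, l)) :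
  mxmw F X -> mxmw F (fun o => - X o).
Proof. by move=> mX i j; apply: eq_mw (mwN (mX i j)) => o; rewrite mxE. Qed.

Lemma mxmwB F k l (X Y : T -> 'M[R]_(k, l)) :
  mxmw F X -> mxmw F Y -> mxmw F (fun o => X o - Y o).
Proof. by move=> mX mY; apply: mxmwD => //; exact: mxmwN. Qed.

Lemma mxmwM F k l m (X : T -> 'M[R]_(k, l)) (Y : T -> 'M[R]_(l, m)) :
  mxmw F X -> mxmw F Y -> mxmw F (fun o => X o *m Y o).
Proof.
move=> mX mY i j.
apply: (@eq_mw _ _ _ (fun o => \sum_r X o i r * Y o r j)).
  by move=> o; rewrite mxE.
by apply: mw_sum => r _; exact: mwM.
Qed.

Lemma mxmwT F k l (X : T -> 'M[R]_(k, l)) : mxmw F X -> mxmw F (fun o => (X o)^T).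
Proof. by move=> mX i j; apply: eq_mw (mX j i) => o; rewrite mxE. Qed.

Lemma mxmwZ F k l (a : T -> R) (X : T -> 'M[R]_(k, l)) :
  mw F a -> mxmw F X -> mxmw F (fun o => a o *: X o).
Proof.
by move=> ma mX i j; apply: eq_mw (mwM ma (mX i j)) => o; rewrite mxE.
Qed.

Lemma mw_tr F k (X : T -> 'M[R]_k) : mxmw F X -> mw F (fun o => \tr (X o)).
Proof. by move=> mX; apply: mw_sum. Qed.

Lemma mxmw_entries F k (X : T -> 'cV[R]_k) :
  entries X `<=` F -> mxmw F X.
Proof. by move=> XF i j; rewrite (ord1 j); apply/mw_gen/XF; exists i. Qed.

Lemma entries_mw F k (X : T -> 'cV[R]_k) :
  mxmw F X -> forall f, entries X f -> mw F f.
Proof. by move=> mX f [i ->]. Qed.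

Lemma mxmw_col F (N : nat) (p : 'I_N -> nat) l
    (X : forall i : 'I_N, T -> 'M[R]_(p i, l)) :
  (forall i, mxmw F (X i)) -> mxmw F (fun o => \mxcol_(i < N) X i o).
Proof.
by move=> mX i j; apply: eq_mw (mX (tagnat.sig1 i) (tagnat.sig2 i) j) => o; rewrite mxE.
Qed.

(** The sets whose preimage under [X] lies in [sigma_of F] form a sigma-algebra containing the
    preimages of the coordinates, hence every Borel set. *)
Lemma mxmw_borel F k l (f : 'cV[R]_k -> 'cV[R]_l) (X : T -> 'cV[R]_k) :
  borel_map f -> mxmw F X -> mxmw F (fun o => f (X o)).
Proof.
move=> bf mX i j; split => B mB; rewrite (ord1 j).
have := bf i B mB; set S := (X in sigma_of _ X) => hS.
change (sigma_of F (X @^-1` S)).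
have : sigma_of (entries (@id 'cV[R]_k)) `<=` [set S | sigma_of F (X @^-1` S)].
  apply: smallest_sub; last first.
    move=> A [g [[r ->] [C [mC ->]]]]; exact: (mw_preimage (mX r 0) mC).
  have [s0 sC sU] : sigma_algebra setT (sigma_of F) by exact: smallest_sigma_algebra.
  split => /=; first by rewrite preimage_set0.
    by move=> A /sC; rewrite !setTD preimage_setC.
  by move=> A hA; rewrite preimage_bigcup; exact: sU.
by apply.
Qed.

End MatrixMeasurability.

(** * Expectations *)

Section RealExpectation.
Context {R : realType} {dsp : measure_display} {T : measurableType dsp}.
Variable P : probability T R.
Implicit Types (X Y : T -> R) (c M : R).

Definition Int X := P.-integrable [set: T] (EFin \o X).
(** The real part of an extended integral, hence 0 when that integral is infinite; the rules of
    calculation therefore ask for [Int]. *)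
Definition Ex X : R := \int[P]_o X o.

Lemma Int_meas X : Int X -> measurable_fun setT X.
Proof. by move=> /integrableP[/measurable_EFinP]. Qed.

Lemma eq_Int X Y : X =1 Y -> Int X -> Int Y.
Proof. by move=> /funext ->. Qed.

Lemma eq_Ex X Y : X =1 Y -> Ex X = Ex Y.
Proof. by move=> /funext ->. Qed.

Lemma Int_cst c : Int (fun=> c).
Proof. exact: finite_measure_integrable_cst. Qed.

Lemma IntD X Y : Int X -> Int Y -> Int (fun o => X o + Y o).
Proof. by move=> iX iY; exact: (integrableD measurableT iX iY). Qed.

Lemma IntN X : Int X -> Int (fun o => - X o).
Proof. by move=> iX; exact: (integrableN iX). Qed.

Lemma IntB X Y : Int X -> Int Y -> Int (fun o => X o - Y o).
Proof. by move=> iX iY; apply: IntD => //; exact: IntN. Qed.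

Lemma IntZ c X : Int X -> Int (fun o => c * X o).
Proof. by move=> iX; exact: (integrableZl measurableT c iX). Qed.

Lemma Int_sum I (r : seq I) (p : pred I) (h : I -> T -> R) :
  (forall i, p i -> Int (h i)) -> Int (fun o => \sum_(i <- r | p i) h i o).
Proof.
move=> ih; elim: r => [|i r IH].
  by apply: eq_Int (Int_cst 0) => o; rewrite big_nil.
case pi: (p i).
  by apply: eq_Int (IntD (ih i pi) IH) => o; rewrite big_cons pi.
by apply: eq_Int IH => o; rewrite big_cons pi.
Qed.

Lemma Int_le X Y : measurable_fun setT X -> Int Y ->
  (forall o, `|X o| <= Y o) -> Int X.
Proof.
move=> mX iY XY; apply: (le_integrable _ _ _ iY) => //; first exact/measurable_EFinP.
by move=> o _ /=; rewrite lee_fin (le_trans (XY o)) // ler_norm.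
Qed.

Lemma Int_bounded M X : measurable_fun setT X -> (forall o, `|X o| <= M) -> Int X.
Proof. by move=> mX XM; apply: Int_le mX (Int_cst M) XM. Qed.

Lemma Int_norm X : Int X -> Int (fun o => `|X o|).
Proof. by move=> iX; exact: integrable_norm. Qed.

Lemma Int_boundedM M X Y : measurable_fun setT X -> (forall o, `|X o| <= M) ->
  Int Y -> Int (fun o => X o * Y o).
Proof.
move=> mX XM iY; apply: (@Int_le _ (fun o => M * `|Y o|)).
- by apply: measurable_funM => //; exact: Int_meas.
- exact/IntZ/Int_norm.
- by move=> o; rewrite normrM ler_wpM2r.
Qed.

Lemma EFin_Ex X : Int X -> (Ex X)%:E = (\int[P]_o (X o)%:E)%E.
Proof. by move=> iX; rewrite fineK //; exact: integrable_fin_num. Qed.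

Lemma Ex_cst c : Ex (fun=> c) = c.
Proof.
rewrite /Ex Rintegral_cst // -[RHS]mulr1; congr (_ * _).
exact: (congr1 fine (probability_setT P)).
Qed.

Lemma ExD X Y : Int X -> Int Y -> Ex (fun o => X o + Y o) = Ex X + Ex Y.
Proof. by move=> iX iY; exact: RintegralD. Qed.

Lemma ExZ c X : Int X -> Ex (fun o => c * X o) = c * Ex X.
Proof. by move=> iX; exact: RintegralZl. Qed.

Lemma ExN X : Int X -> Ex (fun o => - X o) = - Ex X.
Proof.
by move=> iX; rewrite -mulN1r -ExZ //; apply: eq_Ex => o; rewrite mulN1r.
Qed.

Lemma ExB X Y : Int X -> Int Y -> Ex (fun o => X o - Y o) = Ex X - Ex Y.
Proof. by move=> iX iY; rewrite ExD ?ExN //; exact: IntN. Qed.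

Lemma Ex_sum I (r : seq I) (p : pred I) (h : I -> T -> R) :
  (forall i, p i -> Int (h i)) ->
  Ex (fun o => \sum_(i <- r | p i) h i o) = \sum_(i <- r | p i) Ex (h i).
Proof.
move=> ih; elim: r => [|i r IH].
  by rewrite big_nil -[RHS](Ex_cst 0); apply: eq_Ex => o; rewrite big_nil.
rewrite big_cons; case pi: (p i).
  rewrite -IH -ExD ?ih //; last exact: Int_sum.
  by apply: eq_Ex => o; rewrite big_cons pi.
by rewrite -IH; apply: eq_Ex => o; rewrite big_cons pi.
Qed.

Lemma Ex_ge0 X : (forall o, 0 <= X o) -> 0 <= Ex X.
Proof. by move=> X0; exact: Rintegral_ge0. Qed.

Lemma Ex_le X Y : Int X -> Int Y -> (forall o, X o <= Y o) -> Ex X <= Ex Y.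
Proof. by move=> iX iY XY; apply: le_Rintegral. Qed.

Lemma Ex_norm_le X : Int X -> `|Ex X| <= Ex (fun o => `|X o|).
Proof. by move=> iX; exact: le_normr_Rintegral. Qed.

Lemma Int_indic (S : set T) : measurable S -> Int (\1_S).
Proof. by move=> mS; exact: integrable_indic. Qed.

Lemma Ex_indic (S : set T) : measurable S -> Ex (\1_S) = fine (P S).
Proof. by move=> mS; rewrite /Ex /Rintegral integral_indic // setIT. Qed.

Lemma norm_indic (S : set T) o : `|(\1_S o : R)| <= 1.
Proof. by rewrite indicE; case: (_ \in _); rewrite ?normr1 // normr0. Qed.

Lemma Int_indicM (S : set T) X : measurable S -> Int X ->
  Int (fun o => \1_S o * X o).
Proof.
by move=> mS; apply: (@Int_boundedM 1) => // o; exact: norm_indic.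
Qed.

Lemma integral_setE (S : set T) X : measurable S -> Int X ->
  (\int[P]_(o in S) (X o)%:E)%E = (Ex (fun o => \1_S o * X o))%:E.
Proof.
move=> mS iX; rewrite EFin_Ex; last exact: Int_indicM.
rewrite integral_mkcond; apply: eq_integral => o _.
by rewrite patchE indicE; case: (_ \in _); rewrite ?mul1r ?mul0r.
Qed.

Lemma ae_eq_Ex X Y : measurable_fun setT X -> measurable_fun setT Y ->
  {ae P, forall o, X o = Y o} -> Ex X = Ex Y.
Proof.
move=> mX mY XY; congr fine; apply: ae_eq_integral => //.
- exact/measurable_EFinP.
- exact/measurable_EFinP.
- by apply: filterS XY => o -> _.
Qed.

Lemma Ex_cvg (Xn : nat -> T -> R) X Y :
  (forall k, measurable_fun setT (Xn k)) -> measurable_fun setT X -> Int Y ->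
  (forall k o, `|Xn k o| <= Y o) ->
  (forall o, (fun k => Xn k o) @ \oo --> X o) ->
  (fun k => Ex (Xn k)) @ \oo --> Ex X.
Proof.
move=> mXn mX iY le cv.
have cvE o : [set: T] o -> (fun k => (Xn k o)%:E) @ \oo --> (X o)%:E.
  by move=> _; apply: cvg_EFin (cv o); exact: nearW.
have leE o k : [set: T] o -> (`|(Xn k o)%:E| <= (Y o)%:E)%E.
  by move=> _; rewrite lee_fin.
have [iX _] := @dominated_convergence _ _ _ P setT measurableT
  (fun k => EFin \o Xn k) (EFin \o X) (EFin \o Y)
  (fun k => (measurable_EFinP _ _).2 (mXn k))
  ((measurable_EFinP _ _).2 mX)
  (aeW _ cvE)
  iY (aeW _ leE).
by rewrite -(EFin_Ex iX) => /fine_cvgP[].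
Qed.

End RealExpectation.

(** * Independence *)

Section Independence.
Context {R : realType} {dsp : measure_display} {T : measurableType dsp}.
Variable P : probability T R.
Implicit Types (A B D : set T) (F : set (T -> R)).

Definition pr A : R := fine (P A).

Lemma prE A : measurable A -> P A = (pr A)%:E.
Proof. by move=> mA; rewrite fineK // fin_num_measure. Qed.

Definition indep (U V : set (set T)) :=
  forall A B, U A -> V B -> pr (A `&` B) = pr A * pr B.

Lemma indep_sym U V : indep U V -> indep V U.
Proof. by move=> UV A B VA UB; rewrite setIC mulrC UV. Qed.

Lemma indep_sub U V U' V' : U' `<=` U -> V' `<=` V -> indep U V -> indep U' V'.
Proof. by move=> UU VV UV A B /UU ? /VV ?; exact: UV. Qed.

(** For fixed [B] both sides are finite measures in [A] that agree on a pi-system containing the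
    whole space, so uniqueness of measures applies. *)
Lemma indep_gen (G : set (set T)) B :
  G `<=` measurable -> setI_closed G -> G setT -> measurable B ->
  (forall A, G A -> pr (A `&` B) = pr A * pr B) ->
  forall A, <<s G >> A -> pr (A `&` B) = pr A * pr B.
Proof.
move=> Gm GI GT mB h A GA.
have prB0 : 0 <= pr B by exact: fine_ge0.
have sGm : <<s G >> `<=` measurable.
  by apply: smallest_sub => //; exact: sigma_algebra_measurable.
have restrE C : measurable C -> mrestr P mB C = (pr (C `&` B))%:E.
  by move=> mC; exact: (prE (measurableI _ _ mC mB)).
have scaleE C : measurable C -> mscale (NngNum prB0) P C = (pr B * pr C)%:E.
  by move=> mC; rewrite EFinM -(prE mC).
have : mrestr P mB A = mscale (NngNum prB0) P A.
  apply: (@g_sigma_algebra_measure_unique _ _ _ G Gm (fun=> setT)) => //.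
  - by rewrite bigcup_const //; exists 0%N.
  - move=> C GC; have mC := Gm _ GC.
    by rewrite [LHS]restrE // [RHS]scaleE // h // mulrC.
  - by move=> _; rewrite [ltLHS]restrE // ltry.
have mA := sGm _ GA.
by rewrite restrE // scaleE // => -[->]; rewrite mulrC.
Qed.

Definition intersections (U V : set (set T)) : set (set T) :=
  [set S | exists A B, [/\ U A, V B & S = A `&` B]].

Lemma sigma_of_union F1 F2 :
  sigma_of (F1 `|` F2) `<=` <<s intersections (sigma_of F1) (sigma_of F2) >>.
Proof.
apply: smallest_sub; first exact: smallest_sigma_algebra.
move=> S [f [[Ff|Ff] [B [mB ->]]]]; apply: sub_sigma_algebra.
  exists (f @^-1` B), setT; rewrite setIT; split => //.
    exact: (mw_preimage (mw_gen Ff)).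
  exact: sigma_of_setT.
exists setT, (f @^-1` B); rewrite setTI; split => //.
  exact: sigma_of_setT.
exact: (mw_preimage (mw_gen Ff)).
Qed.

(** The way to adjoin a new source [F3]. On the pi-system of intersections of C (from [F1]) and D
    (from [F3]), the event C and B lies in [sigma_of FC], so D splits off first and then C from B.
    This is why [FC] has to contain both [F1] and [F2]. *)
Lemma indep_join F1 F2 F3 FC :
  all_meas FC -> all_meas F3 ->
  (forall f, F1 f -> mw FC f) -> (forall f, F2 f -> mw FC f) ->
  indep (sigma_of F1) (sigma_of F2) -> indep (sigma_of FC) (sigma_of F3) ->
  indep (sigma_of (F1 `|` F3)) (sigma_of F2).
Proof.
move=> mFC mF3 F1C F2C i12 iC3 A B /sigma_of_union hA hB.
have s1 := sigma_of_sub F1C; have s2 := sigma_of_sub F2C.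
have mC := sigma_of_measurable mFC; have m3 := sigma_of_measurable mF3.
apply: (indep_gen _ _ _ _ _ hA).
- move=> S [C [D [/s1/mC mmC /m3 mD ->]]]; exact: measurableI.
- move=> S S' [C [D [hC hD ->]]] [C' [D' [hC' hD' ->]]].
  exists (C `&` C'), (D `&` D'); split; [exact: sigma_of_setI..|].
  by rewrite setIACA.
- by exists setT, setT; rewrite setIT; split => //; exact: sigma_of_setT.
- exact: (mC _ (s2 _ hB)).
- move=> S [C [D [hC hD ->]]].
  rewrite setIAC iC3 //; last by apply: sigma_of_setI; [exact: s1|exact: s2].
  by rewrite (i12 _ _ hC hB) (iC3 _ _ (s1 _ hC) hD) mulrAC.
Qed.

Lemma mutually_independent_seq (I : eqType) (F : I -> set (set T)) (s : seq I)
    (E : I -> set T) :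
  mutually_independent P F -> uniq s -> (forall i, i \in s -> F i (E i)) ->
  pr [set o | forall i, i \in s -> E i o] = \prod_(i <- s) pr (E i).
Proof.
move=> indF us FE; pose f (k : 'I_(size s)) := tnth (in_tuple s) k.
have fs k : f k \in s by exact: mem_tnth.
have injf : injective f by apply/tuple_uniqP.
rewrite (big_tnth _ _ s) -(indF _ f injf (E \o f)); last first.
  by move=> k; exact/FE/fs.
congr (fine (P _)); apply/seteqP; split => o /= h => [k _|i /(tnthP (in_tuple s))[k ->]].
  exact/h/fs.
exact: h.
Qed.

Lemma mutually_independent_sources (I : eqType) (G : I -> set (T -> R))
    (J1 J2 : set I) :
  (forall i, all_meas (G i)) -> mutually_independent P (fun i => sigma_of (G i)) ->
  J1 `&` J2 = set0 ->
  indep (sigma_of (\bigcup_(i in J1) G i)) (sigma_of (\bigcup_(i in J2) G i)).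
Proof.
move=> mG indG J12.
(* Finite intersections of source events form a pi-system that generates the sigma-algebra of [J];
   mutual independence speaks of these only. *)
pose cyl (J : set I) : set (set T) := [set S | exists s E, [/\ uniq s,
  forall i, i \in s -> J i /\ sigma_of (G i) (E i) &
  S = [set o | forall i, i \in s -> E i o]]].
have cylm J : cyl J `<=` measurable.
  move=> S [s [E [_ sE ->]]].
  have -> : [set o | forall i, i \in s -> E i o] = \bigcap_(i in [set` s]) E i.
    by apply/seteqP; split.
  apply: fin_bigcap_measurable; first exact: finite_seq.
  by move=> i /sE[_ GE]; exact: (sigma_of_measurable (mG i)).
have cylI J : setI_closed (cyl J).
  move=> S S' [s [E [us sE ->]]] [s' [E' [us' sE' ->]]].
  exists (undup (s ++ s')), (fun i => (if i \in s then E i else setT) `&`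
                                     (if i \in s' then E' i else setT)).
  split; first exact: undup_uniq.
    move=> i; rewrite mem_undup mem_cat => hi; split.
      by case/orP: hi => [/sE[]|/sE'[]].
    apply: sigma_of_setI.
      by case: ifPn => [/sE[]//|_]; exact: sigma_of_setT.
    by case: ifPn => [/sE'[]//|_]; exact: sigma_of_setT.
  apply/seteqP; split => o /= h.
    move=> i _; split; case: ifPn => // hi; first exact: h.1.
    exact: h.2.
  split => i hi; have := h i; rewrite mem_undup mem_cat hi ?orbT => /(_ isT)[] //.
have cylT J : cyl J setT.
  by exists [::], (fun=> setT); split => //; apply/seteqP; split.
have gen J : sigma_of (\bigcup_(i in J) G i) `<=` <<s cyl J >>.
  apply: smallest_sub; first exact: smallest_sigma_algebra.
  move=> S [f [[i Ji Gf] [B [mB ->]]]]; apply: sub_sigma_algebra.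
  exists [:: i], (fun=> f @^-1` B); split => //.
    move=> k; rewrite inE => /eqP ->; split => //.
    exact: (mw_preimage (mw_gen Gf)).
  apply/seteqP; split => o /= h; first by move=> k _.
  by apply: (h i); rewrite inE.
have sm J : <<s cyl J >> `<=` measurable.
  by apply: smallest_sub (@cylm J); exact: sigma_algebra_measurable.
move=> A B /gen hA /gen hB; apply: (indep_gen (@cylm J1) _ _ _ _ hA) => //.
  exact: sm hB.
move=> {A hA} A hA; rewrite setIC mulrC.
apply: (indep_gen (@cylm J2) _ _ _ _ hB) => //; first exact: cylm hA.
move=> {B hB} B [s' [E' [us' sE' ->]]]; case: hA => s [E [us sE ->]].
(* The two families of events merge into one because [J1] and [J2] share no index; the product rule
   for the concatenated list then factors. *)
pose E2 i := if i \in s then E i else E' i.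
have dis i : i \in s' -> i \notin s.
  move=> /sE'[J2i _]; apply/negP => /sE[J1i _].
  by have : (J1 `&` J2) i by []; rewrite J12.
have -> : [set o | forall i, i \in s' -> E' i o] `&`
          [set o | forall i, i \in s -> E i o] =
          [set o | forall i, i \in s ++ s' -> E2 i o].
  apply/seteqP; split => o /=.
    move=> [h' h] i; rewrite mem_cat /E2; case: ifPn => [/h//|_ /=].
    exact: h'.
  move=> h; split => i hi; have := h i; rewrite mem_cat hi ?orbT => /(_ isT);
    rewrite /E2 ?hi //.
  by rewrite (negbTE (dis i hi)).
rewrite (mutually_independent_seq indG) //; first last.
- move=> i; rewrite mem_cat /E2; case: ifPn => [/sE[]//|_ /=].
  by move=> /sE'[].
- by rewrite cat_uniq us us' andbT; apply/hasPn => i /dis.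
rewrite big_cat /= (mutually_independent_seq indG us); last by move=> i /sE[].
rewrite (mutually_independent_seq indG us'); last by move=> i /sE'[].
rewrite mulrC; congr (_ * _); apply: eq_big_seq => i hi; rewrite /E2 ?hi //.
by rewrite (negbTE (dis i hi)).
Qed.

End Independence.

(** * Integrating out an independent component *)

Section Freezing.
Context {R : realType} {dsp : measure_display} {T : measurableType dsp}.
Variable P : probability T R.
Implicit Types (F : set (T -> R)).

Section Marginal.
Variables (F : set (T -> R)) (mF : all_meas F).

Definition to_sig (o : T) : sigT F := o.

Lemma to_sig_measurable : measurable_fun setT to_sig.
Proof. by move=> _ A FA; rewrite setTI; exact: (sigma_of_measurable mF). Qed.

HB.instance Definition _ := isMeasurableFun.Build _ _ _ _ to_sig to_sig_measurable.

(** The restriction of [P] to [sigma_of F], obtained as the law of the identity map and therefore a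
    probability by construction. *)
Definition marginal : probability (sigT F) R := distribution P to_sig.

Lemma marginal_integrable (a : T -> R) : mw F a -> Int P a ->
  marginal.-integrable setT (EFin \o (a : sigT F -> R)).
Proof.
move=> /mwP ma ia.
apply: (integrable_pushforward to_sig_measurable) => //.
exact/measurable_EFinP.
Qed.

Lemma marginal_integral (a : T -> R) : mw F a -> Int P a ->
  (\int[marginal]_x (a x)%:E)%E = (Ex P a)%:E.
Proof.
move=> /mwP ma ia; rewrite EFin_Ex //.
apply: (integral_pushforward to_sig_measurable) => //.
exact/measurable_EFinP.
Qed.

End Marginal.

Section Product.
Variables (F1 F2 : set (T -> R)) (mF1 : all_meas F1) (mF2 : all_meas F2).
Hypothesis i12 : indep P (sigma_of F1) (sigma_of F2).

Let PA := marginal mF1.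
Let PB := marginal mF2.
Let diag (o : T) : sigT F1 * sigT F2 := (o, o).

Let diag_measurable : measurable_fun setT diag.
Proof.
by apply: measurable_fun_pair; [exact: (to_sig_measurable mF1)|
                                exact: (to_sig_measurable mF2)].
Qed.

HB.instance Definition _ := isMeasurableFun.Build _ _ _ _ diag diag_measurable.

(** Independence is exactly this equality on rectangles. *)
Let diagE X : measurable X -> (PA \x PB)%E X = distribution P diag X.
Proof.
apply: product_measure_unique => A B mA mB.
have mA' := sigma_of_measurable mF1 mA.
have mB' := sigma_of_measurable mF2 mB.
transitivity (P (A `&` B)); first by [].
transitivity (P A * P B)%E; last by [].
rewrite (prE P mA') (prE P mB') -EFinM -i12 //.
by rewrite (prE P (measurableI _ _ mA' mB')).
Qed.

Variables (f : T -> T -> R) (a b : T -> R).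
Hypothesis mf : measurable_fun [set: sigT F1 * sigT F2] (fun z => f z.1 z.2).
Hypotheses (ma : mw F1 a) (ia : Int P a) (mb : mw F2 b) (ib : Int P b).
Hypothesis fab : forall x y, `|f x y| <= a x * b y.

Let int_ab : (PA \x PB)%E.-integrable setT
  (fun z : sigT F1 * sigT F2 => (a z.1 * b z.2)%:E).
Proof.
have /mwP ma' := ma; have /mwP mb' := mb.
have m1 : measurable_fun setT (fun z : sigT F1 * sigT F2 => (a z.1 * b z.2)%:E).
  apply/measurable_EFinP; apply: measurable_funM.
    exact: (measurableT_comp ma' measurable_fst).
  exact: (measurableT_comp mb' measurable_snd).
have inb : mw F2 (fun y => `|b y|) by exact: mw_comp mb.
have ina : mw F1 (fun y => `|a y|) by exact: mw_comp ma.
apply/integrable12ltyP => //=.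
under eq_integral => x _.
  under eq_integral do rewrite normrM EFinM.
  rewrite integralZl //; last exact: (marginal_integrable mF2 inb (Int_norm ib)).
  rewrite (marginal_integral mF2 inb (Int_norm ib)) -EFinM mulrC.
  over.
have iab : Int P (fun x => Ex P (fun y => `|b y|) * `|a x|).
  exact/IntZ/Int_norm.
have mab : mw F1 (fun x => Ex P (fun y => `|b y|) * `|a x|).
  by apply: mwM => //; exact: mw_cst.
by rewrite (marginal_integral mF1 mab iab) ltry.
Qed.

Let int_f : (PA \x PB)%E.-integrable setT
  (fun z : sigT F1 * sigT F2 => (f z.1 z.2)%:E).
Proof.
apply: (le_integrable measurableT _ _ int_ab); first exact/measurable_EFinP.
by move=> z _ /=; rewrite lee_fin (le_trans (fab _ _)) // ler_norm.
Qed.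

Lemma freeze_section x : mw F2 (f x).
Proof. apply/mwP.
exact: (measurableT_comp mf (pair1_measurable (x : sigT F1))). Qed.

Lemma freeze_section_Int x : Int P (f x).
Proof.
apply: (Int_le _ (IntZ (a x) ib)) => //.
exact: (mw_measurable mF2 (freeze_section x)).
Qed.

Let innerE x : (\int[PB]_y (f x y)%:E)%E = (Ex P (f x))%:E.
Proof.
by apply: marginal_integral; [exact: freeze_section|exact: freeze_section_Int].
Qed.

Lemma freeze_inner : mw F1 (fun x => Ex P (f x)).
Proof.
apply/mwP; apply/measurable_EFinP; have := measurable_fubini_F int_f.
by congr measurable_fun; apply/funext => x; exact: innerE.
Qed.

Lemma freeze_inner_Int : Int P (fun x => Ex P (f x)).
Proof.
apply: (Int_le _ (IntZ (Ex P b) ia)).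
  exact: (mw_measurable mF1 freeze_inner).
move=> x; apply: (le_trans (Ex_norm_le (freeze_section_Int x))).
rewrite mulrC -ExZ //.
by apply: Ex_le; [exact/Int_norm/freeze_section_Int|exact: IntZ|].
Qed.

Lemma freeze_diag_Int : Int P (fun o => f o o).
Proof.
apply/integrableP; split.
  exact/measurable_EFinP/(measurableT_comp mf diag_measurable).
have /integrableP[_] := int_f.
have -> : (\int[PA \x PB]_z `|(f z.1 z.2)%:E|)%E =
          (\int[distribution P diag]_z `|(f z.1 z.2)%:E|)%E.
  by apply: eq_measure_integral => A mA _; exact: diagE.
rewrite ge0_integral_distribution //.
by do 2 apply: measurableT_comp => //.
Qed.

(** The diagonal map has the product law, so the left side is a double integral and Fubini applies.
    The product bound [fab] makes every section integrable, not merely almost every one. *)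
Lemma freeze : Ex P (fun o => f o o) = Ex P (fun x => Ex P (f x)).
Proof.
apply: EFin_inj; rewrite -(marginal_integral mF1 freeze_inner freeze_inner_Int).
under eq_integral do rewrite -innerE.
rewrite (integral12_prod_meas1 int_f) (EFin_Ex freeze_diag_Int).
have -> : (\int[PA \x PB]_z (f z.1 z.2)%:E)%E =
          (\int[distribution P diag]_z (f z.1 z.2)%:E)%E.
  by apply: eq_measure_integral => A mA _; exact: diagE.
rewrite integral_distribution //; first exact/measurable_EFinP.
exact: freeze_diag_Int.
Qed.

End Product.

Lemma indep_Ex_mul F1 F2 (X Y : T -> R) : all_meas F1 -> all_meas F2 ->
  indep P (sigma_of F1) (sigma_of F2) -> mw F1 X -> mw F2 Y ->
  Int P X -> Int P Y ->
  Int P (fun o => X o * Y o) /\ Ex P (fun o => X o * Y o) = Ex P X * Ex P Y.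
Proof.
move=> mF1 mF2 i12 mX mY iX iY.
have mX' : mw F1 (fun o => `|X o|) by exact: mw_comp mX.
have mY' : mw F2 (fun o => `|Y o|) by exact: mw_comp mY.
have mXY : measurable_fun [set: sigT F1 * sigT F2] (fun z => X z.1 * Y z.2).
  have /mwP mX'' := mX; have /mwP mY'' := mY; apply: measurable_funM.
    exact: (measurableT_comp mX'' measurable_fst).
  exact: (measurableT_comp mY'' measurable_snd).
have le x y : `|X x * Y y| <= `|X x| * `|Y y| by rewrite normrM.
split.
  exact: (freeze_diag_Int (f := fun x y => X x * Y y) mF1 mF2 i12 mXY mX' (Int_norm iX) mY' (Int_norm iY) le).
rewrite (freeze (f := fun x y => X x * Y y) mF1 mF2 i12 mXY mX' (Int_norm iX) mY' (Int_norm iY) le).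
rewrite mulrC -ExZ //; apply: eq_Ex => o; rewrite mulrC -ExZ //.
Qed.

End Freezing.

(** * The Cramer-Wold device *)

Section SignLimits.
Context {R : realType}.
Implicit Types x y : R.

(* The iterates of s |-> (3 s - s^3) / 2 converge to the sign on [-1, 1]. *)
Definition sharpen x := (3 * x - x ^+ 3) / 2.

Lemma sharpenN x : sharpen (- x) = - sharpen x.
Proof. by rewrite /sharpen; field. Qed.

Lemma iter_sharpenN n x : iter n sharpen (- x) = - iter n sharpen x.
Proof. by elim: n => //= n ->; rewrite sharpenN. Qed.

(** Since [1 - sharpen y] factors as [(1 - y) * (1 - y / 2 - y ^+ 2 / 2)], the distance to 1
    contracts geometrically as long as the iterates stay above [x]. *)
Lemma sharpen_bound x y : 0 < x -> x <= y -> y <= 1 ->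
  [/\ x <= sharpen y, sharpen y <= 1 & 1 - sharpen y <= (1 - y) * (1 - x / 2)].
Proof.
move=> x0 xy y1; have y0 : 0 < y by exact: lt_le_trans xy.
have h1 : sharpen y - y = y * (1 - y) * (1 + y) / 2 by rewrite /sharpen; field.
have h2 : 1 - sharpen y = (1 - y) * (1 - y / 2 - y ^+ 2 / 2).
  by rewrite /sharpen; field.
have h3 : 1 - sharpen y = (1 - y) ^+ 2 * (2 + y) / 2 by rewrite /sharpen; field.
split.
- apply: (le_trans xy); rewrite -subr_ge0 h1.
  by apply: divr_ge0 => //; do 2 (apply: mulr_ge0; last lra); lra.
- by rewrite -subr_ge0 h3; apply: divr_ge0 => //; apply: mulr_ge0; rewrite ?sqr_ge0 //; lra.
- rewrite h2 ler_wpM2l ?subr_ge0 //; have := sqr_ge0 y; lra.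
Qed.

Lemma iter_sharpen_cvg_pos x : 0 < x <= 1 ->
  (fun n => iter n sharpen x) @ \oo --> (1 : R).
Proof.
move=> /andP[x0 x1].
have H n : [/\ x <= iter n sharpen x, iter n sharpen x <= 1 &
               1 - iter n sharpen x <= (1 - x / 2) ^+ n].
  elim: n => [|n [a b c]]; first by rewrite /= expr0; split => //; lra.
  have [a' b' c'] := sharpen_bound x0 a b; split => //=.
  rewrite exprSr (le_trans c') // ler_wpM2r //; lra.
have g : (fun n => (1 - x / 2) ^+ n) @ \oo --> (0 : R).
  by apply: cvg_expr; rewrite ger0_norm; lra.
have g1 : (fun n => 1 - (1 - x / 2) ^+ n) @ \oo --> (1 : R).
  by rewrite -[X in _ --> X](subr0 1); apply: cvgB => //; exact: cvg_cst.
apply: (squeeze_cvgr _ g1 (cvg_cst (1 : R))).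
by apply: nearW => n; have [_ ? ?] := H n; apply/andP; split => //; lra.
Qed.

Lemma iter_sharpen_cvg x : `|x| <= 1 ->
  (fun n => iter n sharpen x) @ \oo --> Num.sg x.
Proof.
move=> x1; have [x0|x0|->] := ltrgt0P x.
- by rewrite gtr0_sg //; apply: iter_sharpen_cvg_pos; rewrite x0 -(gtr0_norm x0).
- rewrite ltr0_sg //.
  have -> : (fun n => iter n sharpen x) = (fun n => - iter n sharpen (- x)).
    by apply/funext => n; rewrite iter_sharpenN opprK.
  apply: cvgN; apply: iter_sharpen_cvg_pos.
  by rewrite oppr_gt0 x0 -(ltr0_norm x0) x1.
- rewrite sgr0 (_ : (fun n => _) = fun=> 0); first exact: cvg_cst.
  apply/funext => n; elim: n => //= n ->.
  by rewrite /sharpen; field.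
Qed.

Lemma iter_sharpen_le1 n x : `|x| <= 1 -> `|iter n sharpen x| <= 1.
Proof.
move=> x1; elim: n => //= n; set y := iter n sharpen x => y1.
have h y' : 0 < y' -> y' <= 1 -> `|sharpen y'| <= 1.
  move=> y0 y1'; have [a b _] := sharpen_bound y0 (lexx _) y1'.
  by rewrite ger0_norm //; lra.
have [y0|y0|->] := ltrgt0P y.
- by apply: h => //; rewrite -(gtr0_norm y0).
- rewrite -normrN -sharpenN; apply: h; first lra.
  by rewrite -(ltr0_norm y0).
- by rewrite (_ : sharpen 0 = 0) ?normr0 // /sharpen; field.
Qed.

(** The sequence is eventually constant: once the scaled angle lies strictly between -pi and pi, its
    sine has the sign of [y]. *)
Lemma sg_sin_cvg y :
  (fun n => Num.sg (sin (n.+1%:R^-1 * y))) @ \oo --> Num.sg y.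
Proof.
have pos (z : R) : 0 < z -> \forall n \near \oo, Num.sg (sin (n.+1%:R^-1 * z)) = 1.
  move=> z0; near=> n; apply: gtr0_sg; apply: sin_gt0_pi.
  rewrite mulr_gt0 ?invr_gt0 //=.
  rewrite mulrC ltr_pdivrMr //; apply: (@lt_le_trans _ _ n.+1%:R).
    near: n; apply: filterS (nbhs_infty_gtr z) => n zn.
    by apply: (lt_trans zn); rewrite ltr_nat.
  by rewrite ler_peMl //; have := @pi_ge2 R; lra.
have [y0|y0|->] := ltrgt0P y.
- by rewrite gtr0_sg //; apply: cvg_near_cst; exact: pos.
- rewrite ltr0_sg //; apply: cvg_near_cst.
  apply: filterS (pos (- y) _); last by rewrite oppr_gt0.
  by move=> n; rewrite mulrN sinN sgrN => h; rewrite -[LHS]opprK h.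
- rewrite sgr0 (_ : (fun n => _) = fun=> 0); first exact: cvg_cst.
  by apply/funext => n; rewrite mulr0 sin0 sgr0.
Unshelve. all: by end_near. Qed.

(** The shift by [n.+1%:R^-1] settles the case [y = 0], where the unshifted expression would give
    one half. *)
Lemma sg_indic_cvg y :
  (fun n => (1 + Num.sg (y - n.+1%:R^-1)) / 2) @ \oo --> ((0 < y)%R%:R : R).
Proof.
have [y0|y0] := ltP 0 y.
  apply: cvg_near_cst; near=> n.
  rewrite gtr0_sg; first by rewrite -[true%:R]/(1 : R); lra.
  rewrite subr_gt0 invf_plt ?posrE //.
  near: n; apply: filterS (nbhs_infty_gtr y^-1) => n yn.
  by apply: (lt_trans yn); rewrite ltr_nat.
rewrite -[false%:R]/(0 : R) (_ : (fun n => _) = fun=> 0); first exact: cvg_cst.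
apply/funext => n; rewrite ltr0_sg; first lra.
by rewrite subr_lt0 (le_lt_trans y0) // invr_gt0.
Unshelve. all: by end_near. Qed.

(** Writes a rounding of [y] as a sum of indicators of level sets; it supplies the staircase
    approximations in [bounded_class]. *)
Lemma count_below (N : nat) y : 0 <= y <= N%:R ->
  y - 1 <= \sum_(j < N) ((j.+1%:R < y)%R%:R : R) <= y.
Proof.
elim: N y => [|N IH] y /andP[y0 yN].
  by rewrite big_ord0; apply/andP; split; lra.
rewrite big_ord_recr /=.
have -> : (N.+1%:R < y) = false by apply/negbTE; rewrite -leNgt.
rewrite addr0; have [yN'|yN'] := leP y N%:R; first by apply: IH; rewrite y0.
rewrite (eq_bigr (fun=> 1)) ?sumr_const ?card_ord; last first.
  move=> j _; rewrite (_ : (_ < _)%R = true) //.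
  by apply: le_lt_trans yN'; rewrite ler_nat ltn_ord.
by rewrite -natr1 in yN; apply/andP; split; lra.
Qed.

End SignLimits.

(** * A functional monotone class theorem *)

Section BoundedClass.
Context {R : realType} {T : pointedType}.
Variable F : set (T -> R).
Variable H : (T -> R) -> Prop.
Hypothesis H1 : forall S, sigma_of F S -> H (\1_S).
Hypothesis HD : forall f g, H f -> H g -> H (fun o => f o + g o).
Hypothesis HZ : forall c f, H f -> H (fun o => c * f o).
Hypothesis Hlim : forall (fn : nat -> T -> R) (f : T -> R) (c : R), (forall n, H (fn n)) ->
  (forall n o, `|fn n o| <= c) -> (forall o, (fun n => fn n o) @ \oo --> f o) ->
  H f.

Let H0 : H (fun=> 0).
Proof.
have := HZ 0 (H1 (@sigma_of_setT _ _ F)).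
by congr H; apply/funext => o; rewrite mul0r.
Qed.

Lemma bounded_class f c : mw F f -> (forall o, `|f o| <= c) -> H f.
Proof.
move=> mf fc; have [C cC] : exists C : nat, c <= C%:R.
  exists (Num.truncn c).+1; exact/ltW/truncnS_gt.
have {}fc o : - C%:R <= f o <= C%:R by rewrite -ler_norml (le_trans (fc o)).
(* After the shift by [C] the values lie in [0, 2C], which needs this many levels of height
   1/(n+1). *)
pose N n := (2 * C * n.+1)%N.
pose y n o : R := (f o + C%:R) * n.+1%:R.
have yN n o : 0 <= y n o <= (N n)%:R.
  have /andP[a b] := fc o; rewrite /y /N natrM ler_pM2r // mulr_ge0 //=; last lra.
  by rewrite natrM; lra.
pose fn n o : R := n.+1%:R^-1 * \sum_(j < N n) (j.+1%:R < y n o)%R%:R + - C%:R.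
have fnP n o : f o - n.+1%:R^-1 <= fn n o <= f o.
  have /andP[a b] := count_below (yN n o).
  have n0 : 0 < n.+1%:R^-1 :> R by rewrite invr_gt0.
  have yE : f o = n.+1%:R^-1 * y n o - C%:R.
    by rewrite /y mulrC mulfK ?addrK // pnatr_eq0.
  apply/andP; split; rewrite /fn yE.
    by rewrite addrAC lerD2r -[X in _ - X]mulr1 -mulrBr ler_pM2l.
  by rewrite lerD2r ler_pM2l.
have n1 n : n.+1%:R^-1 <= 1 :> R by rewrite invf_le1 // ler1n.
(* The staircase may fall below [f] by one step, which is at most 1. *)
apply: (Hlim (fn := fn) (c := C%:R + 1)).
- move=> n; apply: HD; last first.
    have := HZ (- C%:R) (H1 (@sigma_of_setT _ _ F)).
    by congr H; apply/funext => o; rewrite indicE in_setT mulr1.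
  apply: HZ; elim: (N n) => [|k IH].
    by apply: eq_ind H0 _ _; apply/funext => o; rewrite big_ord0.
  suff h : H (fun o => (k.+1%:R < y n o)%R%:R).
    by have := HD IH h; congr H; apply/funext => o; rewrite big_ord_recr.
  pose S := [set o | k.+1%:R < y n o].
  have -> : (fun o => (k.+1%:R < y n o)%R%:R) = \1_S :> (T -> R).
    apply/funext => o; rewrite indicE; congr ((nat_of_bool _)%:R).
    by apply/idP/idP => [h|/set_mem]; [exact/mem_set|].
  apply: H1.
  have my : mw F (y n) by apply: mwM; [apply: mwD => //|]; exact: mw_cst.
  have -> : S = (y n) @^-1` `]k.+1%:R, +oo[%classic.
    by apply/seteqP; split => o; rewrite /S /= in_itv /= andbT.
  by apply: (mw_preimage my); exact: measurable_itv.
- move=> n o; have /andP[a b] := fnP n o; have /andP[a' b'] := fc o.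
  move: (n1 n) a b a' b'; set u := n.+1%:R^-1; set v := fn n o => u1 a b a' b'.
  by rewrite ler_norml; apply/andP; split; lra.
- move=> o; apply: (@squeeze_cvgr _ _ _ _ (fun n => f o - n.+1%:R^-1) (fun=> f o)).
  + by apply: nearW => n; exact: fnP.
  + rewrite -[X in _ --> X]subr0; apply: cvgB; first exact: cvg_cst.
    exact: cvg_harmonic.
  + exact: cvg_cst.
Qed.

End BoundedClass.

Lemma mw_cvg (R : realType) (T : pointedType) (F : set (T -> R))
    (fn : nat -> T -> R) (f : T -> R) :
  (forall n, mw F (fn n)) -> (forall o, (fun n => fn n o) @ \oo --> f o) -> mw F f.
Proof.
move=> mfn fnf; apply/mwP; apply: (@measurable_fun_cvg _ (sigT F) R setT fn f).
  by move=> n; apply/mwP.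
by move=> o _; exact: fnf.
Qed.

Lemma cvg_norm_le (R : realType) (u : nat -> R) (l c : R) :
  (forall n, `|u n| <= c) -> u @ \oo --> l -> `|l| <= c.
Proof.
by move=> uc ul; apply: (cvgr_to_le (cvg_norm ul)); apply: nearW => n /=.
Qed.

(* No Fourier analysis is needed: multiplication by trigonometric monomials
   preserves the class [K] below, and the indicator of [Z_i > b] is a pointwise
   limit of trigonometric polynomials. *)
Section CramerWold.
Context {R : realType} {T : pointedType} {k : nat}.
Variable Z : T -> 'cV[R]_k.
Variable Phi : (T -> R) -> R.

Definition bounded_mw (f : T -> R) :=
  mw (entries Z) f /\ exists c, forall o, `|f o| <= c.

Definition trig (b : bool) (a : 'cV[R]_k) (o : T) : R :=
  if b then cos ((a^T *m Z o) 0 0) else sin ((a^T *m Z o) 0 0).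

Hypothesis PhiD : forall f g, bounded_mw f -> bounded_mw g ->
  Phi (fun o => f o + g o) = Phi f + Phi g.
Hypothesis PhiZ : forall c f, bounded_mw f -> Phi (fun o => c * f o) = c * Phi f.
Hypothesis Philim : forall (fn : nat -> T -> R) (f : T -> R) (c : R),
  (forall n, mw (entries Z) (fn n)) -> mw (entries Z) f ->
  (forall n o, `|fn n o| <= c) -> (forall o, (fun n => fn n o) @ \oo --> f o) ->
  (forall n, Phi (fn n) = 0) -> Phi f = 0.
Hypothesis Phitrig : forall b a, Phi (trig b a) = 0.

Let Zmw : mxmw (entries Z) Z.
Proof. exact: mxmw_entries. Qed.

Let trig_bounded b a : bounded_mw (trig b a).
Proof.
have h : mw (entries Z) (fun o => (a^T *m Z o) 0 0).
  by apply: mxmwM Zmw 0 0; exact: mxmw_cst.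
split; last by exists 1 => o; rewrite /trig; case: b; [exact: cos_max|exact: sin_max].
case: b; rewrite /trig; apply: mw_comp h; apply: continuous_measurable_fun.
  exact: continuous_cos.
exact: continuous_sin.
Qed.

Let bmD f g : bounded_mw f -> bounded_mw g -> bounded_mw (fun o => f o + g o).
Proof.
move=> [mf [c fc]] [mg [d gd]]; split; first exact: mwD.
by exists (c + d) => o; rewrite (le_trans (ler_normD _ _)) // lerD.
Qed.

Let bmM f g : bounded_mw f -> bounded_mw g -> bounded_mw (fun o => f o * g o).
Proof.
move=> [mf [c fc]] [mg [d gd]]; split; first exact: mwM.
by exists (c * d) => o; rewrite normrM ler_pM.
Qed.

Let bmZ c f : bounded_mw f -> bounded_mw (fun o => c * f o).
Proof.
by apply: bmM; split; [exact: mw_cst|exists `|c|].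
Qed.

Let K f := bounded_mw f /\ forall b a, Phi (fun o => f o * trig b a o) = 0.

Let KD f g : K f -> K g -> K (fun o => f o + g o).
Proof.
move=> [bf Kf] [bg Kg]; split; first exact: bmD.
move=> b a; rewrite (_ : (fun o => _) =
    fun o => f o * trig b a o + g o * trig b a o).
  by rewrite PhiD ?Kf ?Kg ?addr0 //; exact: bmM.
by apply/funext => o; rewrite mulrDl.
Qed.

Let KZ c f : K f -> K (fun o => c * f o).
Proof.
move=> [bf Kf]; split; first exact: bmZ.
move=> b a; rewrite (_ : (fun o => _) = fun o => c * (f o * trig b a o)).
  by rewrite PhiZ ?Kf ?mulr0 //; apply: bmM.
by apply/funext => o; rewrite mulrA.
Qed.

Let Klim (fn : nat -> T -> R) f c : (forall n, K (fn n)) ->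
  (forall n o, `|fn n o| <= c) -> (forall o, (fun n => fn n o) @ \oo --> f o) ->
  K f.
Proof.
move=> Kfn fnc fnf.
have mf : mw (entries Z) f by apply: mw_cvg fnf => n; have [[]] := Kfn n.
have fc o : `|f o| <= c by apply: cvg_norm_le (fnf o).
split; first by split => //; exists c.
move=> b a; have [mt [d td]] := trig_bounded b a.
apply: (Philim (fn := fun n o => fn n o * trig b a o) (c := c * d)).
- by move=> n; apply: mwM => //; have [[]] := Kfn n.
- exact: mwM.
- by move=> n o; rewrite normrM ler_pM.
- by move=> o; apply: cvgM; [exact: fnf|exact: cvg_cst].
- by move=> n; have [_ ->] := Kfn n.
Qed.

Let Ktrig f b a : K f -> K (fun o => f o * trig b a o).
Proof.
move=> [bf Kf]; split; first exact: bmM.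
move=> b' a'.
(* Product-to-sum formulas: a product of two monomials combines the monomials of frequencies
   [a + a'] and [a - a'], with the same function, cosine or sine, in both. *)
have [b1 [c1 [c2 E]]] : exists b1 c1 c2, forall o,
    trig b a o * trig b' a' o =
    c1 * trig b1 (a + a') o + c2 * trig b1 (a - a') o.
  have D o (s : R) : ((a + s *: a')^T *m Z o) 0 0 =
      (a^T *m Z o) 0 0 + s * (a'^T *m Z o) 0 0.
    by rewrite linearD linearZ /= mulmxDl -scalemxAl !mxE.
  have P1 o : ((a + a')^T *m Z o) 0 0 = (a^T *m Z o) 0 0 + (a'^T *m Z o) 0 0.
    by rewrite -[a']scale1r D mul1r scale1r.
  have P2 o : ((a - a')^T *m Z o) 0 0 = (a^T *m Z o) 0 0 - (a'^T *m Z o) 0 0.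
    by rewrite -scaleN1r D mulN1r.
  case: b; case: b'.
  - by exists true, 2^-1, 2^-1 => o; rewrite /trig P1 P2 cosD cosB; field.
  - by exists false, 2^-1, (- 2^-1) => o; rewrite /trig P1 P2 sinD sinB; field.
  - by exists false, 2^-1, 2^-1 => o; rewrite /trig P1 P2 sinD sinB; field.
  - by exists true, (- 2^-1), 2^-1 => o; rewrite /trig P1 P2 cosD cosB; field.
rewrite (_ : (fun o => _) = fun o => c1 * (f o * trig b1 (a + a') o) +
                                   c2 * (f o * trig b1 (a - a') o)).
  rewrite PhiD; try by apply: bmZ; apply: bmM.
  by rewrite !PhiZ ?Kf ?mulr0 ?addr0 //; apply: bmM.
by apply/funext => o; rewrite -mulrA E; ring.
Qed.

Let K1 : K (\1_[set: T]).
Proof.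
split; first by split; [apply: mw_set; exact: sigma_of_setT|exists 1 => o; rewrite indicE in_setT normr1].
move=> b a; rewrite (_ : (fun o => _) = trig b a) ?Phitrig //.
by apply/funext => o; rewrite indicE in_setT mul1r.
Qed.

Let Kcst f c : K f -> K (fun o => f o * c).
Proof.
move=> Kf; have := KZ c Kf.
by congr K; apply/funext => o; rewrite mulrC.
Qed.

Let Zi (i : 'I_k) (c : R) o : ((c *: delta_mx i 0 : 'cV[R]_k)^T *m Z o) 0 0 = c * Z o i 0.
Proof.
rewrite linearZ /= -scalemxAl mxE; congr (_ * _).
rewrite trmx_delta mxE (bigD1 i) //= big1 ?addr0.
  by rewrite mxE !eqxx mul1r.
by move=> j ji; rewrite mxE (negbTE ji) andbF mul0r.
Qed.

Let Ksin f (i : 'I_k) (c b : R) : K f -> K (fun o => f o * sin (c * (Z o i 0 - b))).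
Proof.
move=> Kf.
have := KD (Kcst (cos (c * b)) (Ktrig false (c *: delta_mx i 0) Kf))
           (Kcst (- sin (c * b)) (Ktrig true (c *: delta_mx i 0) Kf)).
by congr K; apply/funext => o; rewrite /trig !Zi mulrBr sinB; ring.
Qed.

Let Ksharpen (i : 'I_k) (c b : R) n f : K f ->
  K (fun o => f o * iter n sharpen (sin (c * (Z o i 0 - b)))).
Proof.
elim: n f => [|n IH] f Kf; first exact: Ksin.
(* The cubic term of [sharpen] is a threefold multiplication by the previous iterate. *)
have K3 := IH _ (IH _ (IH _ Kf)).
have := KD (Kcst (3 / 2) (IH _ Kf)) (Kcst (- 2^-1) K3).
by congr K; apply/funext => o; rewrite [iter n.+1 _ _]/= /sharpen; field.
Qed.

Let Ksg f (i : 'I_k) b : K f -> K (fun o => f o * Num.sg (Z o i 0 - b)).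
Proof.
move=> Kf; have [[_ [c fc]] _] := Kf.
have sg1 x : `|Num.sg x| <= 1 :> R by rewrite normr_sg; case: (_ != _).
(* Two nested limits: the inner one sharpens a sine to its sign, the outer one lets the period tend
   to infinity. *)
apply: (Klim (c := c) (fn := fun n o =>
  f o * Num.sg (sin (n.+1%:R^-1 * (Z o i 0 - b))))).
- move=> n; apply: (Klim (c := c) (fn := fun m o =>
    f o * iter m sharpen (sin (n.+1%:R^-1 * (Z o i 0 - b))))).
  + by move=> m; exact: Ksharpen.
  + move=> m o; rewrite normrM -[leRHS]mulr1 ler_pM //.
    by apply: iter_sharpen_le1; exact: sin_max.
  + move=> o; apply: cvgM; first exact: cvg_cst.
    by apply: iter_sharpen_cvg; exact: sin_max.
- by move=> n o; rewrite normrM -[leRHS]mulr1 ler_pM.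
- move=> o; apply: cvgM; first exact: cvg_cst.
  exact: sg_sin_cvg.
Qed.

Let Kgt f (i : 'I_k) b : K f -> K (fun o => f o * (b < Z o i 0)%R%:R).
Proof.
move=> Kf; have [[_ [c fc]] _] := Kf.
have sg1 x : `|Num.sg x| <= 1 :> R by rewrite normr_sg; case: (_ != _).
apply: (Klim (c := c) (fn := fun n o =>
  f o * ((1 + Num.sg (Z o i 0 - b - n.+1%:R^-1)) / 2))).
- move=> n; have := KD (Kcst 2^-1 Kf) (Kcst 2^-1 (Ksg i (b + n.+1%:R^-1) Kf)).
  by congr K; apply/funext => o; rewrite opprD addrA; field.
- move=> n o; rewrite normrM -[leRHS]mulr1 ler_pM //.
  have := sg1 (Z o i 0 - b - n.+1%:R^-1); set u := Num.sg _.
  by rewrite !ler_norml => /andP[? ?]; apply/andP; split; lra.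
- move=> o; apply: cvgM; first exact: cvg_cst.
  by rewrite -subr_gt0; exact: sg_indic_cvg.
Qed.

Let rays : set (set T) := [set S | exists s : seq ('I_k * R),
  S = [set o | all (fun p => p.2 < Z o p.1 0) s]].

Let Krays S : rays S -> K (\1_S).
Proof.
move=> [s ->]; elim: s => [|[i b] s IH].
  by move: K1; congr (K (\1_ _)); apply/seteqP; split.
have := Kgt i b IH; congr K; apply/funext => o.
rewrite !indicE -natrM mulnb; congr ((nat_of_bool _)%:R).
apply/idP/idP.
  by move=> /andP[/set_mem /= h1 h2]; apply/mem_set => /=; rewrite h2.
by move=> /set_mem /= /andP[h1 h2]; rewrite h1 andbT; exact/mem_set.
Qed.

Lemma cramer_wold S : sigma_of (entries Z) S -> Phi (\1_S) = 0.
Proof.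
(* The cosine of frequency zero is the constant 1, so membership in [K] contains the claim. *)
move=> hS; suff [_ /(_ true 0) h] : K (\1_S).
  rewrite -[RHS]h; congr Phi; apply/funext => o.
  by rewrite /trig linear0 mul0mx mxE cos0 mulr1.
have sub : sigma_of (entries Z) `<=` <<s rays >>.
  apply: smallest_sub; first exact: smallest_sigma_algebra.
  move=> _ [f [[i ->] [B [mB ->]]]].
  have : measurable_fun [set: g_sigma_algebraType rays]
           ((fun o => Z o i 0) : g_sigma_algebraType rays -> R).
    apply: (measurability _ (RGenOInfty.measurableE R)) => _ [C [x ->] <-].
    apply: sub_sigma_algebra; exists [:: (i, x)]; rewrite setTI.
    by apply/seteqP; split => o; rewrite /= in_itv /= !andbT.
  by move=> /(_ measurableT B mB); rewrite setTI.
apply: (@dynkin_induction _ (g_sigma_algebraType rays) rays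
          (fun S => K (\1_S)) erefl _ K1 Krays _ _ S (sub _ hS)).
- move=> A B [s ->] [s' ->]; exists (s ++ s').
  by apply/seteqP; split => o; rewrite /= all_cat => /andP.
- move=> A _ KA; have := KD K1 (KZ (-1) KA); congr K; apply/funext => o.
  rewrite !indicE in_setT in_setC; case: (o \in A); rewrite /=; lra.
- move=> Fs mFs tFs KFs.
  (* By disjointness a point meets at most one of the sets, so the partial sums are bounded by 1 and
     [Klim] covers the countable union. *)
  have sumE N o j : Fs j o -> \sum_(i < N) (\1_(Fs i) o : R) = (j < N)%N%:R.
    move=> hj; have E i : \1_(Fs i) o = (i == j)%:R :> R.
      rewrite indicE; congr ((nat_of_bool _)%:R); apply/idP/eqP.
        move=> /set_mem hi; apply: contrapT => /eqP ij.
        have := (trivIsetP.1 tFs) i j Logic.I Logic.I ij; apply/eqP/set0P.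
        by exists o.
      by move=> ->; exact/mem_set.
    elim: N => [|N IH]; first by rewrite big_ord0.
    rewrite big_ord_recr /= IH E -natrD ltnS (eq_sym N).
    by case: (ltngtP j N).
  have sum0 N o : ~ (exists j, Fs j o) -> \sum_(i < N) (\1_(Fs i) o : R) = 0.
    move=> no; apply: big1 => i _; rewrite indicE memNset // => hi.
    by apply: no; exists i.
  apply: (Klim (c := 1) (fn := fun N o => \sum_(j < N) (\1_(Fs j) o : R))).
  + elim=> [|N IH].
      have := KZ 0 K1; congr K; apply/funext => o.
      by rewrite big_ord0 mul0r.
    have := KD IH (KFs N).
    by congr K; apply/funext => o; rewrite big_ord_recr.
  + move=> N o; have [[j hj]|no] := pselect (exists j, Fs j o).
      by rewrite (sumE _ _ _ hj); case: (j < N)%N; rewrite ?normr1 ?normr0.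
    by rewrite (sum0 _ _ no) normr0.
  + move=> o; have [[j hj]|no] := pselect (exists j, Fs j o).
      apply: cvg_near_cst; near=> N; rewrite (sumE _ _ _ hj).
      rewrite indicE mem_set; last by exists j.
      by rewrite (_ : (j < N)%N = true) //; near: N; exact: nbhs_infty_gt.
    rewrite indicE memNset; last by move=> [j _ hj]; apply: no; exists j.
    apply: cvg_near_cst; apply: nearW => N; exact: sum0.
Unshelve. all: by end_near. Qed.

End CramerWold.

(** * Independence and symmetry from characteristic functions *)

Section CramerWoldConsequences.
Context {R : realType} {dsp : measure_display} {T : measurableType dsp}.
Variable P : probability T R.

Lemma entries_meas k (X : T -> 'cV[R]_k) : rvec X -> all_meas (entries X).
Proof. by move=> mX f [i ->]; exact: mX. Qed.

Lemma mxmw_rvec F k (X : T -> 'cV[R]_k) : all_meas F -> mxmw F X -> rvec X.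
Proof. by move=> mF mX i; exact: mw_measurable (mX i 0). Qed.

Lemma trig_le1 k (Z : T -> 'cV[R]_k) b a o : `|trig Z b a o| <= 1.
Proof. by rewrite /trig; case: b; [exact: cos_max|exact: sin_max]. Qed.

Lemma trig_meas k (Z : T -> 'cV[R]_k) b a : rvec Z -> measurable_fun setT (trig Z b a).
Proof.
move=> mZ; apply: (mw_measurable (entries_meas mZ)).
have h : mw (entries Z) (fun o => (a^T *m Z o) 0 0).
  apply: (mxmwM (mxmw_cst _ (a^T)) _ 0 0); exact: mxmw_entries.
case: b; rewrite /trig; apply: mw_comp h; apply: continuous_measurable_fun.
  exact: continuous_cos.
exact: continuous_sin.
Qed.

Lemma cramer_wold_weight k (Z : T -> 'cV[R]_k) (V : T -> R) c : rvec Z ->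
  measurable_fun setT V -> (forall o, `|V o| <= c) ->
  (forall b a, Ex P (fun o => trig Z b a o * V o) = 0) ->
  forall S, sigma_of (entries Z) S -> Ex P (fun o => \1_S o * V o) = 0.
Proof.
move=> mZ mV Vc Htrig S hS.
have mE := entries_meas mZ.
have iV : Int P V by exact: (Int_bounded P mV Vc).
have iM f : bounded_mw Z f -> Int P (fun o => f o * V o).
  move=> [mf [d fd]]; apply: Int_boundedM fd iV; exact: mw_measurable mf.
apply: (cramer_wold (Phi := fun f => Ex P (fun o => f o * V o))) hS => //.
- move=> f g bf bg; rewrite -ExD ?iM //.
  by apply: eq_Ex => o; rewrite mulrDl.
- by move=> d f bf; rewrite -ExZ ?iM //; apply: eq_Ex => o; rewrite mulrA.
- move=> fn f d mfn mf fnd fnf fn0.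
  have cv : (fun n => Ex P (fun o => fn n o * V o)) @ \oo -->
            Ex P (fun o => f o * V o).
    apply: (Ex_cvg (Y := fun=> d * c)).
    + by move=> n; apply: measurable_funM => //; exact: (mw_measurable mE).
    + by apply: measurable_funM => //; exact: (mw_measurable mE).
    + exact: Int_cst.
    + by move=> n o; rewrite normrM ler_pM.
    + by move=> o; apply: cvgM; [exact: fnf|exact: cvg_cst].
  apply: (cvg_unique _ cv) => //.
  by rewrite (_ : (fun n => _) = fun=> 0); [exact: cvg_cst|exact/funext].
Qed.

(** The joint characteristic function is real and factorizes. Monomials are then traded for
    indicators one vector at a time, each time with a centred bounded weight in
    [cramer_wold_weight]. *)
Lemma cramer_wold_indep k l (X : T -> 'cV[R]_k) (Y : T -> 'cV[R]_l) :
  rvec X -> rvec Y ->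
  (forall (a : 'cV[R]_k) (b : 'cV[R]_l), Ex P (fun o => cos ((a^T *m X o) 0 0 + (b^T *m Y o) 0 0)) =
    Ex P (trig X true a) * Ex P (trig Y true b)) ->
  (forall (a : 'cV[R]_k) (b : 'cV[R]_l), Ex P (fun o => sin ((a^T *m X o) 0 0 + (b^T *m Y o) 0 0)) = 0) ->
  indep P (sigma_of (entries X)) (sigma_of (entries Y)).
Proof.
move=> mX mY hc hs.
have iT kk (Z : T -> 'cV[R]_kk) b a : rvec Z -> Int P (trig Z b a).
  by move=> mZ; apply: (@Int_bounded _ _ _ P 1) (trig_meas _ _ mZ) (trig_le1 _ _ _).
have iTT b a b' a' : Int P (fun o => trig X b a o * trig Y b' a' o).
  apply: Int_boundedM (trig_meas _ _ mX) (trig_le1 _ _ _) _; exact: iT.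
have sX a : Ex P (trig X false a) = 0.
  rewrite -[RHS](hs a 0); apply: eq_Ex => o.
  by rewrite trmx0 mul0mx [X in _ + X]mxE addr0.
have sY b : Ex P (trig Y false b) = 0.
  rewrite -[RHS](hs 0 b); apply: eq_Ex => o.
  by rewrite trmx0 mul0mx [X in X + _]mxE add0r.
have cY b : Ex P (trig Y true (- b)) = Ex P (trig Y true b).
  by apply: eq_Ex => o; rewrite /trig linearN mulNmx mxE cosN.
have N (b : 'cV[R]_l) o : ((- b)^T *m Y o) 0 0 = - (b^T *m Y o) 0 0.
  by rewrite linearN mulNmx mxE.
have iC (s : bool) (a : 'cV[R]_k) (b : 'cV[R]_l) : Int P (fun o => (if s then cos else sin)
    ((a^T *m X o) 0 0 + (b^T *m Y o) 0 0)).
  have E : (fun o => (if s then cos else sin)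
      ((a^T *m X o) 0 0 + (b^T *m Y o) 0 0)) =1
    fun o => trig X s a o * trig Y true b o +
     (if s then -1 else 1) * (trig X (~~ s) a o * trig Y false b o).
    by move=> o; case: s; rewrite /trig /= ?cosD ?sinD; ring.
  by apply: eq_Int (fsym E) _; apply: IntD => //; exact: IntZ.
(* The hypotheses at [a'] and at [- a'] separate the products of cosines from the products of sines;
   evenness of the cosine in [Y] closes each case. *)
have F b a b' a' : Ex P (fun o => trig X b a o * trig Y b' a' o) =
    Ex P (trig X b a) * Ex P (trig Y b' a').
  case: b; case: b'.
  - transitivity (2^-1 * (Ex P (trig X true a) * Ex P (trig Y true a')) +
                  2^-1 * (Ex P (trig X true a) * Ex P (trig Y true (- a')))).
      rewrite -!hc -!ExZ -?ExD; try apply: IntZ; try exact: (iC true).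
      apply: eq_Ex => o; rewrite N cosB cosD /trig; by field.
    by rewrite cY; field.
  - rewrite sY mulr0.
    transitivity (2^-1 * 0 + - 2^-1 * 0 : R); last by rewrite !mulr0 addr0.
    rewrite -{1}(hs a a') -(hs a (- a')) -!ExZ -?ExD; try apply: IntZ; try exact: (iC false).
    apply: eq_Ex => o; rewrite N sinB sinD /trig; by field.
  - rewrite sX mul0r.
    transitivity (2^-1 * 0 + 2^-1 * 0 : R); last by rewrite !mulr0 addr0.
    rewrite -{1}(hs a a') -(hs a (- a')) -!ExZ -?ExD; try apply: IntZ; try exact: (iC false).
    apply: eq_Ex => o; rewrite N sinB sinD /trig; by field.
  - rewrite sX mul0r.
    transitivity (- 2^-1 * (Ex P (trig X true a) * Ex P (trig Y true a')) +
                  2^-1 * (Ex P (trig X true a) * Ex P (trig Y true (- a')))).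
      rewrite -!hc -!ExZ -?ExD; try apply: IntZ; try exact: (iC true).
      apply: eq_Ex => o; rewrite N cosB cosD /trig; by field.
    by rewrite cY; field.
have step1 A b' a' : sigma_of (entries X) A ->
    Ex P (fun o => \1_A o * trig Y b' a' o) = pr P A * Ex P (trig Y b' a').
  move=> hA; have mA := sigma_of_measurable (entries_meas mX) hA.
  set m := Ex P (trig Y b' a').
  have := @cramer_wold_weight _ X (fun o => trig Y b' a' o - m) (1 + `|m|) mX.
  move=> /(_ _ _ _ A hA) h; apply/eqP; rewrite -subr_eq0 -h.
  - rewrite -[pr P A](Ex_indic P mA) mulrC -ExZ; last exact: Int_indic.
    rewrite -(ExB (Int_indicM mA (iT _ _ b' a' mY)) (IntZ m (Int_indic P mA))).
    by apply/eqP/eq_Ex => o; ring.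
  - by apply: measurable_funB => //; exact: trig_meas.
  - move=> o; rewrite (le_trans (ler_normB _ _)) // lerD2r; exact: trig_le1.
  - move=> b a.
    rewrite -[RHS](subrr (Ex P (trig X b a) * m)).
    rewrite -{1}F [X in _ - X]mulrC -ExZ; last exact: iT.
    rewrite -(ExB (iTT b a b' a') (IntZ m (iT _ _ b a mX))).
    by apply: eq_Ex => o; ring.
move=> A B hA hB.
have mA := sigma_of_measurable (entries_meas mX) hA.
have mB := sigma_of_measurable (entries_meas mY) hB.
have := @cramer_wold_weight _ Y (fun o => \1_A o - pr P A) (1 + `|pr P A|) mY.
move=> /(_ _ _ _ B hB) h; apply/eqP; rewrite -subr_eq0 -h.
- rewrite -[pr P (A `&` B)](Ex_indic P (measurableI _ _ mA mB)) -[pr P B](Ex_indic P mB).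
  rewrite -ExZ; last exact: Int_indic.
  rewrite -(ExB (Int_indic P (measurableI _ _ mA mB)) (IntZ _ (Int_indic P mB))).
  by apply/eqP/eq_Ex => o; rewrite indicI /=; ring.
- by apply: measurable_funB.
- move=> o; rewrite (le_trans (ler_normB _ _)) // lerD2r; exact: norm_indic.
- move=> b a.
  rewrite -[RHS](subrr (pr P A * Ex P (trig Y b a))).
  rewrite -{1}step1 // -ExZ; last exact: iT.
  rewrite -(ExB (Int_indicM mA (iT _ _ b a mY)) (IntZ _ (iT _ _ b a mY))).
  by apply: eq_Ex => o; ring.
Qed.

(** A characteristic function without imaginary part means that [Z] and [- Z] have the same law. The
    functional is the difference of the two expectations, and the device is applied to the identity
    of the space of values. *)
Lemma cramer_wold_sym k (Z : T -> 'cV[R]_k) : rvec Z ->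
  (forall a, Ex P (trig Z false a) = 0) ->
  forall (f : 'cV[R]_k -> R) (c : R), mw (entries (@id 'cV[R]_k)) f ->
    (forall x, `|f x| <= c) -> Ex P (fun o => f (- Z o)) = Ex P (fun o => f (Z o)).
Proof.
move=> mZ hs f c mf fc; pose I := entries (@id 'cV[R]_k).
pose Phi g := Ex P (fun o => g (Z o)) - Ex P (fun o => g (- Z o)).
have mZ' : mxmw (entries Z) Z by exact: mxmw_entries.
have meas g (X : T -> 'cV[R]_k) : mxmw (entries Z) X -> mw I g ->
    measurable_fun setT (fun o => g (X o)).
  move=> mX mg; apply: (mw_measurable (entries_meas mZ)).
  have bg : borel_map (fun x : 'cV[R]_k => g x *: (1 : 'cV[R]_1)).
    move=> i B mB; have := mw_preimage mg mB; congr sigma_of.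
    by apply/seteqP; split => x; rewrite /= ord1 !mxE mulr1.
  have := mxmw_borel bg mX 0 0; apply: eq_mw => o.
  by rewrite !mxE mulr1.
have m1 g : mw I g -> measurable_fun setT (fun o => g (Z o)) by exact: meas.
have m2 g : mw I g -> measurable_fun setT (fun o => g (- Z o)).
  by apply: meas; exact: mxmwN.
have i1 g : bounded_mw id g -> Int P (fun o => g (Z o)).
  by move=> [mg [d gd]]; apply: (@Int_bounded _ _ _ P d) => [|o]; [exact: m1|exact: gd].
have i2 g : bounded_mw id g -> Int P (fun o => g (- Z o)).
  by move=> [mg [d gd]]; apply: (@Int_bounded _ _ _ P d) => [|o]; [exact: m2|exact: gd].
have PhiD g h : bounded_mw id g -> bounded_mw id h ->
    Phi (fun o => g o + h o) = Phi g + Phi h.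
  move=> bg bh; rewrite /Phi.
  by rewrite (ExD (i1 _ bg) (i1 _ bh)) (ExD (i2 _ bg) (i2 _ bh)); ring.
have PhiZ e g : bounded_mw id g -> Phi (fun o => e * g o) = e * Phi g.
  by move=> bg; rewrite /Phi (ExZ e (i1 _ bg)) (ExZ e (i2 _ bg)); ring.
have Philim (gn : nat -> 'cV[R]_k -> R) (g : 'cV[R]_k -> R) (d : R) :
    (forall n, mw I (gn n)) -> mw I g -> (forall n x, `|gn n x| <= d) ->
    (forall x, (fun n => gn n x) @ \oo --> g x) ->
    (forall n, Phi (gn n) = 0) -> Phi g = 0.
  move=> mgn mg gd cvg g0.
  have cv : (fun n => Phi (gn n)) @ \oo --> Phi g.
    apply: cvgB; apply: (Ex_cvg (Y := fun=> d)) => //; try exact: Int_cst.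
    - by move=> n; exact: m1.
    - exact: m1.
    - by move=> n; exact: m2.
    - exact: m2.
  apply: (cvg_unique _ cv) => //.
  by rewrite (_ : (fun n => _) = fun=> 0); [exact: cvg_cst|exact/funext].
have ind A : sigma_of I A -> Phi (\1_A) = 0.
  apply: (@cramer_wold _ _ _ id Phi) => // b a; rewrite /Phi.
  have tE o : trig id b a (Z o) = trig Z b a o by [].
  have tE' o : trig id b a (- Z o) = (if b then 1 else -1) * trig Z b a o.
    rewrite /trig mulmxN mxE; case: (b); first by rewrite cosN mul1r.
    by rewrite sinN mulN1r.
  rewrite (eq_Ex _ tE) (eq_Ex _ tE') ExZ; last first.
    by apply: (Int_bounded P (trig_meas _ _ mZ) (M := 1)) => o; exact: trig_le1.
  by clear tE tE'; case: b; rewrite ?hs; ring.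
pose H g := bounded_mw id g /\ Phi g = 0.
suff [_ /eqP] : H f by rewrite subr_eq0 => /eqP.
apply: (bounded_class (F := I) (H := H)) mf fc.
- move=> A hA; split; last exact: ind.
  split; first exact: mw_set.
  by exists 1 => x; rewrite indicE; case: (_ \in _); rewrite ?normr1 ?normr0.
- move=> g h [[mg [cg gc]] g0] [[mh [ch hc]] h0]; split.
    split; first exact: mwD.
    by exists (cg + ch) => x; rewrite (le_trans (ler_normD _ _)) // lerD.
  by rewrite PhiD ?g0 ?h0 ?addr0 //; split => //; [exists cg|exists ch].
- move=> e g [[mg [cg gc]] g0]; split.
    split; first by apply: mwM => //; exact: mw_cst.
    by exists (`|e| * cg) => x; rewrite normrM ler_wpM2l.
  by rewrite PhiZ ?g0 ?mulr0 //; split => //; exists cg.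
- move=> gn g d Hgn gd cvg.
  have mg : mw I g by apply: mw_cvg cvg => n; have [[]] := Hgn n.
  split; first by split => //; exists d => x; apply: cvg_norm_le (cvg x).
  by apply: Philim gd cvg _ => // n; have [[]] := Hgn n.
Qed.

End CramerWoldConsequences.

(** * Gaussian vectors *)

Section NormalCharacteristic.
Context {R : realType}.
Variable s : R.
Hypothesis s0 : 0 < s.

Let g := normal_pdf 0 s.
Let c : R := normal_peak s.
Let b : R := (s ^+ 2 *+ 2)^-1.
Notation mu := (@lebesgue_measure R).

Let gE x : g x = c * expR (- b * x ^+ 2).
Proof.
rewrite /g normal_pdfE ?gt_eqF // /normal_fun subr0.
by rewrite -/b -/c; congr (_ * expR _); ring.
Qed.

Let c0 : 0 < c. Proof. by apply: normal_peak_gt0; rewrite gt_eqF. Qed.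

Let is_derive_g (x : R) : is_derive x (1 : R) g (- (x / s ^+ 2) * g x).
Proof.
have -> : g = c \*: (expR \o ((- b) \*: (id ^+ 2))).
  by apply/funext => y; rewrite gE.
apply: is_derive_eq; rewrite /= /GRing.scale /= expr1 -[(id ^+ 2) x]/(x ^+ 2).
set E := expR _; rewrite /b -mulr_natr; field.
by rewrite gt_eqF.
Qed.

Let g_ge0 x : 0 <= g x. Proof. exact: normal_pdf_ge0. Qed.

Let g_int : mu.-integrable setT (EFin \o g).
Proof. exact: integrable_normal_pdf. Qed.

Let g_meas : measurable_fun setT g.
Proof. exact: measurable_normal_pdf. Qed.

Let g_cont : continuous g.
Proof. by apply: continuous_normal_pdf; rewrite gt_eqF. Qed.

Let bounded_g_int (h : R -> R) : measurable_fun setT h -> (forall x, `|h x| <= 1) ->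
  mu.-integrable setT (EFin \o (fun x => h x * g x)).
Proof.
move=> mh h1; apply: (le_integrable measurableT _ _ g_int).
  by apply/measurable_EFinP; exact: measurable_funM.
move=> x _ /=; rewrite lee_fin normrM -[leRHS]mul1r ler_wpM2r //.
Qed.

Let idg_int : mu.-integrable setT (EFin \o (fun x => `|x| * g x)).
Proof.
(* With [u] equal to [x ^+ 2 / (4 * s ^+ 2)] the density is a multiple of [expR (- u)] squared. One
   factor absorbs [|x|], because [|x| <= s * (1 + u)]; the other is a normal density of doubled
   variance. *)
pose s' := Num.sqrt 2 * s.
have s'2 : s' ^+ 2 = 2 * s ^+ 2 by rewrite exprMn sqr_sqrtr.
have s'0 : s' != 0 by rewrite mulf_neq0 ?gt_eqF // sqrtr_gt0.
pose C := s * c / normal_peak s'.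
have C0 : 0 <= C.
  by rewrite divr_ge0 ?normal_peak_ge0 // mulr_ge0 // ltW.
apply: (le_integrable measurableT _ _
  (integrableZl measurableT C (integrable_normal_pdf 0 s'))).
  by apply/measurable_EFinP; exact: measurable_funM.
move=> x _ /=; rewrite lee_fin.
rewrite [leLHS]ger0_norm; last by rewrite mulr_ge0.
rewrite [leRHS]ger0_norm; last by rewrite mulr_ge0 // normal_pdf_ge0.
rewrite gE normal_pdfE // /normal_fun subr0 s'2.
pose u := x ^+ 2 / (4 * s ^+ 2).
have sn0 : s != 0 by rewrite gt_eqF.
have uE : - x ^+ 2 / (2 * s ^+ 2 *+ 2) = - u.
  by rewrite /u -mulr_natl; field.
have vE : - b * x ^+ 2 = - u - u.
  by rewrite /u /b -mulr_natl; field.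
have pk : normal_peak s' != 0 by rewrite gt_eqF // normal_peak_gt0.
rewrite uE vE expRD (_ : C * _ = c * expR (- u) * s); last by rewrite /C; field.
rewrite (_ : `|x| * _ = c * expR (- u) * (`|x| * expR (- u))); last by ring.
apply: ler_wpM2l; first by rewrite mulr_ge0 ?expR_ge0 // ltW.
rewrite expRN ler_pdivrMr ?expR_gt0 //.
apply: (@le_trans _ _ (s * (1 + u))); last first.
  by rewrite ler_pM2l // expR_ge1Dx.
have -> : s * (1 + u) = `|x| + (`|x| / 2 - s) ^+ 2 / s.
  by rewrite /u -[in LHS](real_normK (num_real x)); field.
by rewrite lerDl divr_ge0 ?sqr_ge0 // ltW.
Qed.

Let tail_int (h : R -> R) : measurable_fun setT h -> (forall x, `|h x| <= 1) ->
  mu.-integrable setT (EFin \o (fun x => x * h x * g x)).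
Proof.
move=> mh h1; apply: (le_integrable measurableT _ _ idg_int).
  by apply/measurable_EFinP; do 2 apply: measurable_funM => //.
move=> x _ /=; rewrite lee_fin !normrM normr_id ler_wpM2r //.
by rewrite -[leRHS]mulr1 ler_wpM2l.
Qed.

Let mcos a : measurable_fun setT (fun x : R => cos (a * x)).
Proof.
apply: measurableT_comp; last exact: mulrl_measurable.
by apply: continuous_measurable_fun; exact: continuous_cos.
Qed.

Let msin a : measurable_fun setT (fun x : R => sin (a * x)).
Proof.
apply: measurableT_comp; last exact: mulrl_measurable.
by apply: continuous_measurable_fun; exact: continuous_sin.
Qed.

Let phi a : R := \int[mu]_x (cos (a * x) * g x).

Let phi' a : is_derive (a : R) (1 : R) phi (- \int[mu]_x (x * sin (a * x) * g x)).
Proof.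
pose f (t x : R) : R := cos (t * x) * g x.
have df (t x : R) : is_derive (t : R) (1 : R) (f ^~ x) (- (x * sin (t * x) * g x)).
  have -> : f ^~ x = g x \*: (cos \o (x \*: id)).
    by apply/funext => y; rewrite /f /= mulrC (mulrC y).
  apply: is_derive_eq; rewrite /= /GRing.scale /= (mulrC t x); ring.
have ddf (t x : R) : derivable (f ^~ x) t 1 by have [] := df t x.
have pf t x : partial1of2 f t x = - (x * sin (t * x) * g x).
  by rewrite partial1of2E; have := df t x => ?; rewrite derive_val.
have If t : `]a - 1, a + 1[%classic t -> mu.-integrable setT (EFin \o f t).
  move=> _; apply: bounded_g_int; first exact: mcos.
  by move=> x; exact: cos_max.
have Ia : `]a - 1, a + 1[%classic a by rewrite /= in_itv /=; apply/andP; split; lra.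
have dom t x : `]a - 1, a + 1[%classic t -> [set: R] x -> `|partial1of2 f t x| <= `|x| * g x.
  move=> _ _; rewrite pf normrN !normrM (ger0_norm (g_ge0 x)) ler_wpM2r //.
  by rewrite -[leRHS]mulr1 ler_wpM2l // sin_max.
have D := @derivable_under_integral R _ _ mu f setT measurableT a (a - 1) (a + 1)
  Ia If (fun t x _ _ => ddf t x) (fun x => `|x| * g x)
  (fun x => mulr_ge0 (normr_ge0 _) (g_ge0 x)) idg_int dom.
have E := @differentiation_under_integral R _ _ mu f setT measurableT a (a - 1) (a + 1)
  Ia If (fun t x _ _ => ddf t x) (fun x => `|x| * g x)
  (fun x => mulr_ge0 (normr_ge0 _) (g_ge0 x)) idg_int dom.
apply: DeriveDef; first exact: D.
rewrite -derive1E E.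
have -> : \int[mu]_y partial1of2 f a y = \int[mu]_y (- 1 * (y * sin (a * y) * g y)).
  by apply: eq_Rintegral => x _; rewrite pf mulN1r.
rewrite RintegralZl ?mulN1r //; apply: tail_int => //.
by move=> x; exact: sin_max.
Qed.

(* Integration by parts: the boundary terms [sin (a n) g(n)] vanish. *)
Let ibp a : \int[mu]_x (x * sin (a * x) * g x) = a * s ^+ 2 * phi a.
Proof.
pose h x := sin (a * x) * g x.
pose h' x := a * (cos (a * x) * g x) + - (s ^+ 2)^-1 * (x * sin (a * x) * g x).
have dh (x : R) : is_derive x (1 : R) h (h' x).
  have dg := is_derive_g x.
  have -> : h = (sin \o (a \*: id)) * g by [].
  apply: is_derive_eq; rewrite /= /GRing.scale /= /h'; ring.
have i1 : mu.-integrable setT (EFin \o (fun x => cos (a * x) * g x)).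
  by apply: bounded_g_int => // x; exact: cos_max.
have i2 : mu.-integrable setT (EFin \o (fun x => x * sin (a * x) * g x)).
  by apply: tail_int => // x; exact: sin_max.
have ih' : mu.-integrable setT (EFin \o h').
  exact: (integrableD measurableT (integrableZl measurableT a i1)
     (integrableZl measurableT (- (s ^+ 2)^-1) i2)).
have ch' : continuous h'.
  have ccos : continuous (fun x : R => cos (a * x)).
    move=> x; apply: (continuous_comp (f := fun y : R => a * y) (g := cos)).
      by apply: cvgM; [exact: cvg_cst|exact: cvg_id].
    exact: continuous_cos.
  have csin : continuous (fun x : R => sin (a * x)).
    move=> x; apply: (continuous_comp (f := fun y : R => a * y) (g := sin)).
      by apply: cvgM; [exact: cvg_cst|exact: cvg_id].
    exact: continuous_sin.
  move=> x; apply: cvgD; apply: cvgM; try exact: cvg_cst.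
    by apply: cvgM; [exact: ccos|exact: g_cont].
  apply: cvgM; last exact: g_cont.
  by apply: cvgM; [exact: cvg_id|exact: csin].
pose J (n : nat) : set R := `[- n.+1%:R, n.+1%:R]%classic.
have FTC (n : nat) : (\int[mu]_(x in J n) (h' x)%:E =
    (h n.+1%:R)%:E - (h (- n.+1%:R)%R)%:E)%E.
  apply: continuous_FTC2.
  - by rewrite gtrN.
  - exact: continuous_subspaceT.
  - have ch : continuous h.
      by move=> x; apply/differentiable_continuous/derivable1_diffP; have [] := dh x.
    split.
    + by move=> x _; have [] := dh x.
    + by apply: cvg_at_right_filter; exact: ch.
    + by apply: cvg_at_left_filter; exact: ch.
  - by move=> x _; rewrite derive1E; have ? := dh x; rewrite derive_val.
have b0 : 0 < b by rewrite invr_gt0 pmulrn_lgt0 // exprn_gt0.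
(* From [expR v >= 1 + v] the density decays at least like the inverse square, and a harmonic bound
   is all that is used. *)
have hb (n : nat) y : y ^+ 2 = n.+1%:R ^+ 2 -> `|h y| <= c / b * n.+1%:R^-1.
  move=> yn; have n0 : 0 < n.+1%:R :> R by [].
  apply: (@le_trans _ _ (g y)).
    by rewrite normrM (ger0_norm (g_ge0 y)) -[leRHS]mul1r ler_wpM2r // sin_max.
  rewrite gE yn -mulrA ler_pM2l // mulNr expRN -invfM lef_pV2 ?posrE ?expR_gt0 ?mulr_gt0 //.
  apply: (le_trans _ (expR_ge1Dx _)); rewrite -[leLHS]add0r lerD //.
  by rewrite ler_pM2l // expr2 ler_peMl // ler1n.
have lim0 : (fun n : nat => h n.+1%:R - h (- n.+1%:R)) @ \oo --> (0 : R).
  apply: norm_cvg0.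
  have hz : (fun n : nat => 2 * (c / b) * n.+1%:R^-1) @ \oo --> (0 : R).
    rewrite -(mulr0 (2 * (c / b))); apply: cvgM; first exact: cvg_cst.
    exact: cvg_harmonic.
  apply: (squeeze_cvgr _ (cvg_cst 0) hz); apply: nearW => n.
  rewrite normr_ge0 /= (le_trans (ler_normB _ _)) // mulr2n mulrDl mul1r mulrDl.
  by apply: lerD; apply: hb; rewrite ?sqrrN.
have dc : (fun n : nat => (\int[mu]_(x in J n) (h' x)%:E)%E) @ \oo
    --> (\int[mu]_x (h' x)%:E)%E.
  have mh' : measurable_fun setT h' by exact: continuous_measurable_fun.
  pose fn (n : nat) := (EFin \o h') \_ (J n).
  rewrite (_ : (fun n : nat => _) = fun n => (\int[mu]_x fn n x)%E); last first.
    by apply/funext => n; rewrite integral_mkcond.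
  have p1 n : measurable_fun setT (fn n).
    apply/(measurable_restrictT _ _).1; first exact: measurable_itv.
    by apply: measurable_funTS; exact/measurable_EFinP.
  have p2 : {ae mu, forall x, [set: R] x -> fn ^~ x @ \oo --> (EFin \o h') x}.
    apply: aeW => x _; apply: cvg_near_cst; near=> n.
    rewrite /fn patchE mem_set //= /J /= in_itv /= -ler_norml.
    near: n; apply: filterS (nbhs_infty_gtr `|x|) => n xn.
    by apply/ltW/(lt_trans xn); rewrite ltr_nat.
  have p3 : {ae mu, forall x n, [set: R] x ->
      (`|fn n x| <= (EFin \o (fun x => `|h' x|)%R) x)%E}.
    apply: aeW => x n _; rewrite /fn patchE; case: ifP => _ /=; first by [].
    by rewrite normr0 lee_fin.
  by have [_ _] := @dominated_convergence _ _ _ mu _ measurableT fn _ _ p1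
    ((measurable_EFinP _ _).2 mh') p2 (integrable_norm ih') p3.
have : \int[mu]_x h' x = 0.
  rewrite /Rintegral; apply: EFin_inj; rewrite fineK; last exact: integrable_fin_num.
  apply: (cvg_unique _ dc) => //.
  rewrite (_ : (fun n : nat => _) = fun n => (h n.+1%:R - h (- n.+1%:R))%:E).
    exact: cvg_EFin (nearW _ _) lim0.
  by apply/funext => n; rewrite FTC EFinB.
rewrite /h' RintegralD //; first last.
- exact: (integrableZl measurableT (- (s ^+ 2)^-1) i2).
- exact: (integrableZl measurableT a i1).
rewrite !RintegralZl // -/(phi a) => /eqP; rewrite addr_eq0 => /eqP.
set I := (X in _ * X) => E.
have -> : a * s ^+ 2 * phi a = s ^+ 2 * (a * phi a) by ring.
rewrite E; field; by rewrite gt_eqF.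
Unshelve. all: by end_near. Qed.

(** Differentiation under the integral and integration by parts show that the derivative of [phi] at
    [t] is [- t * s ^+ 2 * phi t]. With the integrating factor in [psi] the function becomes
    constant, and its value at 0 is the total mass. *)
Lemma normal_pdf_cos a : phi a = expR (- (a ^+ 2 * s ^+ 2) / 2).
Proof.
pose k := s ^+ 2 / 2.
pose psi (t : R) := expR (k * t ^+ 2) * phi t.
have dpsi (t : R) : is_derive t (1 : R) psi 0.
  have dphi := phi' t; rewrite ibp in dphi.
  have -> : psi = (expR \o (k \*: (id ^+ 2))) * phi by [].
  by apply: is_derive_eq; rewrite /= /GRing.scale /= expr1 /k; field.
have psi1 : psi a = 1.
  have -> : psi a = psi 0 by exact: (@is_derive_0_is_cst R psi a 0 dpsi).
  rewrite /psi expr0n mulr0 expR0 mul1r /phi.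
  rewrite (_ : (fun x => _) = g); last by apply/funext => x; rewrite mul0r cos0 mul1r.
  by rewrite /Rintegral integral_normal_pdf.
have : phi a = psi a * expR (- (k * a ^+ 2)).
  by rewrite /psi mulrAC -expRD subrr expR0 mul1r.
by rewrite psi1 mul1r => ->; congr expR; rewrite /k; field.
Qed.

End NormalCharacteristic.

(** * Gaussian vectors through their characteristic functions *)

Section GaussianVectors.
Context {R : realType} {dsp : measure_display} {T : measurableType dsp}.
Variable P : probability T R.
Notation mu := (@lebesgue_measure R).

(** A change of variables for the Radon-Nikodym derivative, which agrees almost everywhere with the
    density because both have the same integrals over measurable sets. *)
Lemma integral_normal_prob (s : R) (f : R -> R) (c : R) : measurable_fun setT f ->
  (forall x, `|f x| <= c) ->
  (\int[normal_prob 0 s]_x (f x)%:E = \int[mu]_x (f x * normal_pdf 0 s x)%:E)%E.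
Proof.
move=> mf fc.
pose nu : {finite_measure set _ -> \bar R} := normal_prob 0 s.
have dom : nu `<< mu by exact: normal_prob_dominates.
have inu : nu.-integrable setT (EFin \o f) by exact: (Int_bounded (normal_prob 0 s) mf fc).
have RN := @Radon_Nikodym_change_of_variables _ _ R nu mu dom _ setT measurableT inu.
have aeE : ae_eq mu setT (Radon_Nikodym (charge_of_finite_measure nu) mu)
    (EFin \o normal_pdf 0 s).
  apply: integral_ae_eq => //.
  - exact: Radon_Nikodym_integrable.
  - by apply/measurable_EFinP; exact: measurable_normal_pdf.
  - by move=> E _ mE; rewrite -Radon_Nikodym_integral.
rewrite -[LHS]RN; apply: ae_eq_integral => //.
- apply: emeasurable_funM; first exact/measurable_EFinP.
  exact: (measurable_int mu (Radon_Nikodym_integrable _)).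
- apply/measurable_EFinP; apply: measurable_funM => //.
  exact: measurable_normal_pdf.
- by apply: filterS aeE => x /= h _; rewrite h // EFinM.
Qed.

Lemma prob1_ae (A : set T) : measurable A -> P A = 1%E -> {ae P, forall o, A o}.
Proof.
move=> mA PA; exists (~` A); split => //; first exact: measurableC.
have -> : P (~` A) = (1 - P A)%E by exact: probability_setC.
by rewrite PA subee.
Qed.

Lemma qform_ge0 k (S : 'M[R]_k) a : psd S -> 0 <= qform S a.
Proof. by case=> _; apply. Qed.

(** Unlike [centred_gaussian] this needs no separate degenerate case, and its stability under linear
    maps and independent sums is a computation. *)
Definition gauss k (X : T -> 'cV[R]_k) (S : 'M[R]_k) :=
  [/\ rvec X, forall a, Ex P (trig X true a) = expR (- qform S a / 2) &
      forall a, Ex P (trig X false a) = 0].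

Lemma lform_measurable k (X : T -> 'cV[R]_k) (a : 'cV[R]_k) :
  rvec X -> measurable_fun setT (fun o => (a^T *m X o) 0 0).
Proof.
move=> mX; apply: (mw_measurable (entries_meas mX)).
apply: (mxmwM (mxmw_cst _ (a^T)) _ 0 0); exact: mxmw_entries.
Qed.

Lemma centred_gaussian_law k (X : T -> 'cV[R]_k) (S : 'M[R]_k) (a : 'cV[R]_k)
    (f : R -> R) (c : R) :
  psd S -> centred_gaussian P X S -> measurable_fun setT f ->
  (forall x, `|f x| <= c) ->
  Ex P (fun o => f ((a^T *m X o) 0 0)) =
  let s := Num.sqrt (qform S a) in
  if s == 0 then f 0 else fine (\int[mu]_x (f x * normal_pdf 0 s x)%:E).
Proof.
move=> pS [mX hX] mf fc; have := hX a; move=> /=.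
set s := Num.sqrt _; pose Y o := (a^T *m X o) 0 0.
have mY : measurable_fun setT Y by exact: lform_measurable.
case: eqVneq => [_ Y0|s0 law].
  rewrite -[RHS](Ex_cst P); apply: ae_eq_Ex => //; first exact: measurableT_comp.
  have mA : measurable (Y @^-1` [set 0]).
    by rewrite -[X in measurable X]setTI; exact: mY.
  by apply: filterS (prob1_ae mA Y0) => o; rewrite /Y /preimage /= => ->.
rewrite /Ex /Rintegral; congr fine; rewrite -(@integral_normal_prob s f c) //.
have mY' : @measurable_fun _ _ T (measurableTypeR R) setT Y by exact: mY.
pose Ym : {mfun T >-> measurableTypeR R} :=
  HB.pack (Y : T -> measurableTypeR R) (isMeasurableFun.Build _ _ _ _ _ mY').
have -> : (\int[normal_prob 0 s]_x (f x)%:E = \int[distribution P Ym]_x (f x)%:E)%E.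
  by apply: eq_measure_integral => A mA _; exact/esym/law.
rewrite integral_distribution //; first exact/measurable_EFinP.
by apply: (Int_bounded P _ (M := c)) => //; exact: measurableT_comp.
Qed.

Lemma centred_gaussian_gauss k (X : T -> 'cV[R]_k) (S : 'M[R]_k) :
  psd S -> centred_gaussian P X S -> gauss X S.
Proof.
move=> pS gX; have [mX _] := gX.
have mcos : measurable_fun setT (@cos R).
  by apply: continuous_measurable_fun; exact: continuous_cos.
have msin : measurable_fun setT (@sin R).
  by apply: continuous_measurable_fun; exact: continuous_sin.
split => // a.
- rewrite (centred_gaussian_law a pS gX mcos (@cos_max _)) /=.
  have q0 := qform_ge0 a pS; case: eqVneq => [s0|s0].
    have -> : qform S a = 0 by apply/eqP; rewrite eq_le q0 -sqrtr_eq0 s0 eqxx.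
    by rewrite cos0 oppr0 mul0r expR0.
  have sp : 0 < Num.sqrt (qform S a) by rewrite lt_neqAle eq_sym s0 sqrtr_ge0.
  have := normal_pdf_cos sp 1; rewrite expr1n mul1r sqr_sqrtr // => <-.
  by congr fine; apply: eq_integral => x _; rewrite mul1r.
(* The law of a linear form depends only on its variance, which is the same for [a] and [- a];
   oddness of the sine forces the value 0. *)
- have E1 := centred_gaussian_law a pS gX msin (@sin_max _).
  have E2 := centred_gaussian_law (- a) pS gX msin (@sin_max _).
  have qN : qform S (- a) = qform S a.
    by rewrite /qform [(- a)^T]linearN /= !(mulNmx, mulmxN) opprK.
  rewrite qN -E1 in E2.
  have E3 : Ex P (fun o => sin (((- a)^T *m X o) 0 0)) = - Ex P (trig X false a).
    rewrite -ExN; last first.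
      apply: (Int_bounded P (trig_meas _ _ mX) (M := 1)) => o; exact: trig_le1.
    by apply: eq_Ex => o; rewrite linearN /= mulNmx mxE sinN.
  rewrite E3 in E2; change (- Ex P (trig X false a) = Ex P (trig X false a)) in E2.
  lra.
Qed.

Lemma gauss_linear k l (X : T -> 'cV[R]_k) S (M : 'M[R]_(l, k)) :
  gauss X S -> gauss (fun o => M *m X o) (M *m S *m M^T).
Proof.
move=> [mX hc hs].
have E b a : trig (fun o => M *m X o) b a =1 trig X b (M^T *m a).
  by move=> o; rewrite /trig trmx_mul trmxK mulmxA.
split.
- apply: (mxmw_rvec (entries_meas mX)); apply: mxmwM; first exact: mxmw_cst.
  exact: mxmw_entries.
- move=> a; rewrite (eq_Ex _ (E true a)) hc; congr (expR (- _ / 2)).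
  by rewrite /qform trmx_mul trmxK !mulmxA.
- by move=> a; rewrite (eq_Ex _ (E false a)) hs.
Qed.

Lemma indep_trig k l (X : T -> 'cV[R]_k) (Y : T -> 'cV[R]_l) b a b' a' :
  rvec X -> rvec Y -> indep P (sigma_of (entries X)) (sigma_of (entries Y)) ->
  Int P (fun o => trig X b a o * trig Y b' a' o) /\
  Ex P (fun o => trig X b a o * trig Y b' a' o) = Ex P (trig X b a) * Ex P (trig Y b' a').
Proof.
move=> mX mY ind.
have mt kk (Z : T -> 'cV[R]_kk) b0 a0 : mw (entries Z) (trig Z b0 a0).
  have h : mw (entries Z) (fun o => (a0^T *m Z o) 0 0).
    apply: (mxmwM (mxmw_cst _ (a0^T)) _ 0 0); exact: mxmw_entries.
  case: b0; rewrite /trig; apply: mw_comp h; apply: continuous_measurable_fun.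
    exact: continuous_cos.
  exact: continuous_sin.
have iT kk (Z : T -> 'cV[R]_kk) b0 a0 : rvec Z -> Int P (trig Z b0 a0).
  move=> mZ; apply: (Int_bounded P (trig_meas _ _ mZ) (M := 1)) => o.
  exact: trig_le1.
apply: (indep_Ex_mul (entries_meas mX) (entries_meas mY) ind) => //; exact: iT.
Qed.

Lemma gauss_indep_sum k l (X : T -> 'cV[R]_k) (Y : T -> 'cV[R]_l) S S'
    (a : 'cV[R]_k) (b : 'cV[R]_l) :
  gauss X S -> gauss Y S' -> indep P (sigma_of (entries X)) (sigma_of (entries Y)) ->
  Ex P (fun o => cos ((a^T *m X o) 0 0 + (b^T *m Y o) 0 0)) =
    expR (- (qform S a + qform S' b) / 2) /\
  Ex P (fun o => sin ((a^T *m X o) 0 0 + (b^T *m Y o) 0 0)) = 0.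
Proof.
move=> [mX cX sX] [mY cY sY] ind.
have F c c' := indep_trig c a c' b mX mY ind.
have [i1 e1] := F true true; have [i2 e2] := F false false.
have [i3 e3] := F false true; have [i4 e4] := F true false.
split.
  rewrite (@eq_Ex _ _ _ P _ (fun o => trig X true a o * trig Y true b o -
                                trig X false a o * trig Y false b o)); last first.
    by move=> o; rewrite cosD.
  by rewrite ExB // e1 e2 cX cY sX mul0r subr0 -expRD; congr expR; field.
rewrite (@eq_Ex _ _ _ P _ (fun o => trig X false a o * trig Y true b o +
                              trig X true a o * trig Y false b o)); last first.
  by move=> o; rewrite sinD.
by rewrite ExD // e3 e4 sX sY mul0r mulr0 addr0.
Qed.

Lemma qformD k (S S' : 'M[R]_k) a : qform (S + S') a = qform S a + qform S' a.
Proof. by rewrite /qform mulmxDr mulmxDl mxE. Qed.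

Lemma qform_add k (M : 'M[R]_k) (x y : 'cV[R]_k) : M^T = M ->
  qform M (x + y) = qform M x + qform M y + 2 * (x^T *m M *m y) 0 0.
Proof.
move=> tM; rewrite /qform [(x + y)^T]linearD /= mulmxDl mulmxDl !mulmxDr.
have E : (y^T *m M *m x) 0 0 = (x^T *m M *m y) 0 0.
  by rewrite -[LHS]trace_mx11 -mxtrace_tr trace_mx11 !trmx_mul trmxK tM mulmxA.
have H (a b : 'M[R]_1) : (a + b) 0 0 = a 0 0 + b 0 0 by rewrite mxE.
by rewrite !H E; ring.
Qed.

Lemma gaussD k (X Y : T -> 'cV[R]_k) S S' :
  gauss X S -> gauss Y S' -> indep P (sigma_of (entries X)) (sigma_of (entries Y)) ->
  gauss (fun o => X o + Y o) (S + S').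
Proof.
move=> gX gY ind; have [mX _ _] := gX; have [mY _ _] := gY.
have E a o : (a^T *m (X o + Y o)) 0 0 = (a^T *m X o) 0 0 + (a^T *m Y o) 0 0.
  by rewrite mulmxDr mxE.
split.
- by move=> i; under eq_fun do rewrite mxE; exact: measurable_funD.
- move=> a; have [h _] := gauss_indep_sum a a gX gY ind.
  by rewrite qformD -h; apply: eq_Ex => o; rewrite /trig E.
- move=> a; have [_ h] := gauss_indep_sum a a gX gY ind.
  by rewrite -h; apply: eq_Ex => o; rewrite /trig E.
Qed.

(** In the exponent of the joint characteristic function the mixed term is twice [a^T] times the
    cross covariance times [b]; when it vanishes the exponential factorizes. *)
Lemma gauss_uncorrelated k l m n (X : T -> 'cV[R]_k) (Y : T -> 'cV[R]_l) S S'
    (A : 'M[R]_(m, k)) (B : 'M[R]_(m, l)) (C : 'M[R]_(n, k)) (D : 'M[R]_(n, l)) :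
  S^T = S -> S'^T = S' ->
  gauss X S -> gauss Y S' -> indep P (sigma_of (entries X)) (sigma_of (entries Y)) ->
  A *m S *m C^T + B *m S' *m D^T = 0 ->
  indep P (sigma_of (entries (fun o => A *m X o + B *m Y o)))
          (sigma_of (entries (fun o => C *m X o + D *m Y o))).
Proof.
move=> tS tS' gX gY ind cov.
have [mX _ _] := gX; have [mY _ _] := gY.
have gXY p (E : 'M[R]_(p, k)) (F : 'M[R]_(p, l)) :
    gauss (fun o => E *m X o + F *m Y o) (E *m S *m E^T + F *m S' *m F^T).
  apply: gaussD; [exact: gauss_linear|exact: gauss_linear|].
  apply: indep_sub ind; apply: sigma_of_sub => f [i ->];
    apply: (mxmwM (mxmw_cst _ _) _ i 0); exact: mxmw_entries.
have [m1 c1 s1] := gXY _ A B; have [m2 c2 s2] := gXY _ C D.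
have add00 p r (M N : 'M[R]_(p, r)) i j : (M + N) i j = M i j + N i j by rewrite mxE.
have L (a : 'cV[R]_m) (b : 'cV[R]_n) o :
   (a^T *m (A *m X o + B *m Y o)) 0 0 + (b^T *m (C *m X o + D *m Y o)) 0 0 =
   ((A^T *m a + C^T *m b)^T *m X o) 0 0 + ((B^T *m a + D^T *m b)^T *m Y o) 0 0.
  rewrite [(A^T *m a + _)^T]linearD [(B^T *m a + _)^T]linearD /=.
  by rewrite !trmx_mul !trmxK !mulmxDl !mulmxDr !mulmxA !add00; ring.
apply: cramer_wold_indep => // a b; last first.
  have [_ h] := gauss_indep_sum (A^T *m a + C^T *m b) (B^T *m a + D^T *m b) gX gY ind.
  by rewrite -h; apply: eq_Ex => o; rewrite L.
have [h _] := gauss_indep_sum (A^T *m a + C^T *m b) (B^T *m a + D^T *m b) gX gY ind.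
rewrite (eq_Ex _ (fun o => congr1 cos (L a b o))) h c1 c2 -expRD; congr expR.
suff -> : qform S (A^T *m a + C^T *m b) + qform S' (B^T *m a + D^T *m b) =
  qform (A *m S *m A^T + B *m S' *m B^T) a + qform (C *m S *m C^T + D *m S' *m D^T) b.
  by field.
have qM p r (Q : 'M[R]_p) (M : 'M[R]_(r, p)) (u : 'cV[R]_r) :
    qform (M *m Q *m M^T) u = qform Q (M^T *m u).
  by rewrite /qform trmx_mul trmxK !mulmxA.
rewrite !qform_add // !qformD !qM.
have : a^T *m (A *m S *m C^T + B *m S' *m D^T) *m b = 0.
  by rewrite cov mulmx0 mul0mx.
rewrite mulmxDr mulmxDl => /matrixP /(_ 0 0).
rewrite add00 [RHS]mxE !trmx_mul !trmxK !mulmxA => E.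
rewrite -[RHS]addr0 -(mulr0 2) -E; ring.
Qed.

Lemma norm_sin_le (x : R) : `|sin x| <= `|x|.
Proof.
wlog x0 : x / 0 <= x => [h|].
  have [/h//|x0] := leP 0 x.
  by rewrite -[`|sin x|]normrN -sinN -[`|x|]normrN h // oppr_ge0 ltW.
have cs : {within `[0, x], continuous (@sin R)}.
  by apply: continuous_subspaceT; exact: continuous_sin.
have [y _] := MVT_segment x0 (fun y _ => is_derive_sin y) cs.
rewrite sin0 !subr0 => ->; rewrite normrM -[leRHS]mul1r ler_wpM2r //.
exact: cos_max.
Qed.

Lemma sin_over_cvg (y : R) :
  (fun n : nat => sin (n.+1%:R^-1 * y) / n.+1%:R^-1) @ \oo --> y.
Proof.
have d : is_derive (0 : R) (1 : R) (sin \o (y \*: id)) y.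
  by apply: is_derive_eq; rewrite /= /GRing.scale /= mulr0 cos0; ring.
pose f : R -> R := sin \o (y \*: id); have [ex val] := d.
have cv : (fun h : R => h^-1 *: ((f \o shift 0) (h *: 1) - f 0)) @ 0^' --> y.
  by rewrite -[X in _ --> X]val; exact: ex.
have h : (forall n : nat, n.+1%:R^-1 != 0 :> R) /\
    (fun n : nat => n.+1%:R^-1 : R) @ \oo --> (0 : R).
  by split; [move=> n; rewrite invr_eq0 pnatr_eq0|exact: cvg_harmonic].
have := (cvgr_dnbhsP _ _ _).1 cv (fun n : nat => n.+1%:R^-1) h.
set g := fun n => _; suff -> : g = fun n => sin (n.+1%:R^-1 * y) / n.+1%:R^-1 by [].
apply/funext => n; rewrite /g /f /= /GRing.scale /= mulr1 addr0 mulr0 sin0 subr0.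
by rewrite [RHS]mulrC [_^-1 * y]mulrC.
Qed.

Lemma lform_delta k (Z : 'cV[R]_k) i : ((delta_mx i 0 : 'cV[R]_k)^T *m Z) 0 0 = Z i 0.
Proof.
rewrite trmx_delta mxE (bigD1 i) //= big1 ?addr0; first by rewrite mxE !eqxx mul1r.
by move=> j ji; rewrite mxE (negbTE ji) andbF mul0r.
Qed.

(* Both moments come from the characteristic function: the second one by
   Fatou's lemma, the first one by dominated convergence of sin(t X) / t. *)
Lemma gauss_moments k (X : T -> 'cV[R]_k) S i : psd S -> gauss X S ->
  [/\ Int P (fun o => X o i 0 ^+ 2), Int P (fun o => X o i 0) &
      Ex P (fun o => X o i 0) = 0].
Proof.
move=> pS [mX cX sX]; have mXi := mX i.
pose a : 'cV[R]_k := delta_mx i 0; pose q := qform S a.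
have q0 : 0 <= q by exact: qform_ge0.
pose t (n : nat) : R := n.+1%:R^-1.
have t0 n : 0 < t n by rewrite invr_gt0.
have aX r o : ((r *: a)^T *m X o) 0 0 = r * X o i 0.
  by rewrite linearZ /= -scalemxAl mxE lform_delta.
have mf n : measurable_fun setT (fun o => sin (t n * X o i 0) / t n).
  apply: measurable_funM => //; apply: measurableT_comp.
    by apply: continuous_measurable_fun; exact: continuous_sin.
  exact: measurable_funM.
have fb n o : `|sin (t n * X o i 0) / t n| <= (t n)^-1.
  by rewrite normrM [`|_^-1|]ger0_norm ?invr_ge0 ?(ltW (t0 n)) // -[leRHS]mul1r
    ler_wpM2r ?invr_ge0 ?(ltW (t0 n)) // sin_max.
have mf2 n : measurable_fun setT (fun o => (sin (t n * X o i 0) / t n) ^+ 2).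
  exact: measurable_funX.
have if2 n : Int P (fun o => (sin (t n * X o i 0) / t n) ^+ 2).
  apply: (@Int_bounded _ _ _ P ((t n)^-1 ^+ 2)) => // o.
  by rewrite normrX lerXn2r ?nnegrE ?invr_ge0 ?(ltW (t0 n)).
have Ef2 n : Ex P (fun o => (sin (t n * X o i 0) / t n) ^+ 2) <= q.
  have ic : Int P (trig X true ((2 * t n) *: a)).
    by apply: (Int_bounded P (trig_meas _ _ mX) (M := 1)) => o; exact: trig_le1.
  have qE : qform S ((2 * t n) *: a) = 4 * t n ^+ 2 * q.
    rewrite /qform [(_ *: a)^T]linearZ /= -!scalemxAl -scalemxAr mxE [X in _ * X]mxE.
    by rewrite /q /qform; ring.
  (* Half-angle formula: the square of sin(t X) is half of 1 - cos(2 t X), whose expectation is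
     known; [expR_ge1Dx] then bounds the result by the variance, uniformly in n. *)
  rewrite (@eq_Ex _ _ _ P _ (fun o => (2 * t n ^+ 2)^-1 *
      (1 - trig X true ((2 * t n) *: a) o))); last first.
    move=> o; rewrite /trig aX.
    have -> : 2 * t n * X o i 0 = t n * X o i 0 + t n * X o i 0 by ring.
    rewrite cosD -!expr2 cos2sin2.
    by field; rewrite gt_eqF.
  rewrite ExZ; last by apply: IntB => //; exact: Int_cst.
  rewrite ExB ?Ex_cst //; last exact: Int_cst.
  rewrite cX qE.
  have := expR_ge1Dx (- (4 * t n ^+ 2 * q) / 2).
  set e := expR _ => h; rewrite mulrC ler_pdivrMr; last by rewrite mulr_gt0 // exprn_gt0.
  have -> : q * (2 * t n ^+ 2) = 4 * t n ^+ 2 * q / 2 by field.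
  by move: h; set w := 4 * _ * _ => h; lra.
have i2 : Int P (fun o => X o i 0 ^+ 2).
  apply/integrableP; split; first by apply/measurable_EFinP; exact: measurable_funX.
  have F := @fatou _ _ _ P setT measurableT
    (fun n o => ((sin (t n * X o i 0) / t n) ^+ 2)%:E)
    (fun n => (measurable_EFinP _ _).2 (mf2 n)) (fun n o _ => sqr_ge0 _).
  have lhs : (\int[P]_o `|(X o i 0 ^+ 2)%:E| =
    \int[P]_o limn_einf (fun n => ((sin (t n * X o i 0) / t n) ^+ 2)%:E))%E.
    apply: eq_integral => o _.
    have cv : (fun n => ((sin (t n * X o i 0) / t n) ^+ 2)%:E) @ \oo -->
        (X o i 0 ^+ 2)%:E.
      apply: cvg_EFin; first exact: nearW.
      have h := @sin_over_cvg (X o i 0); exact: (cvgM h h).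
    rewrite is_cvg_limn_einfE; last by apply/cvg_ex; eexists; exact: cv.
    by rewrite (cvg_lim _ cv) //= ger0_norm ?sqr_ge0.
  rewrite lhs; apply: (le_lt_trans F); apply: (@le_lt_trans _ _ q%:E); last exact: ltry.
  rewrite limn_einf_lim; apply: lime_le; first exact: is_cvg_einfs.
  apply: nearW => n; apply: ge_ereal_inf.
  exists (\int[P]_o ((sin (t n * X o i 0) / t n) ^+ 2)%:E)%E; first by exists n => /=.
  by rewrite -EFin_Ex // lee_fin.
have i1 : Int P (fun o => X o i 0).
  apply: (Int_le mXi (IntD (Int_cst P 1) i2)) => o; set x := X o i 0.
  have := sqr_ge0 (`|x| - 1); rewrite sqrrB1 real_normK ?num_real //.
  by have := sqr_ge0 x; rewrite mulr2n; lra.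
split => //.
have cv : (fun n => Ex P (fun o => sin (t n * X o i 0) / t n)) @ \oo -->
    Ex P (fun o => X o i 0).
  apply: Ex_cvg (Int_norm i1) _ _ => //.
    move=> n o; rewrite normrM [`|_^-1|]ger0_norm ?invr_ge0 ?(ltW (t0 n)) //.
    rewrite ler_pdivrMr // (le_trans (norm_sin_le _)) // normrM mulrC.
    by rewrite [`|t n|]ger0_norm // ltW.
  by move=> o; exact: sin_over_cvg.
apply/esym/(cvg_unique _ _ cv) => //.
rewrite (_ : (fun n => _) = fun=> 0); first exact: cvg_cst.
apply/funext => n; rewrite (@eq_Ex _ _ _ P _ (fun o => (t n)^-1 * trig X false (t n *: a) o)).
  rewrite ExZ ?sX ?mulr0 //.
  by apply: (Int_bounded P (trig_meas _ _ mX) (M := 1)) => o; exact: trig_le1.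
by move=> o; rewrite /trig aX mulrC.
Qed.

End GaussianVectors.

(** * The innovations process of the Kalman filter *)

HB.instance Definition _ := gen_eqMixin source.

Section PsdMatrices.
Context {R : realType}.

Lemma qform_mul k l (M : 'M[R]_(l, k)) (S : 'M[R]_k) (v : 'cV[R]_l) :
  qform (M *m S *m M^T) v = qform S (M^T *m v).
Proof. by rewrite /qform trmx_mul trmxK !mulmxA. Qed.

Lemma psd_mul k l (M : 'M[R]_(l, k)) S : psd S -> psd (M *m S *m M^T).
Proof.
move=> [tS S0]; split; first by rewrite !trmx_mul trmxK tS mulmxA.
by move=> v; rewrite -/(qform _ v) qform_mul; exact: S0.
Qed.

Lemma psdD k (S S' : 'M[R]_k) : psd S -> psd S' -> psd (S + S').
Proof.
move=> [tS S0] [tS' S0']; split; first by rewrite linearD /= tS tS'.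
by move=> v; rewrite -/(qform _ v) qformD addr_ge0 //; [exact: S0|exact: S0'].
Qed.

Lemma pd_psd k (S : 'M[R]_k) : pd S -> psd S.
Proof.
move=> [tS S0]; split=> // v; have [->|v0] := eqVneq v 0; last exact/ltW/S0.
by rewrite mulmx0 mxE.
Qed.

(** Applied to the innovation covariance, which the Kalman gain inverts; the positive definite
    summand is the measurement noise. *)
Lemma psd_pd_unit k (S S' : 'M[R]_k) : psd S -> pd S' -> S + S' \in unitmx.
Proof.
move=> [tS S0] [tS' S0']; rewrite -row_free_unit -kermx_eq0.
apply/rowV0P => u /sub_kermxP uk; apply/eqP; rewrite -trmx_eq0; apply/eqP.
apply: contrapT => /eqP/S0'; rewrite trmxK => h.
have : (u *m (S + S') *m u^T) 0 0 = 0 by rewrite uk mul0mx mxE.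
rewrite mulmxDr mulmxDl mxE => /eqP; rewrite gt_eqF //.
by apply: ltr_wpDl h; have := S0 u^T; rewrite trmxK.
Qed.

End PsdMatrices.

Section InnovationsProcess.
Context {R : realType} {d m q : nat}.
Context {dsp : measure_display} {T : measurableType dsp}.
Variables (P : probability T R) (S : plant R d m q) (U : uncertainty R d q T).
Variables (ps pc : R).
Hypothesis hS : plant_ok S.
Hypothesis hU : uncertainty_ok P S U ps pc.

Let A := mA S.
Let C := mC S.

Definition source_gen (i : source) : set (T -> R) :=
  match i with
  | SrcInit => entries (x0 U)
  | SrcW k => entries (w U k)
  | SrcV k => entries (vs U k)
  | SrcS k => [set indicator_rv (sd U k)]
  | SrcNu k => [set indicator_rv (nu U k)]
  end.

Definition gen (J : set source) : set (T -> R) := \bigcup_(i in J) source_gen i.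

Lemma source_gen_meas i : all_meas (source_gen i).
Proof.
have [[mx _] hw hv [hs hn] _] := hU; case: i => [|k|k|k|k] f /=.
- by move=> [i ->]; exact: mx.
- by move=> [i ->]; have [] := hw k.
- by move=> [i ->]; have [] := hv k.
- by move=> ->; have [] := hs k.
- by move=> ->; have [] := hn k.
Qed.

Lemma gen_meas J : all_meas (gen J).
Proof. by move=> f [i _]; exact: source_gen_meas. Qed.

Lemma gen_indep J1 J2 : J1 `&` J2 = set0 ->
  indep P (sigma_of (gen J1)) (sigma_of (gen J2)).
Proof.
apply: (mutually_independent_sources (I := source)); first exact: source_gen_meas.
have [_ _ _ _] := hU; congr mutually_independent.
by apply/funext; case.
Qed.

Lemma gen_mw J i f : J i -> source_gen i f -> mw (gen J) f.
Proof. by move=> Ji fi; apply: mw_gen; exists i. Qed.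

Lemma gen_mxmw J i k (X : T -> 'cV[R]_k) : J i -> entries X `<=` source_gen i ->
  mxmw (gen J) X.
Proof. by move=> Ji Xi; apply: mxmw_entries => f /Xi fi; exists i. Qed.

Lemma gen_sub J J' f : J `<=` J' -> mw (gen J) f -> mw (gen J') f.
Proof. by move=> JJ; apply: mw_subset; exact: bigcup_subset. Qed.

Definition kalman_gain (M : 'M[R]_d) : 'M[R]_(d, q) :=
  M *m C^T *m invmx (C *m M *m C^T + Sv S).

(** The Joseph form of the covariance update: visibly positive semidefinite, and the covariance read
    off from [post_errE] without using the formula for the gain. *)
Definition kalman_post (M : 'M[R]_d) : 'M[R]_d :=
  let K := kalman_gain M in
  (1%:M - K *m C) *m M *m (1%:M - K *m C)^T + (- K) *m Sv S *m (- K)^T.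

Fixpoint prior_cov (k : nat) : 'M[R]_d :=
  if k is k'.+1 then A *m kalman_post (prior_cov k') *m A^T + Sw S else Sx0 S.

(** The one-step prediction error: the control enters the state and its prediction alike and
    cancels. *)
Fixpoint prior_err (k : nat) (o : T) : 'cV[R]_d :=
  if k is k'.+1 then
    A *m (prior_err k' o -
      kalman_gain (prior_cov k') *m (C *m prior_err k' o + vs U k' o)) + w U k' o
  else x0 U o.

Definition innovation k o := C *m prior_err k o + vs U k o.

Definition post_err k o :=
  prior_err k o - kalman_gain (prior_cov k) *m innovation k o.

Lemma prior_errS k o : prior_err k.+1 o = A *m post_err k o + w U k o.
Proof. by []. Qed.

Lemma post_errE k o : post_err k o =
  (1%:M - kalman_gain (prior_cov k) *m C) *m prior_err k o +
  (- kalman_gain (prior_cov k)) *m vs U k o.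
Proof.
rewrite /post_err /innovation mulmxDr mulmxBl mul1mx mulNmx mulmxA.
by rewrite opprD addrA.
Qed.

(** The residual after filtering, which is what the sensor transmits, is a linear image of the
    innovation; it inherits both symmetry and measurability from it. *)
Lemma residualE k o : C *m post_err k o + vs U k o =
  (1%:M - C *m kalman_gain (prior_cov k)) *m innovation k o.
Proof.
rewrite /post_err mulmxBr mulmxBl mul1mx mulmxA.
by rewrite -addrA [- _ + _]addrC addrA.
Qed.

Lemma prior_cov_psd k : psd (prior_cov k).
Proof.
have [_ _ _ _ [p0 pw pv]] := hS; elim: k => //= k IH.
apply: psdD => //; apply: psd_mul; apply: psdD; first exact: psd_mul.
by apply: psd_mul; exact: pd_psd.
Qed.

Lemma kalman_post_psd k : psd (kalman_post (prior_cov k)).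
Proof.
have [_ _ _ _ [p0 pw pv]] := hS; apply: psdD; first exact/psd_mul/prior_cov_psd.
by apply: psd_mul; exact: pd_psd.
Qed.

(** Process and measurement noises are counted separately: the prediction error at [k] involves [k]
    of each, the innovation one more measurement noise. *)
Definition noise (k l : nat) : set source := fun i =>
  match i with
  | SrcInit => True | SrcW j => (j < k)%N | SrcV j => (j < l)%N | _ => False
  end.

Lemma noise_sub k l k' l' : (k <= k')%N -> (l <= l')%N -> noise k l `<=` noise k' l'.
Proof. by move=> kk ll [|j|j|j|j] //= h; apply: leq_trans h _. Qed.

Lemma prior_err_mw k : mxmw (gen (noise k k)) (prior_err k).
Proof.
elim: k => [|k IH]; first exact: (gen_mxmw (i := SrcInit)).
have s : noise k k `<=` noise k.+1 k.+1 by exact: noise_sub.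
have IH' : mxmw (gen (noise k.+1 k.+1)) (prior_err k).
  by move=> i j; apply: gen_sub s _; exact: IH.
have mv : mxmw (gen (noise k.+1 k.+1)) (vs U k) by apply: (gen_mxmw (i := SrcV k)) => //=; exact: ltnSn.
have mw' : mxmw (gen (noise k.+1 k.+1)) (w U k) by apply: (gen_mxmw (i := SrcW k)) => //=; exact: ltnSn.
apply: mxmwD => //; apply: mxmwM; first exact: mxmw_cst.
apply: mxmwB => //; apply: mxmwM; first exact: mxmw_cst.
by apply: mxmwD => //; apply: mxmwM => //; exact: mxmw_cst.
Qed.

Lemma innovation_mw k : mxmw (gen (noise k k.+1)) (innovation k).
Proof.
apply: mxmwD; last by apply: (gen_mxmw (i := SrcV k)) => //=; exact: ltnSn.
apply: mxmwM; first exact: mxmw_cst.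
by move=> i j; apply: gen_sub (prior_err_mw k i j); exact: noise_sub.
Qed.

Lemma post_err_mw k : mxmw (gen (noise k k.+1)) (post_err k).
Proof.
apply: mxmwB; last by apply: mxmwM; [exact: mxmw_cst|exact: innovation_mw].
by move=> i j; apply: gen_sub (prior_err_mw k i j); exact: noise_sub.
Qed.

Definition innovations k : set (T -> R) := \bigcup_(j in `I_k) entries (innovation j).

Lemma innovations_mw k f : innovations k.+1 f -> mw (gen (noise k k.+1)) f.
Proof.
move=> [j /= jk [i ->]]; apply: gen_sub (innovation_mw j i 0).
exact: noise_sub.
Qed.

Lemma innovations_meas k : all_meas (innovations k).
Proof.
move=> f [j _ [i ->]]; exact: (mw_measurable (@gen_meas _) (innovation_mw j i 0)).
Qed.

Lemma gauss_vs k : gauss P (vs U k) (Sv S).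
Proof.
have [_ _ hv _ _] := hU; have [_ _ _ _ [p0 pw pv]] := hS.
by apply: centred_gaussian_gauss; [exact: pd_psd|exact: hv].
Qed.

Lemma gauss_w k : gauss P (w U k) (Sw S).
Proof.
have [_ hw _ _ _] := hU; have [_ _ _ _ [p0 pw pv]] := hS.
exact: centred_gaussian_gauss.
Qed.

Lemma prior_err_vs_indep k :
  indep P (sigma_of (entries (prior_err k))) (sigma_of (entries (vs U k))).
Proof.
have : indep P (sigma_of (gen (noise k k))) (sigma_of (gen [set SrcV k])).
  apply: gen_indep; apply/seteqP; split => // -[|j|j|j|j] [] //= h [].
  by move=> jk; move: h; rewrite jk ltnn.
apply: indep_sub; apply: sigma_of_sub; apply: entries_mw; first exact: prior_err_mw.
exact: (gen_mxmw (i := SrcV k)).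
Qed.

Lemma lin_indep_sub k l (X : T -> 'cV[R]_k) (Y : T -> 'cV[R]_l) p r
   (M : 'M[R]_(p, k)) (N : 'M[R]_(r, l)) :
  indep P (sigma_of (entries X)) (sigma_of (entries Y)) ->
  indep P (sigma_of (entries (fun o => M *m X o))) (sigma_of (entries (fun o => N *m Y o))).
Proof.
apply: indep_sub; apply: sigma_of_sub; apply: entries_mw; apply: mxmwM;
  try exact: mxmw_cst; exact: mxmw_entries.
Qed.

Lemma gauss_post_err k : gauss P (prior_err k) (prior_cov k) ->
  gauss P (post_err k) (kalman_post (prior_cov k)).
Proof.
move=> g; rewrite (funext (post_errE k)); apply: gaussD.
- exact: gauss_linear.
- exact/gauss_linear/gauss_vs.
- exact/lin_indep_sub/prior_err_vs_indep.
Qed.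

Lemma post_err_w_indep k :
  indep P (sigma_of (gen (noise k k.+1))) (sigma_of (entries (w U k))).
Proof.
have : indep P (sigma_of (gen (noise k k.+1))) (sigma_of (gen [set SrcW k])).
  apply: gen_indep; apply/seteqP; split => // -[|j|j|j|j] [] //= h [].
  by move=> jk; move: h; rewrite jk ltnn.
apply: indep_sub; apply: sigma_of_sub => f; first exact: mw_gen.
by move=> fi; exact: (gen_mw (i := SrcW k)).
Qed.

Lemma gauss_prior_err k : gauss P (prior_err k) (prior_cov k).
Proof.
elim: k => [|k IH].
  have [hx _ _ _ _] := hU; have [_ _ _ _ [p0 pw pv]] := hS.
  exact: centred_gaussian_gauss.
rewrite (funext (prior_errS k)); apply: gaussD.
- exact/gauss_linear/gauss_post_err.
- exact: gauss_w.
- apply: indep_sub (@post_err_w_indep k) => //.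
  apply: sigma_of_sub; apply: entries_mw; apply: mxmwM; first exact: mxmw_cst.
  exact: post_err_mw.
Qed.

(* The Kalman gain is the one that makes the filtering error and the
   innovation uncorrelated. *)
Lemma post_err_innovation_indep k :
  indep P (sigma_of (entries (post_err k))) (sigma_of (entries (innovation k))).
Proof.
have [tM M0] := prior_cov_psd k; have [_ _ _ _ [_ _ pv]] := hS.
have [tV _] := pv.
rewrite (funext (post_errE k)).
have -> : innovation k = fun o => C *m prior_err k o + 1%:M *m vs U k o.
  by apply/funext => o; rewrite mul1mx.
apply: (gauss_uncorrelated tM tV (gauss_prior_err k) (gauss_vs k)).
  exact: prior_err_vs_indep.
set K := kalman_gain _; set M := prior_cov k.
(* The normal equation of least squares, which is exactly the vanishing of the covariance of
   [post_err] and [innovation]. *)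
have KE : K *m (C *m M *m C^T + Sv S) = M *m C^T.
  rewrite /K /kalman_gain -/M mulmxKV //.
  by apply: psd_pd_unit => //; apply: psd_mul; exact: prior_cov_psd.
rewrite trmx1 mulmx1 mulNmx !mulmxBl mul1mx -KE mulmxDr !mulmxA.
by rewrite -addrA -opprD subrr.
Qed.

(** Independence from each single innovation would not give independence from all of them. The
    induction therefore alternates: a fresh noise is adjoined to the error, then the newest
    innovation to the earlier ones. *)
Lemma post_err_innovations_indep k :
  indep P (sigma_of (entries (post_err k))) (sigma_of (innovations k.+1)).
Proof.
have split_innov j : innovations j.+1 = entries (innovation j) `|` innovations j.
  by rewrite /innovations IIS bigcup_setU bigcup_set1 setUC.
have mV j : all_meas (entries (vs U j)).
  by apply: entries_meas; have [] := gauss_vs j.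
have mPri j : all_meas (entries (prior_err j)).
  by apply: entries_meas; have [] := gauss_prior_err j.
have step j : indep P (sigma_of (entries (prior_err j))) (sigma_of (innovations j)) ->
    indep P (sigma_of (entries (post_err j))) (sigma_of (innovations j.+1)).
  move=> ind.
  have ind2 : indep P (sigma_of (entries (prior_err j) `|` entries (vs U j)))
      (sigma_of (innovations j)).
    apply: (indep_join (FC := gen (noise j j))) ind _ => //.
    + exact: gen_meas.
    + by apply: entries_mw; exact: prior_err_mw.
    + move=> f [i /= ij fi]; have : innovations i.+1 f by exists i => /=.
      move=> /innovations_mw; apply: gen_sub; apply: noise_sub => //.
      exact: ltnW.
    + have : indep P (sigma_of (gen (noise j j))) (sigma_of (gen [set SrcV j])).
        apply: gen_indep; apply/seteqP; split => // -[|l|l|l|l] [] //= h [].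
        by move=> lj; move: h; rewrite lj ltnn.
      apply: indep_sub => //; apply: sigma_of_sub => f fi.
      exact: (gen_mw (i := SrcV j)).
  rewrite split_innov; apply: indep_sym.
  have mFC : all_meas (entries (prior_err j) `|` entries (vs U j)).
    by move=> f [/mPri|/mV].
  have m1 : mxmw (entries (prior_err j) `|` entries (vs U j)) (prior_err j).
    by apply: mxmw_entries; left.
  have m2 : mxmw (entries (prior_err j) `|` entries (vs U j)) (vs U j).
    by apply: mxmw_entries; right.
  have m3 : mxmw (entries (prior_err j) `|` entries (vs U j)) (innovation j).
    by apply: mxmwD => //; apply: mxmwM => //; exact: mxmw_cst.
  (* The new error and the new innovation are functions of one pair, [prior_err j] and [vs U j],
     which is independent of all earlier innovations. *)
  apply: (indep_join mFC (@innovations_meas j) _ _ _ ind2).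
  + exact: entries_mw.
  + apply: entries_mw; apply: mxmwB => //; apply: mxmwM => //; exact: mxmw_cst.
  + exact/indep_sym/post_err_innovation_indep.
elim: k => [|k IH]; apply: step.
  have : indep P (sigma_of (gen (noise 0 0))) (sigma_of (gen set0)).
    by apply: gen_indep; rewrite setI0.
  apply: indep_sub; apply: sigma_of_sub => f; last by case.
  by apply: entries_mw; exact: prior_err_mw.
have : indep P (sigma_of (entries (post_err k) `|` entries (w U k)))
    (sigma_of (innovations k.+1)).
  apply: (indep_join (FC := gen (noise k k.+1))) IH _.
  + exact: gen_meas.
  + by apply: entries_meas; have [] := gauss_w k.
  + by apply: entries_mw; exact: post_err_mw.
  + exact: innovations_mw.
  + exact: post_err_w_indep.
apply: indep_sub => //; apply: sigma_of_sub; apply: entries_mw.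
rewrite (funext (prior_errS k)); apply: mxmwD.
  apply: mxmwM; first exact: mxmw_cst.
  by apply: mxmw_entries; left.
by apply: mxmw_entries; right.
Qed.

(** The indices follow the order of events: at time [t] the sensor packet has been sent, while the
    control packet has not. *)
Definition dropouts_before (t : nat) : set source := fun i =>
  match i with SrcS j => (j <= t)%N | SrcNu j => (j < t)%N | _ => False end.

Definition future (t : nat) : set source := fun i =>
  match i with
  | SrcInit => False | SrcW j => (t <= j)%N | SrcV j => (t < j)%N
  | SrcS j => (t < j)%N | SrcNu j => (t <= j)%N
  end.

(** Generated by the innovations and not by the past noises, because [post_err t], which must belong
    to the future, is itself a function of those noises. *)
Definition past_info t := innovations t.+1 `|` gen (dropouts_before t).
Definition future_info t := entries (post_err t) `|` gen (future t).

Lemma past_info_meas t : all_meas (past_info t).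
Proof. by move=> f [/innovations_meas|/gen_meas]. Qed.

Lemma post_err_meas t : all_meas (entries (post_err t)).
Proof. by apply: entries_meas; have [] := gauss_post_err (gauss_prior_err t). Qed.

Lemma future_info_meas t : all_meas (future_info t).
Proof. by move=> f [/post_err_meas|/gen_meas]. Qed.

Lemma past_future_indep t :
  indep P (sigma_of (past_info t)) (sigma_of (future_info t)).
Proof.
have ind1 : indep P (sigma_of (past_info t)) (sigma_of (entries (post_err t))).
  apply: (indep_join (FC := gen (noise t t.+1))).
  + exact: gen_meas.
  + exact: gen_meas.
  + exact: innovations_mw.
  + by apply: entries_mw; exact: post_err_mw.
  + exact/indep_sym/post_err_innovations_indep.
  + by apply: gen_indep; apply/seteqP; split => // -[|l|l|l|l] [].
(* [J] holds every source behind the past and the current error, and is disjoint from [future t]. *)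
apply: indep_sym; pose J := noise t t.+1 `|` dropouts_before t.
apply: (indep_join (FC := gen J)).
+ exact: gen_meas.
+ exact: gen_meas.
+ by apply: entries_mw => i j; apply: gen_sub (post_err_mw t i j); left.
+ move=> f [/innovations_mw|/mw_gen]; first by apply: gen_sub; left.
  by apply: gen_sub; right.
+ exact: indep_sym.
+ apply: gen_indep; apply/seteqP; split => // -[|l|l|l|l] [] [] //=;
    by rewrite ?ltnS => h; rewrite ?(leqNgt t) ?(ltnNge t) h.
Qed.

End InnovationsProcess.

(** * Conditional expectations *)

Section ConditionalExpectation.
Context {R : realType} {dsp : measure_display} {T : measurableType dsp}.
Variable P : probability T R.
Implicit Types (F : set (T -> R)) (X Y : T -> R).

Lemma Ex_norm_eq0 X : Int P X -> Ex P (fun o => `|X o|) = 0 -> {ae P, forall o, X o = 0}.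
Proof.
move=> iX E0; have /(ae_eq_integral_abs P measurableT) : measurable_fun setT (EFin \o X).
  by apply/measurable_EFinP; exact: Int_meas iX.
move=> h; have : ae_eq P setT (EFin \o X) (cst 0%E).
  by apply/h; rewrite -[RHS]/(0%R%:E) -E0 (EFin_Ex (Int_norm iX)).
by apply: filterS => o /(_ Logic.I) [].
Qed.

Lemma ae_eq0_of_sigma F X : all_meas F -> mw F X -> Int P X ->
  (forall S, sigma_of F S -> Ex P (fun o => \1_S o * X o) = 0) ->
  {ae P, forall o, X o = 0}.
Proof.
move=> mF mX iX h; apply: Ex_norm_eq0 => //.
(* The positive and the negative part of [X] are its products with indicators of this set and its
   complement, both admissible test events. *)
pose S := [set o | 0 <= X o].
have FS : sigma_of F S.
  have -> : S = X @^-1` `[0, +oo[%classic.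
    by apply/seteqP; split => o; rewrite /S /= in_itv /= andbT.
  by apply: (mw_preimage mX); exact: measurable_itv.
have FS' : sigma_of F (~` S) by exact: (@measurableC _ (sigT F) S FS).
have mS := sigma_of_measurable mF FS; have mS' := sigma_of_measurable mF FS'.
rewrite (@eq_Ex _ _ _ P _ (fun o => \1_S o * X o - \1_(~` S) o * X o)).
  by rewrite (ExB (Int_indicM mS iX) (Int_indicM mS' iX)) !h // subrr.
move=> o; rewrite !indicE in_setC; have [hS|hS] := boolP (o \in S) => /=.
  by rewrite mul1r mul0r subr0 ger0_norm //; exact: (set_mem hS).
rewrite mul1r mul0r sub0r ltr0_norm // ltNge; apply: contra hS => hS.
exact/mem_set.
Qed.

Lemma condexp_Ex F X Y S : all_meas F -> is_condexp P (sigma_of F) X Y ->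
  sigma_of F S -> Ex P (fun o => \1_S o * Y o) = Ex P (fun o => \1_S o * X o).
Proof.
move=> mF [iX iY _ h] hS; have mS := sigma_of_measurable mF hS.
by apply: EFin_inj; rewrite -!integral_setE // h.
Qed.

Lemma condexp_mw F X Y : is_condexp P (sigma_of F) X Y -> mw F Y.
Proof. by case=> _ _ h _; split. Qed.

Lemma condexp_unique F X Y Y' : all_meas F -> is_condexp P (sigma_of F) X Y ->
  mw F Y' -> Int P Y' ->
  (forall S, sigma_of F S -> Ex P (fun o => \1_S o * Y' o) = Ex P (fun o => \1_S o * X o)) ->
  {ae P, forall o, Y o = Y' o}.
Proof.
move=> mF cY mY' iY' h; have [iX iY _ _] := cY.
have : {ae P, forall o, Y o - Y' o = 0}.
  apply: (ae_eq0_of_sigma mF); [|exact: IntB|].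
    by apply: mwB => //; exact: condexp_mw cY.
  move=> S hS; have mS := sigma_of_measurable mF hS.
  rewrite (@eq_Ex _ _ _ P _ (fun o => \1_S o * Y o - \1_S o * Y' o)).
    rewrite (ExB (Int_indicM mS iY) (Int_indicM mS iY')).
    by rewrite (condexp_Ex mF cY hS) h // subrr.
  by move=> o; rewrite mulrBr.
by apply: filterS => o /eqP; rewrite subr_eq0 => /eqP.
Qed.

(** Functions orthogonal to [D] are closed under linear combinations and, by domination with a
    multiple of [|D|], under bounded limits; [bounded_class] does the rest. *)
Lemma orthogonal_bounded F D Z c : all_meas F -> Int P D ->
  (forall S, sigma_of F S -> Ex P (fun o => \1_S o * D o) = 0) ->
  mw F Z -> (forall o, `|Z o| <= c) -> Ex P (fun o => Z o * D o) = 0.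
Proof.
move=> mF iD h mZ Zc.
pose H f := [/\ mw F f, exists c, forall o, `|f o| <= c &
               Ex P (fun o => f o * D o) = 0].
suff [] : H Z by [].
have iM f : mw F f -> (exists c, forall o, `|f o| <= c) -> Int P (fun o => f o * D o).
  by move=> mf [e fe]; apply: Int_boundedM fe iD; exact: mw_measurable mf.
apply: (bounded_class (F := F) (H := H)) mZ Zc.
- move=> S hS; split; [exact: mw_set| |exact: h].
  by exists 1 => o; exact: norm_indic.
- move=> f g [mf [e fe] Ef] [mg [e' ge'] Eg]; split; first exact: mwD.
    by exists (e + e') => o; rewrite (le_trans (ler_normD _ _)) // lerD.
  rewrite (@eq_Ex _ _ _ P _ (fun o => f o * D o + g o * D o)).
    by rewrite ExD ?Ef ?Eg ?addr0 //; apply: iM => //; [exists e|exists e'].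
  by move=> o; rewrite mulrDl.
- move=> a f [mf [e fe] Ef]; split; first by apply: mwM => //; exact: mw_cst.
    by exists (`|a| * e) => o; rewrite normrM ler_wpM2l.
  rewrite (@eq_Ex _ _ _ P _ (fun o => a * (f o * D o))).
    by rewrite ExZ ?Ef ?mulr0 //; apply: iM => //; exists e.
  by move=> o; rewrite mulrA.
- move=> fn f e Hfn fe cvg.
  have mf : mw F f by apply: mw_cvg cvg => n; have [] := Hfn n.
  split => //; first by exists e => o; apply: cvg_norm_le (cvg o).
  have cv : (fun n => Ex P (fun o => fn n o * D o)) @ \oo --> Ex P (fun o => f o * D o).
    apply: (Ex_cvg (Y := fun o => e * `|D o|)).
    + move=> n; apply: measurable_funM; last exact: Int_meas iD.
      by have [m _ _] := Hfn n; exact: mw_measurable m.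
    + apply: measurable_funM; last exact: Int_meas iD.
      exact: mw_measurable mf.
    + exact/IntZ/Int_norm.
    + by move=> n o; rewrite normrM ler_wpM2r.
    + by move=> o; apply: cvgM; [exact: cvg|exact: cvg_cst].
  apply: (cvg_unique _ cv) => //.
  rewrite (_ : (fun n => _) = fun=> 0); first exact: cvg_cst.
  by apply/funext => n; have [] := Hfn n.
Qed.

Lemma condexp_pull F X Y Z c : all_meas F -> is_condexp P (sigma_of F) X Y ->
  mw F Z -> (forall o, `|Z o| <= c) ->
  Ex P (fun o => Z o * X o) = Ex P (fun o => Z o * Y o).
Proof.
move=> mF cY mZ Zc; have [iX iY _ _] := cY.
have mZ' : measurable_fun setT Z by exact: mw_measurable mZ.
apply/eqP; rewrite -subr_eq0 -(ExB (Int_boundedM mZ' Zc iX) (Int_boundedM mZ' Zc iY)).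
apply/eqP; rewrite (@eq_Ex _ _ _ P _ (fun o => Z o * (X o - Y o))); last first.
  by move=> o; rewrite mulrBr.
apply: (orthogonal_bounded mF (IntB iX iY)) mZ Zc => S hS.
have mS := sigma_of_measurable mF hS.
rewrite (@eq_Ex _ _ _ P _ (fun o => \1_S o * X o - \1_S o * Y o)).
  rewrite (ExB (Int_indicM mS iX) (Int_indicM mS iY)).
  by rewrite (condexp_Ex mF cY hS) subrr.
by move=> o; rewrite mulrBr.
Qed.

Section Existence.
Variables (F : set (T -> R)) (mF : all_meas F) (X : T -> R) (iX : Int P X).

Let total := induced_charge (mu := P) iX.

Definition restricted_charge : set (sigT F) -> \bar R := fun A => total A.

Let restricted0 : restricted_charge set0 = 0%E.
Proof. exact: charge0. Qed.

Let restricted_fin A : measurable A -> restricted_charge A \is a fin_num.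
Proof. by move=> /(sigma_of_measurable mF) mA; exact: fin_num_measure. Qed.

Let restricted_additive : semi_sigma_additive restricted_charge.
Proof.
move=> E mE tE mU; apply: (charge_semi_sigma_additive (s := total)) => //.
  by move=> n; exact: (sigma_of_measurable mF (mE n)).
exact: (sigma_of_measurable mF mU).
Qed.

HB.instance Definition _ := isCharge.Build _ _ _ restricted_charge
  restricted0 restricted_fin restricted_additive.

(** The Radon-Nikodym derivative is taken on [sigT F], between the charge with density [X]
    restricted to [sigma_of F] and the marginal of [P]; measurability with respect to [F] then comes
    for free. *)
Lemma condexp_exists : exists Y, is_condexp P (sigma_of F) X Y.
Proof.
pose nu : {charge set (sigT F) -> \bar R} := restricted_charge.
pose m : probability (sigT F) R := marginal P mF.
have dom : nu `<< m.
  apply/null_content_dominatesP => A mA mA0.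
  have mA' : measurable (A : set T) := sigma_of_measurable mF mA.
  apply: null_set_integral => //; exact: (measurable_funTS (measurable_int P iX)).
pose Y : T -> R := fine \o Radon_Nikodym nu m.
have RNi := Radon_Nikodym_integrable dom.
have YE : EFin \o (Y : sigT F -> R) = Radon_Nikodym nu m.
  by apply/funext => o; rewrite /Y /= fineK //; exact: Radon_Nikodym_fin_num.
have mYm : m.-integrable setT (EFin \o (Y : sigT F -> R)) by rewrite YE.
have mY : mw F Y.
  by apply/mwP; apply/measurable_EFinP; exact: (measurable_int m mYm).
have mYT : measurable_fun setT Y by exact: (mw_measurable mF mY).
have iY : Int P Y.
  have /integrableP[_] := mYm.
  rewrite (ge0_integral_pushforward (to_sig_measurable mF)) //; last first.
    by apply: measurableT_comp => //; exact: (measurable_int m mYm).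
  by move=> h; apply/integrableP; split => //; exact/measurable_EFinP.
exists Y; split => //; first exact: mw_preimage mY.
move=> A hA; have mA : measurable A := sigma_of_measurable mF hA.
transitivity (\int[m]_(x in A) (Y x)%:E)%E.
  rewrite (integral_pushforward (to_sig_measurable mF)) //.
    exact: (measurable_int m mYm).
  exact: (integrableS measurableT).
have -> : (fun x : sigT F => (Y x)%:E) = Radon_Nikodym nu m by exact: YE.
by rewrite -Radon_Nikodym_integral.
Qed.

End Existence.

Lemma ae_forall_ord k (Q : 'I_k -> T -> Prop) :
  (forall i, {ae P, forall o, Q i o}) -> {ae P, forall o i, Q i o}.
Proof. by move=> h; apply: filter_forall. Qed.

End ConditionalExpectation.

(** * Closed loops *)

Section LoopAnalysis.
Context {R : realType} {d m q : nat}.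
Context {dsp : measure_display} {T : measurableType dsp}.
Variables (P : probability T R) (S : plant R d m q) (U : uncertainty R d q T).
Variables (ps pc : R).
Hypothesis hS : plant_ok S.
Hypothesis hU : uncertainty_ok P S U ps pc.

Let pst := post_err S U.
Let past := past_info S U.

Let past_meas k : all_meas (past k). Proof. exact: (past_info_meas hU). Qed.

Lemma past_info_mono j k f : (j <= k)%N -> mw (past j) f -> mw (past k) f.
Proof.
move=> jk; apply: mw_subset => g [[i /= ij gi]|[i ij gi]].
  by left; exists i => //=; exact: leq_trans ij _.
right; exists i => //; case: i ij {gi} => //= l h; exact: leq_trans h _.
Qed.

Lemma sd_past j k : (j <= k)%N -> mw (past k) (fun o => (sd U j o)%:R : R).
Proof. by move=> jk; apply: mw_gen; right; exists (SrcS j). Qed.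

Lemma nu_past j k : (j < k)%N -> mw (past k) (fun o => (nu U j o)%:R : R).
Proof. by move=> jk; apply: mw_gen; right; exists (SrcNu j). Qed.

Lemma innovation_past j k : (j <= k)%N -> mxmw (past k) (innovation S U j).
Proof. by move=> jk; apply: mxmw_entries => f hf; left; exists j. Qed.

Lemma post_err_Int k i : Int P (fun o => pst k o i 0) /\ Ex P (fun o => pst k o i 0) = 0.
Proof.
have g := gauss_post_err hS hU (gauss_prior_err hS hU k).
by have [_ ? ?] := gauss_moments i (kalman_post_psd hS k) g.
Qed.

Lemma post_err_orthogonal k i A : sigma_of (past k) A ->
  Ex P (fun o => \1_A o * pst k o i 0) = 0.
Proof.
move=> hA; have [ie Ee] := post_err_Int k i.
have me : mw (future_info S U k) (fun o => pst k o i 0).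
  by apply: mw_gen; left; exists i.
have [_ ->] := indep_Ex_mul (@past_meas k) (future_info_meas hS hU (t := k))
  (past_future_indep hS hU (t := k)) (mw_set hA) me
  (Int_indic P (sigma_of_measurable (@past_meas k) hA)) ie.
by rewrite Ee mulr0.
Qed.

Variables (L : loop R d m q T) (N : nat).
Hypothesis hL : is_loop P S U L N.

Definition filter_data k : set (T -> R) :=
  \bigcup_(j in `I_k.+1) entries (out L j) `|` \bigcup_(j in `I_k) entries (act L j).

Definition ideal_est k o := st L k o - pst k o.

Definition adapted_obs k := mxmw (past k) (out L k) /\ mxmw (past k) (est L k).
(** One index later than the observations: the applied control contains the dropout [nu U k], which
    enters the past only at [k.+1]. *)
Definition adapted_act k := mxmw (past k.+1) (act L k).

Lemma ideal_est_mw k : (k <= N)%N -> (forall j, (j < k)%N -> adapted_act j) ->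
  mxmw (past k) (ideal_est k).
Proof.
have [st0 stS _ _] := hL.
elim: k => [|k IH] kN ha.
  have -> : ideal_est 0 = fun o => kalman_gain S (prior_cov S 0) *m innovation S U 0 o.
    by apply/funext => o; rewrite /ideal_est st0 /pst /post_err /= opprB addrC subrK.
  by apply: mxmwM; [exact: mxmw_cst|exact: innovation_past].
have IH' : mxmw (past k.+1) (ideal_est k).
  move=> i j; apply: (@past_info_mono k) => //.
  by apply: IH => [|l lk]; [exact: ltnW|apply: ha; exact: ltnW].
have -> : ideal_est k.+1 = fun o => (mA S *m ideal_est k o + mB S *m act L k o) +
    kalman_gain S (prior_cov S k.+1) *m innovation S U k.+1 o.
  apply/funext => o; rewrite /ideal_est stS // {1}/pst /post_err prior_errS -/(pst k).
  rewrite [mA S *m (st L k o - pst k o)]mulmxBr opprB opprD [_ *m _ + (_ - _)]addrA addrACA subrr addr0.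
  by rewrite [_ - mA S *m _]addrC addrACA addrA.
apply: mxmwD.
  by apply: mxmwD; apply: mxmwM => //; try exact: mxmw_cst; exact: ha.
by apply: mxmwM; [exact: mxmw_cst|exact: innovation_past].
Qed.

Lemma adapted_out k : (k <= N)%N -> (forall j, (j < k)%N -> adapted_act j) ->
  mxmw (past k) (out L k).
Proof.
have [_ _ outE _] := hL; move=> kN ha.
have -> : out L k = fun o => mC S *m ideal_est k o +
    (1%:M - mC S *m kalman_gain S (prior_cov S k)) *m innovation S U k o.
  apply/funext => o; rewrite outE // -residualE /ideal_est mulmxBr -/(pst k).
  by rewrite addrA subrK.
apply: mxmwD; apply: mxmwM; try exact: mxmw_cst.
  exact: ideal_est_mw.
exact: innovation_past.
Qed.

Lemma filter_data_mw k : (forall j, (j <= k)%N -> mxmw (past j) (out L j)) ->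
  (forall j, (j < k)%N -> adapted_act j) -> forall f, filter_data k f -> mw (past k) f.
Proof.
move=> ho ha f [[j /= jk [i ->]]|[j /= jk [i ->]]].
  by apply: (@past_info_mono j) => //; exact: ho.
by apply: (@past_info_mono j.+1) => //; exact: ha.
Qed.

(** The filter recursion driven by outputs and controls. Uniqueness of conditional expectations
    requires measurability for the filter's own data, whereas [ideal_est_mw] gives it only for the
    larger past. *)
Lemma ideal_est_filter F k : (k <= N)%N ->
  (forall j, (j <= k)%N -> mxmw F (out L j)) ->
  (forall j, (j < k)%N -> mxmw F (act L j)) -> mxmw F (ideal_est k).
Proof.
have [st0 stS outE _] := hL.
elim: k => [|k IH] kN ho ha.
  have -> : ideal_est 0 = fun o => kalman_gain S (prior_cov S 0) *m out L 0 o.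
    apply/funext => o; rewrite /ideal_est /pst /post_err /innovation /= outE //.
    by rewrite st0 opprB addrC subrK.
  by apply: mxmwM; [exact: mxmw_cst|exact: ho].
have IH' : mxmw F (ideal_est k).
  apply: IH => [|l lk|l lk]; [exact: ltnW|apply: ho; exact: ltnW|].
  by apply: ha; exact: ltnW.
pose pred o := mA S *m ideal_est k o + mB S *m act L k o.
have mpred : mxmw F pred.
  by apply: mxmwD; apply: mxmwM => //; try exact: mxmw_cst; exact: ha.
have -> : ideal_est k.+1 = fun o => pred o +
    kalman_gain S (prior_cov S k.+1) *m (out L k.+1 o - mC S *m pred o).
  apply/funext => o; have predE : pred o = st L k.+1 o - prior_err S U k.+1 o.
    rewrite stS // prior_errS -/(pst k) /pred /ideal_est.
    rewrite [mA S *m (st L k o - pst k o)]mulmxBr.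
    by rewrite opprD addrACA subrr addr0 addrAC.
  have -> : out L k.+1 o - mC S *m pred o = innovation S U k.+1 o.
    rewrite outE // predE mulmxBr opprB /innovation.
    by rewrite addrCA -!addrA [X in _ + X]addrC subrK addrC.
  by rewrite predE /ideal_est /pst /post_err opprB addrCA addrC.
apply: mxmwD => //; apply: mxmwM; first exact: mxmw_cst.
apply: mxmwB; first exact: ho.
by apply: mxmwM => //; exact: mxmw_cst.
Qed.

Lemma innov_mw k : adapted_obs k -> mxmw (past k) (innov S U L k).
Proof.
move=> [mo me]; apply: mxmwZ; first exact: sd_past.
by apply: mxmwB => //; apply: mxmwM => //; exact: mxmw_cst.
Qed.

Lemma controller_data_mw k : (forall j, (j <= k)%N -> adapted_obs j) ->
  (forall j, (j < k)%N -> adapted_act j) ->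
  forall f, controller_data U L k f -> mw (past k) f.
Proof.
move=> ho ha f [[j /= jk [[fj|fj]|->]]|[j /= jk [i ->]]].
- have [mo _] := ho j jk.
  move: f fj; apply: entries_mw; apply: mxmwZ; first exact: sd_past.
  by move=> i l; apply: (@past_info_mono j).
- have [_ me] := ho j jk.
  move: f fj; apply: entries_mw; apply: mxmwZ; first exact: sd_past.
  by move=> i l; apply: (@past_info_mono j).
- exact: sd_past.
- by apply: (@past_info_mono j.+1) => //; exact: ha.
Qed.

(** An induction step and not a plain measurability assumption: the control at [k] is a function of
    observations whose adaptedness is being proved at the same time. Both the loop [L] and its
    continuations satisfy it. *)
Hypothesis causal : forall k, (k < N)%N -> (forall j, (j <= k)%N -> adapted_obs j) ->
  (forall j, (j < k)%N -> adapted_act j) -> adapted_act k.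

Lemma loop_adapted k : (k <= N)%N -> adapted_obs k /\ ((k < N)%N -> adapted_act k).
Proof.
elim/ltn_ind: k => k IH kN.
have ho j : (j < k)%N -> adapted_obs j.
  by move=> jk; have [] := IH j jk (leq_trans (ltnW jk) kN).
have ha j : (j < k)%N -> adapted_act j.
  move=> jk; have [_] := IH j jk (leq_trans (ltnW jk) kN); apply.
  exact: leq_trans jk kN.
have oo : mxmw (past k) (out L k) by exact: adapted_out.
have obs : adapted_obs k.
  split => // i j; rewrite (ord1 j); have [_ _ _ estL] := hL.
  have := condexp_mw (F := filter_data k) (estL k kN i).
  apply: mw_sub; apply: filter_data_mw => // l.
  by rewrite leq_eqVlt => /predU1P[->//|/ho[]].
split => // kN'; apply: causal => // j.
by rewrite leq_eqVlt => /predU1P[->|/ho].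
Qed.

(** [ideal_est] is measurable for the filter data, and its distance to the state, [post_err], is
    orthogonal to the larger past; these two facts characterize the conditional expectation. *)
Lemma est_ideal k : (k <= N)%N -> {ae P, forall o, est L k o = ideal_est k o}.
Proof.
move=> kN; have [_ _ _ estL] := hL.
have hact j : (j < k)%N -> adapted_act j.
  move=> jk; have jN := leq_trans jk kN.
  by have [_] := loop_adapted (ltnW jN); apply.
have hout j : (j <= k)%N -> mxmw (past j) (out L j).
  by move=> jk; have [[]] := loop_adapted (leq_trans jk kN).
have fd : forall f, filter_data k f -> mw (past k) f by exact: filter_data_mw.
have mfd : all_meas (filter_data k).
  by move=> f /fd; exact: mw_measurable.
suff h i : {ae P, forall o, est L k o i 0 = ideal_est k o i 0}.
  have := ae_forall_ord h; apply: filterS => o ho.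
  by apply/matrixP => i j; rewrite (ord1 j).
have iS : Int P (fun o => st L k o i 0) by have [] := estL k kN i.
have [ie Ee] := post_err_Int k i.
have idE : (fun o => ideal_est k o i 0) = fun o => st L k o i 0 - pst k o i 0.
  by apply/funext => o; rewrite !mxE.
apply: (condexp_unique mfd (estL k kN i)).
- have := @ideal_est_filter (filter_data k) k kN _ _ i 0; apply => j jk.
    by apply: mxmw_entries => f fj; left; exists j.
  by apply: mxmw_entries => f fj; right; exists j.
- by rewrite idE; exact: IntB.
- move=> A hA.
  have hA' := sigma_of_sub fd hA; have mA := sigma_of_measurable (@past_meas k) hA'.
  rewrite (@eq_Ex _ _ _ P _ (fun o => \1_A o * st L k o i 0 - \1_A o * pst k o i 0)).
    rewrite (ExB (Int_indicM mA iS) (Int_indicM mA ie)).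
    by rewrite post_err_orthogonal // subr0.
  by move=> o; rewrite -mulrBr /ideal_est !mxE.
Qed.

(* The received innovation in terms of the sources only. *)
Definition ideal_innov k o : 'cV[R]_q :=
  (sd U k o)%:R *: (mC S *m pst k o + vs U k o).

Lemma est_err_ideal k : (k <= N)%N -> {ae P, forall o, est_err L k o = pst k o}.
Proof.
move=> /est_ideal; apply: filterS => o h.
by rewrite /est_err h /ideal_est opprB addrC subrK.
Qed.

Lemma innov_ideal k : (k <= N)%N -> {ae P, forall o, innov S U L k o = ideal_innov k o}.
Proof.
have [_ _ outE _] := hL.
move=> kN; apply: filterS (est_err_ideal kN) => o h.
by rewrite /innov /ideal_innov outE // -h /est_err mulmxBr addrAC.
Qed.

Lemma innov_past k : (k <= N)%N -> mxmw (past k) (innov S U L k).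
Proof. by move=> kN; apply: innov_mw; have [] := loop_adapted kN. Qed.

Lemma controller_data_past k : (k <= N)%N ->
  forall f, controller_data U L k f -> mw (past k) f.
Proof.
move=> kN; apply: controller_data_mw => j jk.
  by have [] := loop_adapted (leq_trans jk kN).
have jN := leq_trans jk kN.
by have [_] := loop_adapted (ltnW jN); apply.
Qed.

End LoopAnalysis.

(** * The stacked dynamics *)

Section HorizonAlgebra.
Context {R : realType} {d m q n : nat}.
Variables (S : plant R d m q) (W : weights R d m).

Lemma state_expand (x : nat -> 'cV[R]_d) (u : nat -> 'cV[R]_m) (v : nat -> 'cV[R]_d) N :
  (forall k, (k < N)%N -> x k.+1 = mA S *m x k + mB S *m u k + v k) ->
  forall i, (i <= N)%N -> x i = mA S ^+ i *m x 0%N +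
    \sum_(j < i) mA S ^+ (i - j.+1) *m (mB S *m u j + v j).
Proof.
move=> xS; elim=> [|i IH] iN; first by rewrite big_ord0 addr0 mul1mx.
rewrite xS // {1}IH; last exact: ltnW.
rewrite big_ord_recr /= subnn mul1mx mulmxDr mulmxA.
rewrite -[mA S *m mA S ^+ i]/(mA S * mA S ^+ i) -exprS -!addrA; congr (_ + _).
congr (_ + _); rewrite mulmx_sumr; apply: eq_bigr => j _.
by rewrite mulmxA -[mA S *m mA S ^+ _]/(mA S * mA S ^+ _) -exprS -subSn.
Qed.

Lemma sum_ord_le (V : nmodType) k l (F : nat -> V) : (k <= l)%N ->
  \sum_(j < l) (if (j < k)%N then F j else 0) = \sum_(j < k) F j.
Proof. by move=> kl; rewrite -big_mkcond -big_ord_widen. Qed.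

Lemma stack_expand (x : nat -> 'cV[R]_d) (u : nat -> 'cV[R]_m) (v : nat -> 'cV[R]_d) :
  (forall k, (k < n.+1)%N -> x k.+1 = mA S *m x k + mB S *m u k + v k) ->
  \mxcol_(i < n.+2) x i = calA S *m x 0%N +
    calB S *m (\mxcol_(i < n.+1) u i) + calD S *m (\mxcol_(i < n.+1) v i).
Proof.
move=> xS; rewrite /calA /calB /calD mxcol_mul !mul_mxblock_mxrow -!mxcolD.
congr mxcol; apply/funext => i.
have iN : (i <= n.+1)%N by rewrite -ltnS.
rewrite (state_expand xS iN) -addrA; congr (_ + _).
rewrite -(sum_ord_le (fun j => mA S ^+ (i - j.+1) *m (mB S *m u j + v j)) iN).
rewrite -big_split /=; apply: eq_bigr => j _.
by case: ifP => _; rewrite ?mulmxDr ?mulmxA // !mul0mx addr0.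
Qed.

Lemma calQ_psd : psd (wQ W) -> psd (wQN W) -> psd (calQ (n := n) W).
Proof.
move=> [tQ pQ] [tN pN]; split.
  by rewrite /calQ tr_mxdiag; apply: eq_mxdiag => i; case: ifP.
move=> v; rewrite -(submxcolK v) /calQ -mulmxA mul_mxdiag_mxcol tr_mxcol mul_mxrow_mxcol.
rewrite summxE; apply: sumr_ge0 => i _; rewrite mulmxA; case: ifP => _; [exact: pQ|exact: pN].
Qed.

Lemma calR_psd : psd (wR W) -> psd (calR (n := n) W).
Proof.
move=> [tQ pQ]; split; first by rewrite /calR tr_mxdiag; apply: eq_mxdiag.
move=> v; rewrite -(submxcolK v) /calR -mulmxA mul_mxdiag_mxcol tr_mxcol mul_mxrow_mxcol.
by rewrite summxE; apply: sumr_ge0 => i _; rewrite mulmxA; exact: pQ.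
Qed.

Hypothesis hW : weights_ok W.

Lemma alpha_psd : psd (alpha (n := n) S W).
Proof.
have [hQ hN hR] := hW; apply: psdD; last exact/calR_psd/pd_psd.
by have := psd_mul (calB S)^T (calQ_psd hQ hN); rewrite trmxK.
Qed.

(** Isolates the part free of [u], the source of the additive constant, from what the program
    minimizes. *)
Lemma cost_expand (x : 'cV[R]_d) (u : 'cV[R]_(stacked m n.+1)) (v : 'cV[R]_(stacked d n.+1)) :
  qform (calQ W) (calA S *m x + calB S *m u + calD S *m v) + qform (calR W) u =
  qform (calQ W) (calA S *m x + calD S *m v) + qform (alpha S W) u +
  2 * ((x^T *m calQA S W + v^T *m calQD S W) *m u) 0 0.
Proof.
have [hQ hN hR] := hW; have [tQ _] := calQ_psd hQ hN.
have -> : qform (alpha S W) u = qform (calQ W) (calB S *m u) + qform (calR W) u.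
  by rewrite /alpha qformD /qform trmx_mul !mulmxA.
have -> : x^T *m calQA S W + v^T *m calQD S W =
    (calA S *m x + calD S *m v)^T *m calQ W *m calB S.
  rewrite [(_ + _)^T]linearD /= !trmx_mul /calQA /calQD.
  by rewrite !mulmxDl !mulmxA.
by rewrite [calA S *m x + _ + _]addrAC qform_add // !mulmxA; ring.
Qed.

End HorizonAlgebra.

(** * Expectations of random matrices *)

Section MatrixExpectation.
Context {R : realType} {dsp : measure_display} {T : measurableType dsp}.
Variable P : probability T R.
Implicit Types (F : set (T -> R)).

Definition mxInt k l (X : T -> 'M[R]_(k, l)) := forall i j, Int P (fun o => X o i j).

Lemma mean_mxE k l (X : T -> 'M[R]_(k, l)) i j :
  mean_mx P X i j = Ex P (fun o => X o i j).
Proof. by rewrite mxE /Ex unlock. Qed.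

Lemma eq_mean_mx k l (X Y : T -> 'M[R]_(k, l)) : X =1 Y -> mean_mx P X = mean_mx P Y.
Proof. by move=> /funext ->. Qed.

Lemma mxInt_bounded F k l (X : T -> 'M[R]_(k, l)) c : all_meas F -> mxmw F X ->
  (forall o i j, `|X o i j| <= c) -> mxInt X.
Proof. by move=> mF mX bX i j; apply: (@Int_bounded _ _ _ _ c) => //; exact: mw_measurable (mX i j). Qed.

Lemma mxInt_cst k l (M : 'M[R]_(k, l)) : mxInt (fun=> M).
Proof. by move=> i j; exact: Int_cst. Qed.

Lemma mxInt_mull k l p (M : 'M[R]_(k, l)) (X : T -> 'M[R]_(l, p)) :
  mxInt X -> mxInt (fun o => M *m X o).
Proof.
move=> iX i j; apply: (@eq_Int _ _ _ _ (fun o => \sum_a M i a * X o a j)).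
  by move=> o; rewrite mxE.
by apply: Int_sum => a _; exact: IntZ.
Qed.

Lemma mxInt_tr k l (X : T -> 'M[R]_(k, l)) : mxInt X -> mxInt (fun o => (X o)^T).
Proof. by move=> iX i j; apply: eq_Int (iX j i) => o; rewrite mxE. Qed.

Lemma mxInt_mulr k l p (M : 'M[R]_(l, p)) (X : T -> 'M[R]_(k, l)) :
  mxInt X -> mxInt (fun o => X o *m M).
Proof.
move=> iX i j; apply: (@eq_Int _ _ _ _ (fun o => \sum_a M a j * X o i a)).
  by move=> o; rewrite mxE; apply: eq_bigr => a _; rewrite mulrC.
by apply: Int_sum => a _; exact: IntZ.
Qed.

Lemma mxInt_D k l (X Y : T -> 'M[R]_(k, l)) :
  mxInt X -> mxInt Y -> mxInt (fun o => X o + Y o).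
Proof. by move=> iX iY i j; apply: eq_Int (IntD (iX i j) (iY i j)) => o; rewrite mxE. Qed.

Lemma mean_mull k l p (M : 'M[R]_(k, l)) (X : T -> 'M[R]_(l, p)) :
  mxInt X -> mean_mx P (fun o => M *m X o) = M *m mean_mx P X.
Proof.
move=> iX; apply/matrixP => i j; rewrite mean_mxE mxE.
rewrite (@eq_Ex _ _ _ P _ (fun o => \sum_a M i a * X o a j)); last by move=> o; rewrite mxE.
rewrite Ex_sum; last by move=> a _; exact: IntZ.
by apply: eq_bigr => a _; rewrite ExZ // mean_mxE.
Qed.

Lemma mean_tr k l (X : T -> 'M[R]_(k, l)) : mean_mx P (fun o => (X o)^T) = (mean_mx P X)^T.
Proof.
by apply/matrixP => i j; rewrite mean_mxE mxE mean_mxE; apply: eq_Ex => o; rewrite mxE.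
Qed.

Lemma mean_mulr k l p (M : 'M[R]_(l, p)) (X : T -> 'M[R]_(k, l)) :
  mxInt X -> mean_mx P (fun o => X o *m M) = mean_mx P X *m M.
Proof.
move=> iX; apply: trmx_inj; rewrite -mean_tr trmx_mul -mean_tr -mean_mull; last exact: mxInt_tr.
by apply: eq_mean_mx => o; rewrite trmx_mul.
Qed.

(** Integrability travels with the value, since neither is of use alone when expectations are
    added. *)
Definition has_mean (X : T -> R) v := Int P X /\ Ex P X = v.

Lemma has_meanD X Y v w : has_mean X v -> has_mean Y w ->
  has_mean (fun o => X o + Y o) (v + w).
Proof. by move=> [iX <-] [iY <-]; split; [exact: IntD|exact: ExD]. Qed.

Lemma has_meanZ c X v : has_mean X v -> has_mean (fun o => c * X o) (c * v).
Proof. by move=> [iX <-]; split; [exact: IntZ|exact: ExZ]. Qed.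

Lemma eq_has_mean X Y v w : X =1 Y -> v = w -> has_mean X v -> has_mean Y w.
Proof. by move=> /funext -> ->. Qed.

Lemma has_mean_tr k (X : T -> 'M[R]_k) : mxInt X ->
  has_mean (fun o => \tr (X o)) (\tr (mean_mx P X)).
Proof.
move=> iX; split; first by apply: Int_sum => i _.
by rewrite /mxtrace Ex_sum //; apply: eq_bigr => i _; rewrite mean_mxE.
Qed.

(** The normal form for cost terms: a matrix of control dropouts times a matrix of the other
    sources, under a trace. *)
Lemma has_mean_indep F1 F2 k l (X : T -> 'M[R]_(k, l)) (Y : T -> 'M[R]_(l, k)) :
  all_meas F1 -> all_meas F2 -> indep P (sigma_of F1) (sigma_of F2) ->
  mxmw F1 X -> mxmw F2 Y -> mxInt X -> mxInt Y ->
  has_mean (fun o => \tr (X o *m Y o)) (\tr (mean_mx P X *m mean_mx P Y)).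
Proof.
move=> m1 m2 i12 mX mY iX iY.
have h i j : has_mean (fun o => X o i j * Y o j i) (mean_mx P X i j * mean_mx P Y j i).
  by rewrite !mean_mxE; have [? ?] := indep_Ex_mul m1 m2 i12 (mX i j) (mY j i) (iX i j) (iY j i).
have E o : \tr (X o *m Y o) = \sum_i \sum_j X o i j * Y o j i.
  by apply: eq_bigr => i _; rewrite mxE.
split.
  apply: eq_Int (fun o => esym (E o)) _; apply: Int_sum => i _; apply: Int_sum => j _.
  by case: (h i j).
rewrite (@eq_Ex _ _ _ P _ _ E) Ex_sum; last first.
  by move=> i _; apply: Int_sum => j _; case: (h i j).
apply: eq_bigr => i _; rewrite mxE Ex_sum; last by move=> j _; case: (h i j).
by apply: eq_bigr => j _; case: (h i j).
Qed.

Lemma mean_ae k l (X Y : T -> 'M[R]_(k, l)) F G : all_meas F -> all_meas G ->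
  mxmw F X -> mxmw G Y ->
  {ae P, forall o, X o = Y o} -> mean_mx P X = mean_mx P Y.
Proof.
move=> mF mG mX mY h; apply/matrixP => i j; rewrite !mean_mxE; apply: ae_eq_Ex.
- exact: mw_measurable (mX i j).
- exact: mw_measurable (mY i j).
- by apply: filterS h => o ->.
Qed.

End MatrixExpectation.

Section ProductMeasurability.
Context {R : realType} {dsp : measure_display} {T : measurableType dsp}.
Variables (F1 F2 : set (T -> R)).

(* Measurability on the product of two sigma-algebras, in the format of [mw]. *)
Definition prod_gen : set (sigT F1 * sigT F2 -> R) := [set g | measurable_fun setT g].

Lemma mw_prod (g : sigT F1 * sigT F2 -> R) : mw prod_gen g -> measurable_fun setT g.
Proof. by apply: mw_measurable. Qed.

Lemma mxmw_fst k l (X : T -> 'M[R]_(k, l)) : mxmw F1 X ->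
  mxmw prod_gen (fun z => X (z.1 : T)).
Proof.
move=> mX i j; apply: mw_gen; have /mwP h := mX i j.
exact: (measurableT_comp h measurable_fst).
Qed.

Lemma mxmw_snd k l (X : T -> 'M[R]_(k, l)) : mxmw F2 X ->
  mxmw prod_gen (fun z => X (z.2 : T)).
Proof.
move=> mX i j; apply: mw_gen; have /mwP h := mX i j.
exact: (measurableT_comp h measurable_snd).
Qed.

End ProductMeasurability.

(** * Constraints and convexity *)

Section HardConstraint.
Context {R : realType} {m q n : nat}.
Variables (Nr : nat) (psi : 'I_n.+1 -> 'cV[R]_q -> 'cV[R]_q) (psimax umax : R).
Implicit Types (nu : nat -> bool) (t : nat) (z : decision R m q n).
Implicit Types (p : 'cV[R]_(stacked q n.+1)).


Definition gfac nu t (i : nat) : R := if (i < Nr)%N then gate nu t i else 1.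
Definition sfac nu t (i : nat) : R := if (i < Nr)%N then (nu (t + i)%N)%:R else 1.

Lemma gate01 nu t l : gate (R := R) nu t l = 0 \/ gate (R := R) nu t l = 1.
Proof.
elim: l => [|l [] /= ->]; first by rewrite /=; case: (nu t); [right|left].
  by case: (nu _); [right|left]; rewrite subr0 mul1r add0r.
by right; rewrite subrr mul0r addr0.
Qed.

Lemma gate_true t l : gate (R := R) (fun=> true) t l = 1.
Proof. by elim: l => //= l ->; rewrite subrr mul0r addr0. Qed.

Lemma gfac_norm nu t i : `|gfac nu t i| <= 1.
Proof.
rewrite /gfac; case: ifP => _; last by rewrite normr1.
by have [->|->] := gate01 nu t i; rewrite ?normr0 ?normr1.
Qed.

Lemma sfac_norm nu t i : `|sfac nu t i| <= 1.
Proof. by rewrite /sfac; case: ifP => _; [case: (nu _)|]; rewrite ?normr0 ?normr1. Qed.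

Lemma gfac_true t i : gfac (fun=> true) t i = 1.
Proof. by rewrite /gfac gate_true; case: ifP. Qed.

Lemma sfac_true t i : sfac (fun=> true) t i = 1.
Proof. by rewrite /sfac; case: ifP. Qed.

Lemma mxdiag_scalarE k N (a : 'I_N -> R) l (M : 'M[R]_(\sum_(i < N) k, l)) i j :
  ((\mxdiag_(i < N) ((a i)%:M : 'M[R]_k)) *m M) i j = a (tagnat.sig1 i) * M i j.
Proof.
rewrite -{1}(submxcolK M) mul_mxdiag_mxcol mxE mul_scalar_mx !mxE.
by rewrite tagnat.sig2K.
Qed.

Lemma applied_entry z nu t p i : applied Nr z nu t p i 0 =
  gfac nu t (tagnat.sig1 i) * z.1 i 0 + sfac nu t (tagnat.sig1 i) * (z.2 *m p) i 0.
Proof. by rewrite /applied mxE -mulmxA !mxdiag_scalarE. Qed.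

Lemma applied_true z t p i : applied Nr z (fun=> true) t p i 0 =
  z.1 i 0 + (z.2 *m p) i 0.
Proof. by rewrite applied_entry gfac_true sfac_true !mul1r. Qed.

Let spread z (i : 'I_(stacked m n.+1)) := \sum_j `|z.2 i j|.

Lemma applied_le z nu t p i : (forall j, `|p j 0| <= psimax) ->
  `|applied Nr z nu t p i 0| <= `|z.1 i 0| + spread z i * psimax.
Proof.
move=> hp; rewrite applied_entry; apply: (le_trans (ler_normD _ _)).
apply: lerD; rewrite normrM; first exact: ler_piMl (gfac_norm _ _ _).
apply: (le_trans (ler_piMl (normr_ge0 _) (sfac_norm _ _ _))).
rewrite mxE; apply: (le_trans (ler_norm_sum _ _ _)).
rewrite mulr_suml; apply: ler_sum => j _.
by rewrite normrM ler_wpM2l.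
Qed.

Let sgn (x : R) := (-1) ^+ (x < 0)%R : R.

Let sgnE x : sgn x * x = `|x|.
Proof. by rewrite /sgn; case: ltrP => h; [rewrite expr1 mulN1r ltr0_norm|rewrite expr0 mul1r ger0_norm]. Qed.

Let sgn2 x : sgn x * sgn x = 1.
Proof. by rewrite /sgn -expr2 sqrr_sign. Qed.

Let sgnn x : `|sgn x| = 1.
Proof. by rewrite /sgn normr_sign. Qed.

(* The feedback value at which row [i] of the control is largest. *)
Definition worst z i j : bool := ((z.1 i 0 < 0) (+) (z.2 i j < 0))%R.

(** The tolerance serves two uses: [eps = 0] for the full box, whose corners are attained, and a
    small positive one for a [psi] that only approaches them. *)
Lemma worst_le z t p i eps :
  (forall j, `|p j 0 - (-1) ^+ worst z i j * psimax| <= eps) ->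
  `|z.1 i 0| + spread z i * psimax <=
  `|applied Nr z (fun=> true) t p i 0| + spread z i * eps.
Proof.
move=> hp.
have E : sgn (z.1 i 0) * (z.1 i 0 + \sum_j z.2 i j * ((-1) ^+ worst z i j * psimax)) =
    `|z.1 i 0| + spread z i * psimax.
  rewrite mulrDr sgnE mulr_sumr /spread mulr_suml; congr (_ + _); apply: eq_bigr => j _.
  have -> : (-1) ^+ worst z i j = sgn (z.1 i 0) * sgn (z.2 i j) :> R by rewrite signr_addb.
  rewrite -(sgnE (z.2 i j)) -[RHS]mul1r -(sgn2 (z.1 i 0)).
  set a := sgn _; set b := sgn _; ring.
rewrite -E -lerBlDl; apply: le_trans (lerB (ler_norm _) (lexx _)) _.
rewrite normrM sgnn mul1r applied_true; apply: le_trans (lerB_dist _ _) _.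
rewrite opprD addrACA subrr add0r mxE -sumrB; apply: (le_trans (ler_norm_sum _ _ _)).
rewrite /spread mulr_suml; apply: ler_sum => j _.
by rewrite -mulrBr normrM ler_wpM2l // distrC.
Qed.

Lemma stack_psiE (zeta : 'I_n.+1 -> 'cV[R]_q) j :
  stack_psi psi zeta j 0 = psi (tagnat.sig1 j) (zeta (tagnat.sig1 j)) (tagnat.sig2 j) 0.
Proof. by rewrite mxE. Qed.

Hypothesis hpsi : psi_ok psi psimax.

(** The index [j] excludes [q = 0], where the bound on [psi] says nothing about the sign of
    [psimax]. *)
Lemma psimax_ge0 (j : 'I_q) : 0 <= psimax.
Proof. by have [_ _ h] := hpsi ord0; exact: le_trans (normr_ge0 _) (h 0 j). Qed.

Lemma robust_program t z :
  program_constraint psimax umax z <-> robust_hard_constraint Nr psimax umax t z.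
Proof.
split=> [[bl h]|[bl h]]; split => //.
  by move=> nu p hp i; exact: le_trans (applied_le _ _ _ _ hp) (h i).
move=> i; pose p : 'cV[R]_(stacked q n.+1) := \col_j ((-1) ^+ worst z i j * psimax).
have := @worst_le z t p i 0; rewrite mulr0 addr0 => w.
apply: (le_trans (w _)) => [j|]; first by rewrite mxE subrr normr0.
apply: h => j; rewrite mxE normrM normr_sign mul1r ger0_norm //.
exact: psimax_ge0 (tagnat.sig2 j).
Qed.

Lemma robust_hard t z :
  robust_hard_constraint Nr psimax umax t z -> hard_constraint Nr psi umax t z.
Proof.
move=> [bl h]; split => // nu zeta i; apply: h => j; rewrite stack_psiE.
by have [_ _] := hpsi (tagnat.sig1 j); exact.
Qed.

Lemma tight_hard_program t z : psi_tight psi psimax ->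
  hard_constraint Nr psi umax t z -> program_constraint psimax umax z.
Proof.
move=> tight [bl h]; split => // i; apply/ler_addgt0Pr => e e0.
have B0 : 0 <= spread z i by exact: sumr_ge0.
(* The error is multiplied by [spread z i]; adding 1 keeps the quotient defined for a zero row. *)
pose eps := e / (spread z i + 1).
have eps0 : 0 < eps by rewrite divr_gt0 // ltr_wpDl.
have ex k : exists zk : 'cV[R]_q, forall j,
    `|psi k zk j 0 - (-1) ^+ worst z i (tagnat.Rank k j) * psimax| < eps.
  exact: tight.
have [zeta hz] := choice ex.
have := @worst_le z t (stack_psi psi zeta) i eps.
move=> w; apply: (le_trans (w _)) => [j|].
  rewrite stack_psiE; have := hz (tagnat.sig1 j) (tagnat.sig2 j).
  by rewrite tagnat.sig2K => /ltW.
apply: lerD; first exact: h.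
rewrite /eps mulrA ler_pdivrMr ?ltr_wpDl // mulrC ler_pM2l //.
by rewrite lerDl.
Qed.

Lemma zero_program : 0 < umax -> program_constraint (n := n) (m := m) (q := q) psimax umax (0, 0).
Proof.
move=> u0; split=> [i j _|i]; first by rewrite submxblock0.
rewrite mxE normr0 add0r big1 ?mul0r ?ltW // => j _.
by rewrite mxE normr0.
Qed.

(** Zero innovations are an admissible realization, and oddness makes their feedback vanish; with
    every transmission successful only the offset is left. *)
Lemma eta_le t z : hard_constraint Nr psi umax t z -> forall i, `|z.1 i 0| <= umax.
Proof.
move=> [_ h] i; pose u zeta := z.2 *m stack_psi psi zeta.
have uN : u (fun=> 0) i 0 = 0.
  rewrite /u (_ : stack_psi psi _ = 0) ?mulmx0 ?mxE //; apply/matrixP => j l.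
  rewrite (ord1 l) stack_psiE mxE; have [_ odd _] := hpsi (tagnat.sig1 j).
  have := odd 0 (tagnat.sig2 j); rewrite oppr0 => e; lra.
by have := h (fun=> true) (fun=> 0) i; rewrite applied_true -/(u _) uN addr0.
Qed.

End HardConstraint.

(** * Polyhedral feasible set and convex quadratic objective *)

Section ConvexProgram.
Context {R : realType} {m q n : nat}.
Local Notation dec := (decision R m q n).

Lemma block_lower_entries (M : 'M[R]_(stacked m n.+1, stacked q n.+1)) :
  block_lower M <-> forall i j, (tagnat.sig1 i < tagnat.sig1 j)%N -> M i j = 0.
Proof.
split=> [h i j ij|h i j ij].
  have /matrixP/(_ (tagnat.sig2 i) (tagnat.sig2 j)) := h _ _ ij.
  by rewrite !mxE !tagnat.sig2K.
apply/matrixP => k l; rewrite [LHS]mxE [RHS]mxE; apply: h.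
by rewrite !tagnat.Rank1K.
Qed.

Lemma program_polyhedral (psimax umax : R) :
  (forall j : 'I_q, 0 <= psimax) ->
  polyhedral (program_constraint psimax umax : set dec).
Proof.
move=> p0.
pose sg (b : bool) : R := (-1) ^+ b.
have sgM b (x : R) : sg b * x <= `|x|.
  by apply: (le_trans (ler_norm _)); rewrite normrM normr_sign mul1r.
have sgE (x : R) : sg (x < 0)%R * x = `|x|.
  by rewrite /sg; case: ltrP => h; [rewrite expr1 mulN1r ltr0_norm|rewrite expr0 mul1r ger0_norm].
pose M := stacked m n.+1; pose Q := stacked q n.+1.
(* Each absolute value is the maximum over a sign, so a row yields one inequality per sign pattern;
   each vanishing entry of the gain yields two opposite inequalities. *)
pose I : finType := ('I_M * bool * {ffun 'I_Q -> bool} + 'I_M * 'I_Q * bool)%type.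
pose l (k : I) (z : dec) : R := match k with
  | inl (i, b, s) => sg b * z.1 i 0 + \sum_j sg (s j) * (z.2 i j * psimax)
  | inr (i, j, b) => if (tagnat.sig1 i < tagnat.sig1 j)%N then sg b * z.2 i j else 0
  end.
exists I, l, (fun k : I => if k is inl _ then umax else 0); split.
  move=> [[[i b] s]|[[i j] b]] a u v /=.
    rewrite !mxE.
    have -> : \sum_j sg (s j) * ((a *: u.2 + v.2) i j * psimax) =
        a * (\sum_j sg (s j) * (u.2 i j * psimax)) + \sum_j sg (s j) * (v.2 i j * psimax).
      by rewrite mulr_sumr -big_split /=; apply: eq_bigr => j _; rewrite !mxE; ring.
    by ring.
  by case: ifP => _; rewrite ?mulr0 ?addr0 // !mxE; ring.
move=> z; split.
  move=> [/block_lower_entries bl h] [[[i b] s]|[[i j] b]] /=; last first.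
    by case: ifP => // /bl ->; rewrite mulr0.
  apply: le_trans (h i); apply: lerD => //; rewrite mulr_suml; apply: ler_sum => j _.
  by have := sgM (s j) (z.2 i j * psimax); rewrite normrM (ger0_norm (p0 (tagnat.sig2 j))).
move=> h; split.
  apply/block_lower_entries => i j ij; have := h (inr (i, j, true)); have := h (inr (i, j, false)).
  rewrite /= ij /sg expr0 expr1 mul1r mulN1r oppr_le0 => h1 h2.
  by apply/eqP; rewrite eq_le h1 h2.
move=> i; have := h (inl (i, (z.1 i 0 < 0)%R, [ffun j => (z.2 i j < 0)%R])).
rewrite /= sgE; congr (_ + _ <= _); rewrite mulr_suml; apply: eq_bigr => j _.
by rewrite ffunE mulrA sgE.
Qed.

Variables (G GS SS : 'M[R]_(stacked m n.+1)) (Sp : 'M[R]_(stacked q n)).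
Variables (d : nat) (r1 r2 : 'rV[R]_(stacked m n.+1)) (p0 : 'cV[R]_q).
Variables (K1 : 'M[R]_(stacked d n.+1, stacked m n.+1)) (V1 : 'M[R]_(stacked q n, stacked d n.+1)).
Variables (K2 : 'M[R]_(d, stacked m n.+1)) (V2 : 'M[R]_(stacked q n, d)).

Definition quadratic_cost (z : dec) : R :=
  let eta := z.1 in let Th0 := head_cols z.2 in let Th' := tail_cols z.2 in
  (eta^T *m G *m eta) 0 0
  + \tr (SS *m Th0 *m (p0 *m p0^T) *m Th0^T)
  + \tr (SS *m Th' *m Sp *m Th'^T)
  + 2 * ((eta^T *m GS + r1) *m Th0 *m p0) 0 0
  + 2 * (r2 *m eta) 0 0
  + 2 * \tr (K1 *m Th' *m V1)
  + 2 * \tr (K2 *m Th' *m V2).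

(** The cross term couples [eta] with the first feedback column, so positivity has to hold jointly
    in the offset and in the known part [a] of the feedback. *)
Hypothesis joint_psd : forall eta a : 'cV[R]_(stacked m n.+1),
  0 <= (eta^T *m G *m eta) 0 0 + 2 * (eta^T *m GS *m a) 0 0 + (a^T *m SS *m a) 0 0.
Hypothesis tail_psd : forall Th' : 'M[R]_(stacked m n.+1, stacked q n),
  0 <= \tr (SS *m Th' *m Sp *m Th'^T).

Let head_colsP a (A B : 'M[R]_(stacked m n.+1, stacked q n.+1)) :
  head_cols (a *: A + B) = a *: head_cols A + head_cols B.
Proof. by apply/matrixP => i j; rewrite !mxE. Qed.

Let tail_colsP a (A B : 'M[R]_(stacked m n.+1, stacked q n.+1)) :
  tail_cols (a *: A + B) = a *: tail_cols A + tail_cols B.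
Proof. by apply/matrixP => i j; rewrite !mxE. Qed.

Let trmxP k l a (A B : 'M[R]_(k, l)) : (a *: A + B)^T = a *: A^T + B^T.
Proof. by rewrite linearP. Qed.

Let e00P a (A B : 'M[R]_1) : (a *: A + B) 0 0 = a * A 0 0 + B 0 0.
Proof. by rewrite !mxE. Qed.

Let trP k a (A B : 'M[R]_k) : \tr (a *: A + B) = a * \tr A + \tr B.
Proof. by rewrite mxtraceD mxtraceZ. Qed.

Let mullP k l p a (A B : 'M[R]_(k, l)) (C : 'M[R]_(l, p)) :
  (a *: A + B) *m C = a *: (A *m C) + B *m C.
Proof. by rewrite mulmxDl scalemxAl. Qed.

Let mulrP k l p a (A B : 'M[R]_(k, l)) (C : 'M[R]_(p, k)) :
  C *m (a *: A + B) = a *: (C *m A) + C *m B.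
Proof. by rewrite mulmxDr scalemxAr. Qed.

Let linE := (head_colsP, tail_colsP, trmxP, mullP, mulrP, e00P, trP).

Let be (u v : dec) : R :=
  (u.1^T *m G *m v.1) 0 0
  + \tr (SS *m head_cols u.2 *m (p0 *m p0^T) *m (head_cols v.2)^T)
  + \tr (SS *m tail_cols u.2 *m Sp *m (tail_cols v.2)^T)
  + 2 * (u.1^T *m GS *m head_cols v.2 *m p0) 0 0.

Let be_l a u1 u2 v : be (a *: u1 + u2) v = a * be u1 v + be u2 v.
Proof. by rewrite /be /= !linE; ring. Qed.

Let be_r a u1 u2 v : be v (a *: u1 + u2) = a * be v u1 + be v u2.
Proof. by rewrite /be /= !linE; ring. Qed.

Lemma quadratic_cost_convex : convex_quadratic quadratic_cost.
Proof.
(* [be] carries the whole cross term on one side and is not symmetric; symmetrizing does not change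
   its diagonal. *)
exists (fun u v => (be u v + be v u) / 2).
exists (fun z => 2 * (r1 *m head_cols z.2 *m p0) 0 0 + 2 * (r2 *m z.1) 0 0 +
  2 * \tr (K1 *m tail_cols z.2 *m V1) + 2 * \tr (K2 *m tail_cols z.2 *m V2)), 0.
split.
- by move=> u a v1 v2; rewrite be_l be_r /=; ring.
- by move=> u v; rewrite addrC.
- move=> u; have -> : (be u u + be u u) / 2 = be u u by field.
  have := addr_ge0 (joint_psd u.1 (head_cols u.2 *m p0)) (tail_psd (tail_cols u.2)).
  congr (0 <= _); rewrite /be !mulmxA.
  have -> : \tr (SS *m head_cols u.2 *m p0 *m p0^T *m (head_cols u.2)^T) =
      ((head_cols u.2 *m p0)^T *m SS *m head_cols u.2 *m p0) 0 0.
    rewrite -trace_mx11 -2!mulmxA mulmxA -trmx_mul mxtrace_mulC.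
    by rewrite !mulmxA.
  ring.
- by move=> a u v; rewrite /= !linE; ring.
- move=> u; have -> : (be u u + be u u) / 2 = be u u by field.
  rewrite /quadratic_cost /be /= mulmxDl mulmxDl.
  have -> (A B : 'M[R]_1) : (A + B) 0 0 = A 0 0 + B 0 0 by rewrite mxE.
  ring.
Qed.

End ConvexProgram.

(** * The horizon cost *)

Section BoundedMatrices.
Context {R : realType} {dsp : measure_display} {T : measurableType dsp}.
Variable P : probability T R.
Implicit Types (F : set (T -> R)).

Definition mxbd k l (X : T -> 'M[R]_(k, l)) := exists c, forall o i j, `|X o i j| <= c.

Lemma mxbd_cst k l (M : 'M[R]_(k, l)) : mxbd (fun=> M).
Proof.
exists (\sum_i \sum_j `|M i j|) => _ i j.
rewrite (bigD1 i) //= (bigD1 j) //= -addrA lerDl addr_ge0 ?sumr_ge0 // => a _.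
exact: sumr_ge0.
Qed.

Lemma mxbd_tr k l (X : T -> 'M[R]_(k, l)) : mxbd X -> mxbd (fun o => (X o)^T).
Proof. by move=> [c h]; exists c => o i j; rewrite mxE. Qed.

Lemma mxbdD k l (X Y : T -> 'M[R]_(k, l)) : mxbd X -> mxbd Y -> mxbd (fun o => X o + Y o).
Proof.
move=> [c h] [c' h']; exists (c + c') => o i j; rewrite mxE.
by apply: (le_trans (ler_normD _ _)); exact: lerD.
Qed.

Lemma mxbdM k l p (X : T -> 'M[R]_(k, l)) (Y : T -> 'M[R]_(l, p)) :
  mxbd X -> mxbd Y -> mxbd (fun o => X o *m Y o).
Proof.
move=> [c h] [c' h']; exists (\sum_(a < l) c * c') => o i j; rewrite mxE.
apply: (le_trans (ler_norm_sum _ _ _)); apply: ler_sum => a _.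
by rewrite normrM ler_pM.
Qed.

Lemma mxbd_Int F k l (X : T -> 'M[R]_(k, l)) : all_meas F -> mxmw F X -> mxbd X -> mxInt P X.
Proof. by move=> mF mX [c h]; exact: mxInt_bounded mF mX h. Qed.

Lemma mxInt_bdM F k l p (X : T -> 'M[R]_(k, l)) (Y : T -> 'M[R]_(l, p)) :
  all_meas F -> mxmw F X -> mxbd X -> mxInt P Y -> mxInt P (fun o => X o *m Y o).
Proof.
move=> mF mX [c h] iY i j.
apply: (@eq_Int _ _ _ _ (fun o => \sum_a X o i a * Y o a j)); first by move=> o; rewrite mxE.
apply: Int_sum => a _; apply: (@Int_boundedM _ _ _ _ c) => //.
exact: mw_measurable (mX i a).
Qed.

Definition has_mxmean k l (X : T -> 'M[R]_(k, l)) M := mxInt P X /\ mean_mx P X = M.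

Lemma has_mxmean_cst k l (M : 'M[R]_(k, l)) : has_mxmean (fun=> M) M.
Proof.
split; first exact: mxInt_cst.
by apply/matrixP => i j; rewrite mean_mxE Ex_cst.
Qed.

Lemma has_mxmeanD k l (X Y : T -> 'M[R]_(k, l)) A B :
  has_mxmean X A -> has_mxmean Y B -> has_mxmean (fun o => X o + Y o) (A + B).
Proof.
move=> [iX <-] [iY <-]; split; first exact: mxInt_D.
apply/matrixP => i j; have -> (A' B' : 'M[R]_(k, l)) : (A' + B') i j = A' i j + B' i j by rewrite mxE.
rewrite !mean_mxE -ExD //.
by apply: eq_Ex => o; rewrite mxE.
Qed.

Lemma has_mxmean_mull k l p (M : 'M[R]_(k, l)) (X : T -> 'M[R]_(l, p)) A :
  has_mxmean X A -> has_mxmean (fun o => M *m X o) (M *m A).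
Proof. by move=> [iX <-]; split; [exact: mxInt_mull|exact: mean_mull]. Qed.

Lemma has_mxmean_mulr k l p (M : 'M[R]_(l, p)) (X : T -> 'M[R]_(k, l)) A :
  has_mxmean X A -> has_mxmean (fun o => X o *m M) (A *m M).
Proof. by move=> [iX <-]; split; [exact: mxInt_mulr|exact: mean_mulr]. Qed.

Lemma has_mxmean_tr k l (X : T -> 'M[R]_(k, l)) A :
  has_mxmean X A -> has_mxmean (fun o => (X o)^T) A^T.
Proof. by move=> [iX <-]; split; [exact: mxInt_tr|exact: mean_tr]. Qed.

Lemma eq_has_mxmean k l (X Y : T -> 'M[R]_(k, l)) A B :
  X =1 Y -> A = B -> has_mxmean X A -> has_mxmean Y B.
Proof. by move=> /funext -> ->. Qed.

End BoundedMatrices.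

(** * Expectation over the future with the past frozen *)

Section InnerExpectation.
Context {R : realType} {dsp : measure_display} {T : measurableType dsp}.
Variable P : probability T R.
Variables (FN FS : set (T -> R)) (mFN : all_meas FN) (mFS : all_meas FS).
Hypothesis iNS : indep P (sigma_of FN) (sigma_of FS).
Variables (M Q d D : nat) (rG rS : T -> 'M[R]_M) (ps : T -> 'cV[R]_Q).
Variables (e : T -> 'cV[R]_d) (wv : T -> 'cV[R]_D).
Variables (al : 'M[R]_M) (QA : 'M[R]_(d, M)) (QD : 'M[R]_(D, M)).
Hypotheses (mG : mxmw FN rG) (bG : mxbd rG) (mS : mxmw FN rS) (bS : mxbd rS).
Hypotheses (mp : mxmw FS ps) (bp : mxbd ps) (me : mxmw FS e) (mwv : mxmw FS wv).
Hypotheses (p0 : mean_mx P ps = 0) (e0 : has_mxmean P e 0) (w0 : has_mxmean P wv 0).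
Hypothesis al_sym : al^T = al.

Let SG := mean_mx P (fun o => (rG o)^T *m al *m rG o).
Let SS := mean_mx P (fun o => (rS o)^T *m al *m rS o).
Let SGS := mean_mx P (fun o => (rG o)^T *m al *m rS o).
Let Sp := mean_mx P (fun o => ps o *m (ps o)^T).
Let Spw := mean_mx P (fun o => ps o *m (wv o)^T).
Let Sep := mean_mx P (fun o => ps o *m (e o)^T).

Let quad (X Y : T -> 'M[R]_M) : mxmw FN X -> mxbd X -> mxmw FN Y -> mxbd Y ->
  mxmw FN (fun o => (X o)^T *m al *m Y o) /\ mxInt P (fun o => (X o)^T *m al *m Y o).
Proof.
move=> mX bX mY bY.
have m1 : mxmw FN (fun o => (X o)^T *m al *m Y o).
  by apply: mxmwM => //; apply: mxmwM; [exact: mxmwT|exact: mxmw_cst].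
split=> //; apply: (@mxbd_Int _ _ _ P FN) => //; apply: mxbdM => //.
by apply: mxbdM; [exact: mxbd_tr|exact: mxbd_cst].
Qed.

Let hp : has_mxmean P ps 0.
Proof. by split => //; apply: (@mxbd_Int _ _ _ P FS). Qed.

Let hpx k (x : T -> 'cV[R]_k) : mxmw FS x -> mxInt P x ->
  has_mxmean P (fun o => ps o *m (x o)^T) (mean_mx P (fun o => ps o *m (x o)^T)).
Proof.
by move=> mx ix; split => //; apply: (@mxInt_bdM _ _ _ P FS) => //; exact: mxInt_tr.
Qed.

Let indepE (X Y : T -> 'M[R]_M) (B : 'M[R]_M) : mxmw FN X -> mxInt P X -> mxmw FS Y -> has_mxmean P Y B ->
  has_mean P (fun o => \tr (X o *m Y o)) (\tr (mean_mx P X *m B)).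
Proof. by move=> mX iX mY [iY <-]; exact: (has_mean_indep mFN mFS). Qed.

Definition control (eta a : 'cV[R]_M) (Th : 'M[R]_(M, Q)) (G S' : 'M[R]_M) (p : 'cV[R]_Q) : 'cV[R]_M :=
  G *m eta + S' *m (a + Th *m p).

(** The cost is a sum of five traces, each pairing control dropouts with the other sources. Terms
    linear in [ps], [e] or [wv] vanish in the mean, so only the second moments of [ps] and its
    correlations with [e] and [wv] survive. *)
Lemma inner_mean (xh : 'cV[R]_d) (eta a : 'cV[R]_M) (Th : 'M[R]_(M, Q)) :
  has_mean P (fun o => let u := control eta a Th (rG o) (rS o) (ps o) in
     qform al u + 2 * (((xh + e o)^T *m QA + (wv o)^T *m QD) *m u) 0 0)
   ((eta^T *m SG *m eta) 0 0 + (a^T *m SS *m a) 0 0 + \tr (SS *m Th *m Sp *m Th^T)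
    + 2 * (eta^T *m SGS *m a) 0 0
    + 2 * (xh^T *m QA *m (mean_mx P rG *m eta + mean_mx P rS *m a)) 0 0
    + 2 * \tr (QD *m mean_mx P rS *m Th *m Spw)
    + 2 * \tr (QA *m mean_mx P rS *m Th *m Sep)).
Proof.
pose b o := a + Th *m ps o; pose r o := (xh + e o)^T *m QA + (wv o)^T *m QD.
have mc k l (X : 'M[R]_(k, l)) : mxmw FS (fun=> X) by exact: mxmw_cst.
have mb : mxmw FS b by apply: mxmwD => //; exact: mxmwM.
have mr : mxmw FS r.
  by apply: mxmwD; apply: mxmwM => //; apply: mxmwT => //; exact: mxmwD.
have hb : has_mxmean P b a.
  apply: (eq_has_mxmean (X := b) (A := a + Th *m 0)) => //; first by rewrite mulmx0 addr0.
  by apply: has_mxmeanD; [exact: has_mxmean_cst|exact: has_mxmean_mull].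
have hr : has_mxmean P r (xh^T *m QA).
  apply: (eq_has_mxmean (X := r) (A := (xh + 0)^T *m QA + 0^T *m QD)) => //.
    by rewrite trmx0 mul0mx !addr0.
  apply: has_mxmeanD; apply: has_mxmean_mulr; apply: has_mxmean_tr => //.
  by apply: has_mxmeanD => //; exact: has_mxmean_cst.
have hbb : has_mxmean P (fun o => b o *m (b o)^T) (a *m a^T + Th *m Sp *m Th^T).
  apply: (eq_has_mxmean (X := fun o => a *m (b o)^T + (Th *m ps o *m a^T + Th *m (ps o *m (ps o)^T) *m Th^T))
    (A := a *m a^T + (Th *m 0 *m a^T + Th *m Sp *m Th^T))).
  - by move=> o; rewrite /b [in RHS]mulmxDl [(a + _)^T]linearD /= trmx_mul !mulmxDr !mulmxA.
  - by rewrite mulmx0 mul0mx add0r.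
  apply: has_mxmeanD; first exact/has_mxmean_mull/has_mxmean_tr.
  apply: has_mxmeanD; apply: has_mxmean_mulr; apply: has_mxmean_mull => //.
  by apply: hpx => //; case: hp.
have hbr : has_mxmean P (fun o => b o *m r o)
    (a *m (xh^T *m QA) + (Th *m Sep *m QA + Th *m Spw *m QD)).
  apply: (eq_has_mxmean (X := fun o => a *m r o + (Th *m ps o *m (xh^T *m QA) +
      (Th *m (ps o *m (e o)^T) *m QA + Th *m (ps o *m (wv o)^T) *m QD)))
    (A := a *m (xh^T *m QA) + (Th *m 0 *m (xh^T *m QA) + (Th *m Sep *m QA + Th *m Spw *m QD)))).
  - move=> o; rewrite /b [in RHS]mulmxDl; congr (_ + _).
    by rewrite /r [(xh + _)^T]linearD /= !mulmxDl !mulmxDr !mulmxA addrA.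
  - by rewrite mulmx0 mul0mx add0r.
  apply: has_mxmeanD; first exact: has_mxmean_mull.
  apply: has_mxmeanD; first by apply: has_mxmean_mulr; exact: has_mxmean_mull.
  apply: has_mxmeanD; apply: has_mxmean_mulr; apply: has_mxmean_mull; apply: hpx => //.
  + by case: e0.
  + by case: w0.
have hbe : has_mxmean P (fun o => b o *m eta^T) (a *m eta^T) by exact: has_mxmean_mulr.
have her : has_mxmean P (fun o => eta *m r o) (eta *m (xh^T *m QA)) by exact: has_mxmean_mull.
have [mGG iGG] := quad mG bG mG bG; have [mSS iSS] := quad mS bS mS bS.
have [mGS iGS] := quad mG bG mS bS.
have iG : mxInt P rG by exact: (@mxbd_Int _ _ _ P FN).
have iS : mxInt P rS by exact: (@mxbd_Int _ _ _ P FN).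
have t1 := indepE mGG iGG (mc _ _ (eta *m eta^T)) (has_mxmean_cst P (eta *m eta^T)).
have t2 := indepE mSS iSS (mxmwM mb (mxmwT mb)) hbb.
have t3 := indepE mGS iGS (mxmwM mb (mc _ _ eta^T)) hbe.
have t4 := indepE mG iG (mxmwM (mc _ _ eta) mr) her.
have t5 := indepE mS iS (mxmwM mb mr) hbr.
apply: eq_has_mean (has_meanD (has_meanD t1 t2) (has_meanD (has_meanZ 2 t3)
  (has_meanD (has_meanZ 2 t4) (has_meanZ 2 t5)))).
  move=> o /=; rewrite -/(r o) /control -/(b o) qform_add // /qform.
  have tm k (X : 'M[R]_k) (x y : 'cV[R]_k) : \tr (X *m (x *m y^T)) = (y^T *m X *m x) 0 0.
    by rewrite mulmxA mxtrace_mulC mulmxA trace_mx11.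
  have tn (X : 'M[R]_M) (x : 'cV[R]_M) (y : 'rV[R]_M) : \tr (X *m (x *m y)) = (y *m (X *m x)) 0 0.
    by rewrite mulmxA mxtrace_mulC trace_mx11.
  rewrite !tm !tn mulmxDr !trmx_mul !mulmxA.
  have -> (A B : 'M[R]_1) : (A + B) 0 0 = A 0 0 + B 0 0 by rewrite mxE.
  ring.
have tm (X : 'M[R]_M) (x y : 'cV[R]_M) : \tr (X *m (x *m y^T)) = (y^T *m X *m x) 0 0.
  by rewrite mulmxA mxtrace_mulC mulmxA trace_mx11.
have tn (X : 'M[R]_M) (x : 'cV[R]_M) (y : 'rV[R]_M) : \tr (X *m (x *m y)) = (y *m (X *m x)) 0 0.
  by rewrite mulmxA mxtrace_mulC trace_mx11.
rewrite !mulmxDr !mxtraceD !tm !tn -/SG -/SS -/SGS.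
have -> (A B : 'M[R]_1) : (A + B) 0 0 = A 0 0 + B 0 0 by rewrite mxE.
have -> : \tr (mean_mx P rS *m (Th *m Sep *m QA)) = \tr (QA *m mean_mx P rS *m Th *m Sep).
  by rewrite -!mulmxA [RHS]mxtrace_mulC !mulmxA.
have -> : \tr (mean_mx P rS *m (Th *m Spw *m QD)) = \tr (QD *m mean_mx P rS *m Th *m Spw).
  by rewrite -!mulmxA [RHS]mxtrace_mulC !mulmxA.
rewrite !mulmxA; ring.
Qed.

End InnerExpectation.

(** * The feedback signal as a function of the sources *)

Section IdealFeedback.
Context {R : realType} {d m q n : nat}.
Context {dsp : measure_display} {T : measurableType dsp}.
Variables (P : probability T R) (S : plant R d m q) (U : uncertainty R d q T).
Variables (ps pc : R).
Hypothesis hS : plant_ok S.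
Hypothesis hU : uncertainty_ok P S U ps pc.
Variables (psi : 'I_n.+1 -> 'cV[R]_q -> 'cV[R]_q) (psimax : R).
Hypothesis hpsi : psi_ok psi psimax.
Variables (Nr t : nat).

Let past := past_info S U t.
Let fut := future_info S U t.
Let future_meas : all_meas fut. Proof. exact: (future_info_meas hS hU). Qed.

Let gen_m J : all_meas (gen U J). Proof. exact: (gen_meas hU). Qed.

(** This splitting cuts across past and future: it separates the factors [rG] and [rS] from
    everything they multiply. *)
Definition control_source : set source := [set i | exists k, i = SrcNu k].
Definition other_source : set source := [set i | ~ control_source i].

Lemma control_other_indep :
  indep P (sigma_of (gen U control_source)) (sigma_of (gen U other_source)).
Proof. by apply: (gen_indep hU); apply/seteqP; split => // i []. Qed.

(** The error recursion restarted at time [t] has [post_err t] as its initial value, so no older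
    noise enters separately. *)
Lemma post_err_future j : mxmw fut (post_err S U (t + j)).
Proof.
elim: j => [|j IH]; first by rewrite addn0; apply: mxmw_entries => f hf; left.
have src i k (X : T -> 'cV[R]_k) : entries X `<=` source_gen U i -> future t i -> mxmw fut X.
  by move=> Xi Ji; apply: mxmw_entries => f /Xi fi; right; exists i.
have mp : mxmw fut (prior_err S U (t + j).+1).
  apply: mxmwD; first by apply: mxmwM => //; exact: mxmw_cst.
  by apply: (src (SrcW (t + j))) => //=; exact: leq_addr.
rewrite addnS; apply: mxmwB => //; apply: mxmwM; first exact: mxmw_cst.
apply: mxmwD; first by apply: mxmwM => //; exact: mxmw_cst.
by apply: (src (SrcV (t + j).+1)) => //=; rewrite ltnS leq_addr.
Qed.

Lemma post_err_other j : mxmw (gen U other_source) (post_err S U j).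
Proof.
move=> i l; apply: gen_sub (post_err_mw S U j i l).
by move=> [|k|k|k|k] //= _ [].
Qed.

Lemma ideal_innov_future j : (0 < j)%N -> mxmw fut (ideal_innov S U (t + j)).
Proof.
move=> j0; have tj : (t < t + j)%N by rewrite -addn1 leq_add2l.
apply: mxmwZ; first by apply: mw_gen; right; exists (SrcS (t + j)).
apply: mxmwD; first by apply: mxmwM; [exact: mxmw_cst|exact: post_err_future].
by apply: mxmw_entries => f hf; right; exists (SrcV (t + j)).
Qed.

Lemma ideal_innov_other j : mxmw (gen U other_source) (ideal_innov S U j).
Proof.
apply: mxmwZ; first by apply: mw_gen; exists (SrcS j) => //= -[].
apply: mxmwD; first by apply: mxmwM; [exact: mxmw_cst|exact: post_err_other].
by apply: (gen_mxmw (i := SrcV j)) => //= -[].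
Qed.

Lemma innovation_gauss k : exists V, gauss P (innovation S U k) V.
Proof.
exists (mC S *m prior_cov S k *m (mC S)^T + Sv S); apply: gaussD.
- exact/gauss_linear/(gauss_prior_err hS hU).
- exact: (gauss_vs hS hU).
- have := lin_indep_sub (M := mC S) (N := 1%:M) (@prior_err_vs_indep _ _ _ _ _ _ P S U _ _ hU k).
  by rewrite (_ : (fun o => 1%:M *m vs U k o) = vs U k) //; apply/funext => o; rewrite mul1mx.
Qed.

Lemma psi0 i : psi i 0 = 0.
Proof.
apply/matrixP => j l; rewrite (ord1 l) mxE; have [_ odd _] := hpsi i.
by have := odd 0 j; rewrite oppr0 => e; lra.
Qed.

Lemma ideal_psi_mean i k : mean_mx P (fun o => psi i (ideal_innov S U k o)) = 0.
Proof.
have [bpsi odd le] := hpsi i.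
apply/matrixP => j l; rewrite (ord1 l) mean_mxE mxE.
pose M := 1%:M - mC S *m kalman_gain S (prior_cov S k).
pose f (x : 'cV[R]_q) := psi i (M *m x) j 0.
have mf : mw (entries (@id 'cV[R]_q)) f.
  by apply: (mxmw_borel (X := fun x => M *m x) bpsi); apply: mxmwM; [exact: mxmw_cst|exact: mxmw_entries].
have [V gV] := innovation_gauss k; have [mV _ sV] := gV.
have E0 : Ex P (fun o => f (innovation S U k o)) = 0.
  have := cramer_wold_sym mV sV mf (fun x => le (M *m x) j).
  rewrite (@eq_Ex _ _ _ P _ (fun o => - f (innovation S U k o))); last first.
    by move=> o; rewrite /f mulmxN odd.
  rewrite ExN; first by move=> e; lra.
  apply: (@Int_bounded _ _ _ _ psimax) => [|o]; last exact: le.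
  apply: (mw_measurable (@gen_m _)); apply: (mxmw_borel (X := fun o => M *m innovation S U k o) bpsi).
  by apply: mxmwM; [exact: mxmw_cst|exact: innovation_mw].
(* A lost packet yields the value of [psi] at 0, which oddness makes 0; the dropout thus comes out
   as an independent factor. *)
rewrite (@eq_Ex _ _ _ P _ (fun o => (sd U k o)%:R * f (innovation S U k o))); last first.
  move=> o; rewrite /ideal_innov residualE -/M /f; case: (sd U k o).
    by rewrite scale1r mul1r.
  by rewrite scale0r psi0 mxE mul0r.
have ms : mw (gen U [set SrcS k]) (fun o => (sd U k o)%:R : R) by apply: mw_gen; exists (SrcS k).
have mi : mw (gen U (noise k k.+1)) (fun o => f (innovation S U k o)).
  apply: (mxmw_borel (X := fun o => M *m innovation S U k o) bpsi).
  by apply: mxmwM; [exact: mxmw_cst|exact: innovation_mw].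
have ind : indep P (sigma_of (gen U [set SrcS k])) (sigma_of (gen U (noise k k.+1))).
  by apply: (gen_indep hU); apply/seteqP; split => // -[|a|a|a|a] [] //= [].
have is' : Int P (fun o => (sd U k o)%:R : R).
  apply: (@Int_bounded _ _ _ _ 1) => [|o]; first exact: mw_measurable (@gen_m _) ms.
  by case: (sd U k o); rewrite ?normr1 ?normr0.
have ii : Int P (fun o => f (innovation S U k o)).
  apply: (@Int_bounded _ _ _ _ psimax) => [|o]; last exact: le.
  exact: mw_measurable (@gen_m _) mi.
have [_ ->] := indep_Ex_mul (@gen_m _) (@gen_m _) ind ms mi is' ii.
by rewrite E0 mulr0.
Qed.

Definition ideal_tail (o : T) : 'cV[R]_(stacked q n) :=
  \mxcol_(i < n) psi (lift ord0 i) (ideal_innov S U (t + lift ord0 i) o).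

Lemma ideal_tail_future : mxmw fut ideal_tail.
Proof.
apply: mxmw_col => i; have [bpsi _ _] := hpsi (lift ord0 i).
by apply: (mxmw_borel bpsi); exact: ideal_innov_future.
Qed.

Lemma ideal_tail_other : mxmw (gen U other_source) ideal_tail.
Proof.
apply: mxmw_col => i; have [bpsi _ _] := hpsi (lift ord0 i).
by apply: (mxmw_borel bpsi); exact: ideal_innov_other.
Qed.

Lemma ideal_tail_mxbd : mxbd ideal_tail.
Proof.
exists psimax => o i j; rewrite mxE (ord1 j).
by have [_ _] := hpsi (lift ord0 (tagnat.sig1 i)); exact.
Qed.

Lemma ideal_tail_mean : mean_mx P ideal_tail = 0.
Proof.
apply/matrixP => i j; rewrite mean_mxE [RHS]mxE (ord1 j).
have /matrixP/(_ (tagnat.sig2 i) 0) :=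
  ideal_psi_mean (lift ord0 (tagnat.sig1 i)) (t + lift ord0 (tagnat.sig1 i)).
rewrite mean_mxE [RHS]mxE => <-; apply: eq_Ex => o.
by rewrite mxE.
Qed.

Lemma w_stack_future : mxmw fut (w_stack (n := n) U t).
Proof.
apply: mxmw_col => i; apply: mxmw_entries => f hf; right.
by exists (SrcW (t + i)) => //=; exact: leq_addr.
Qed.

Lemma w_stack_other : mxmw (gen U other_source) (w_stack (n := n) U t).
Proof.
by apply: mxmw_col => i; apply: (gen_mxmw (i := SrcW (t + i))) => //= -[].
Qed.

Lemma w_moments k i : [/\ Int P (fun o => w U k o i 0 ^+ 2), Int P (fun o => w U k o i 0) &
  Ex P (fun o => w U k o i 0) = 0].
Proof.
have [_ _ _ _ [_ hw _]] := hS.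
exact: gauss_moments hw (gauss_w hS hU k).
Qed.

Lemma w_stack_mean : has_mxmean P (w_stack (n := n) U t) 0.
Proof.
have E (o : T) i j : w_stack (n := n) U t o i j =
    w U (t + tagnat.sig1 i) o (tagnat.sig2 i) 0 by rewrite mxE (ord1 j).
split => [i j|].
  apply: eq_Int (fun o => esym (E o i j)) _.
  by have [] := w_moments (t + tagnat.sig1 i) (tagnat.sig2 i).
apply/matrixP => i j; rewrite mean_mxE [RHS]mxE (@eq_Ex _ _ _ P _ _ (fun o => E o i j)).
by have [] := w_moments (t + tagnat.sig1 i) (tagnat.sig2 i).
Qed.

Lemma post_err_mean : has_mxmean P (post_err S U t) 0.
Proof.
split => [i j|].
  by rewrite (ord1 j); have [] := post_err_Int hS hU t i.
apply/matrixP => i j; rewrite mean_mxE [RHS]mxE (ord1 j).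
by have [] := post_err_Int hS hU t i.
Qed.

Let nu_hyp F := forall k, (t <= k)%N -> mw F (fun o => (nu U k o)%:R : R).

Let rGE o i j : rG U Nr t o i j = gfac Nr (fun k => nu U k o) t (tagnat.sig1 i) *
  (1%:M : 'M[R]_(stacked m n.+1)) i j.
Proof.
rewrite /rG -[calG _ _ _]mulmx1.
exact: (mxdiag_scalarE (fun l : 'I_n.+1 => gfac Nr (fun k => nu U k o) t l)).
Qed.

Let rSE o i j : rS U Nr t o i j = sfac Nr (fun k => nu U k o) t (tagnat.sig1 i) *
  (1%:M : 'M[R]_(stacked m n.+1)) i j.
Proof.
rewrite /rS -[calS _ _ _]mulmx1.
exact: (mxdiag_scalarE (fun l : 'I_n.+1 => sfac Nr (fun k => nu U k o) t l)).
Qed.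

Lemma rG_mw F : nu_hyp F -> mxmw F (rG (n := n) (m := m) U Nr t).
Proof.
move=> hF i j.
have hg l : mw F (fun o => gate (fun k => nu U k o) t l).
  elim: l => [|l IH] /=; first exact: hF.
  apply: mwD => //; apply: mwM; last by apply: hF; exact: leq_addr.
  by apply: mwB => //; exact: mw_cst.
apply: (@eq_mw _ _ _ (fun o => gfac Nr (fun k => nu U k o) t (tagnat.sig1 i) *
  (1%:M : 'M[R]_(stacked m n.+1)) i j)).
  by move=> o; rewrite rGE.
apply: mwM; last exact: mw_cst.
by rewrite /gfac; case: (_ < Nr)%N; [exact: hg|exact: mw_cst].
Qed.

Lemma rS_mw F : nu_hyp F -> mxmw F (rS (n := n) (m := m) U Nr t).
Proof.
move=> hF i j.
apply: (@eq_mw _ _ _ (fun o => sfac Nr (fun k => nu U k o) t (tagnat.sig1 i) *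
  (1%:M : 'M[R]_(stacked m n.+1)) i j)).
  by move=> o; rewrite rSE.
apply: mwM; last exact: mw_cst.
by rewrite /sfac; case: (_ < Nr)%N; [apply: hF; exact: leq_addr|exact: mw_cst].
Qed.

Lemma rG_mxbd : mxbd (rG (n := n) (m := m) U Nr t : T -> 'M[R]_(stacked m n.+1)).
Proof.
exists 1 => o i j.
rewrite rGE normrM mxE; apply: mulr_ile1; rewrite ?gfac_norm //.
by case: eqP; rewrite ?normr1 ?normr0.
Qed.

Lemma rS_mxbd : mxbd (rS (n := n) (m := m) U Nr t : T -> 'M[R]_(stacked m n.+1)).
Proof.
exists 1 => o i j.
rewrite rSE normrM mxE; apply: mulr_ile1; rewrite ?sfac_norm //.
by case: eqP; rewrite ?normr1 ?normr0.
Qed.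

Lemma nu_control : nu_hyp (gen U control_source).
Proof. by move=> k _; apply: mw_gen; exists (SrcNu k) => //; exists k. Qed.

Lemma nu_future : nu_hyp fut.
Proof. by move=> k tk; apply: mw_gen; right; exists (SrcNu k). Qed.

End IdealFeedback.

(** * Causality of the loop and of its continuations *)

Section Causality.
Context {R : realType} {d m q n : nat}.
Context {dsp : measure_display} {T : measurableType dsp}.
Variables (P : probability T R) (S : plant R d m q) (U : uncertainty R d q T).
Variables (ps pc : R).
Hypothesis hS : plant_ok S.
Hypothesis hU : uncertainty_ok P S U ps pc.
Variables (psi : 'I_n.+1 -> 'cV[R]_q -> 'cV[R]_q) (psimax umax : R).
Hypothesis hpsi : psi_ok psi psimax.
Variables (Nr t : nat) (L : loop R d m q T).
Hypothesis hL : is_loop P S U L (t + n.+1).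
Hypothesis hLadm : admissible_operation U L umax (t + n.+1).

Lemma admissible_causal k : (k < t + n.+1)%N ->
  (forall j, (j <= k)%N -> adapted_obs S U L j) ->
  (forall j, (j < k)%N -> adapted_act S U L j) -> adapted_act S U L k.
Proof.
move=> kN ho ha i j; have [h _] := hLadm kN; rewrite (ord1 j).
have hk := Mw (h i).
apply: mw_sub hk => f [fk|[l /= lk ->]]; last exact: nu_past.
by apply: (@past_info_mono _ _ _ _ _ _ S U k) => //; exact: controller_data_mw fk.
Qed.

Let adaptedL := loop_adapted hL admissible_causal.

Variables (z : T -> decision R m q n) (L' : loop R d m q T).
Hypothesis hz : data_dependent U t L z.
Hypothesis hbl : forall o, block_lower (z o).2.
Hypothesis hL' : continues_with P S U Nr t psi L z L'.

Lemma decision_mw : mxmw (controller_data U L t) (fun o => (z o).1) /\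
  mxmw (controller_data U L t) (fun o => (z o).2).
Proof.
have [h1 h2] := hz; split => [i j|i j].
  by rewrite (ord1 j); split; exact: h1.
by split; exact: h2.
Qed.

Lemma controller_past f : mw (controller_data U L t) f -> mw (past_info S U t) f.
Proof.
apply: mw_sub; apply: (controller_data_past hL admissible_causal).
exact: leq_addr.
Qed.

Lemma continuation_causal k : (k < t + n.+1)%N ->
  (forall j, (j <= k)%N -> adapted_obs S U L' j) ->
  (forall j, (j < k)%N -> adapted_act S U L' j) -> adapted_act S U L' k.
Proof.
have [_ actE _ appE] := hL'; move=> kN ho ha.
have [kt|tk] := ltnP k t.
  rewrite /adapted_act actE //; have kN' : (k <= t + n.+1)%N by exact: ltnW.
  by have [_] := adaptedL kN'; apply.
have [i ki] : exists i : 'I_n.+1, k = (t + i)%N.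
  have lt : (k - t < n.+1)%N by rewrite ltn_subLR.
  by exists (Ordinal lt); rewrite /= subnKC.
rewrite ki; move=> a b; rewrite (ord1 b) -ki.
pose r := tagnat.Rank (p_ := fun=> m) i a.
have r1 : tagnat.sig1 r = i by exact: tagnat.Rank1K.
(* Block lower triangularity cuts the sum at block [i], so the control at [t + i] involves only
   innovations up to that time; this breaks the apparent circularity. *)
have E o : act L' k o a 0 = gfac Nr (fun k => nu U k o) t i * (z o).1 r 0 +
   sfac Nr (fun k => nu U k o) t i * \sum_j (if (tagnat.sig1 j <= i)%N then
     (z o).2 r j * psi_stack S U t psi L' o j 0 else 0).
  have -> : act L' k o a 0 = act_stack t L' o r 0.
    by rewrite ki /act_stack -[in LHS](mxcolK (fun i : 'I_n.+1 => act L' (t + i) o) i) mxE.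
  rewrite appE applied_entry r1; congr (_ + _ * _); rewrite mxE; apply: eq_bigr => j _.
  case: leqP => // ij; rewrite (proj1 (block_lower_entries _) (hbl o) r j) ?mul0r //.
  by rewrite r1.
apply: eq_mw (fun o => esym (E o)) _.
have [mz1 mz2] := decision_mw.
have tk1 : (t <= k.+1)%N by exact: leqW.
have zp f : mw (controller_data U L t) f -> mw (past_info S U k.+1) f.
  by move=> /controller_past; exact: past_info_mono.
have nup j : (j <= k)%N -> mw (past_info S U k.+1) (fun o => (nu U j o)%:R : R).
  by move=> jk; exact: nu_past.
have mg l : (t + l <= k)%N -> mw (past_info S U k.+1) (fun o => gate (fun k => nu U k o) t l : R).
  elim: l => [|l IH] lk /=; first by apply: nup.
  have IH' := IH (leq_trans (leq_add (leqnn t) (leqnSn l)) lk).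
  by apply: mwD => //; apply: mwM; [apply: mwB => //; exact: mw_cst|exact: nup].
apply: mwD; apply: mwM.
- rewrite /gfac; case: (_ < Nr)%N; last exact: mw_cst.
  by apply: mg; rewrite ki.
- exact: zp.
- rewrite /sfac; case: (_ < Nr)%N; last exact: mw_cst.
  by apply: nup; rewrite ki.
apply: mw_sum => j _; case: (leqP (tagnat.sig1 j) i) => ji; last exact: mw_cst.
apply: mwM; first exact: zp.
apply: eq_mw (fun o => esym (mxE _ _ _ _)) _.
have [bpsi _ _] := hpsi (tagnat.sig1 j).
apply: (mxmw_borel bpsi); move=> a' b'.
have tjk : (t + tagnat.sig1 j <= k)%N by rewrite ki leq_add2l.
apply: (@past_info_mono _ _ _ _ _ _ S U (t + tagnat.sig1 j)); first exact: leqW.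
by apply: innov_mw; exact: ho.
Qed.

(** States and outputs agree by the dynamics, estimates by assumption, being otherwise determined
    only almost surely. The received innovation at [t], and with it the known feedback, is therefore
    the same pointwise. *)
Lemma continuation_past : [/\ forall k, (k <= t)%N -> st L' k = st L k,
  forall k, (k <= t)%N -> out L' k = out L k & innov S U L' t = innov S U L t].
Proof.
have [[st0' stS' outE' _] actE estE _] := hL'; have [st0 stS outE _] := hL.
have le k : (k <= t -> k <= t + n.+1)%N by move=> kt; exact: leq_trans kt (leq_addr _ _).
have hst k : (k <= t)%N -> st L' k = st L k.
  elim: k => [_|k IH kt]; first by rewrite st0 st0'.
  have kN : (k < t + n.+1)%N by rewrite (leq_trans kt) ?leq_addr.
  by apply/funext => o; rewrite stS // stS' // IH ?actE // ltnW.
have hout k : (k <= t)%N -> out L' k = out L k.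
  by move=> kt; apply/funext => o; rewrite outE ?outE' ?hst ?le.
by split => //; apply/funext => o; rewrite /innov hout ?estE.
Qed.

End Causality.

(** * Square-integrable vectors *)

Section SquareIntegrable.
Context {R : realType} {dsp : measure_display} {T : measurableType dsp}.
Variable P : probability T R.

Implicit Types (X Y : T -> R) (c : R).

Definition sq_int X := measurable_fun setT X /\ Int P (fun o => X o ^+ 2).

Lemma sq_int_mul X Y : sq_int X -> sq_int Y -> Int P (fun o => X o * Y o).
Proof.
move=> [mX iX] [mY iY].
apply: (Int_le (Y := fun o => X o ^+ 2 + Y o ^+ 2)) (IntD iX iY) _.
  exact: measurable_funM.
move=> o; rewrite normrM -(real_normK (num_real (X o))) -(real_normK (num_real (Y o))).
have := sqr_ge0 (`|X o| - `|Y o|); have := mulr_ge0 (normr_ge0 (X o)) (normr_ge0 (Y o)); nra.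
Qed.

Lemma sq_intD X Y : sq_int X -> sq_int Y -> sq_int (fun o => X o + Y o).
Proof.
move=> hX hY; have [mX iX] := hX; have [mY iY] := hY; split; first exact: measurable_funD.
apply: (@eq_Int _ _ _ _ (fun o => X o ^+ 2 + (2 * (X o * Y o) + Y o ^+ 2))); first by move=> o; ring.
by apply: IntD => //; apply: IntD => //; apply: IntZ; exact: sq_int_mul.
Qed.

Lemma sq_intZ c X : sq_int X -> sq_int (fun o => c * X o).
Proof.
move=> [mX iX]; split; first exact: measurable_funM.
by apply: eq_Int (IntZ (c ^+ 2) iX) => o; rewrite exprMn.
Qed.

Lemma sq_int_bounded c X : measurable_fun setT X -> (forall o, `|X o| <= c) -> sq_int X.
Proof.
move=> mX bX; split=> //; apply: (@Int_bounded _ _ _ _ (c ^+ 2)).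
  by apply: measurable_funX.
by move=> o; rewrite normrX; apply: lerXn2r => //; rewrite nnegrE // (le_trans _ (bX o)).
Qed.

Lemma sq_int_sum k (X : 'I_k -> T -> R) : (forall i, sq_int (X i)) ->
  sq_int (fun o => \sum_i X i o).
Proof.
move=> h; elim: k X h => [|k IH] X h.
  rewrite (_ : (fun o => _) = fun=> 0); last by apply/funext => o; rewrite big_ord0.
  by apply: (@sq_int_bounded 0) => // o; rewrite normr0.
rewrite (_ : (fun o => _) = fun o => X ord0 o + \sum_i X (lift ord0 i) o); last first.
  by apply/funext => o; rewrite big_ord_recl.
by apply: sq_intD => //; exact: IH.
Qed.

Definition sq_vec k (X : T -> 'cV[R]_k) := forall i, sq_int (fun o => X o i 0).

Lemma sq_vecD k (X Y : T -> 'cV[R]_k) : sq_vec X -> sq_vec Y -> sq_vec (fun o => X o + Y o).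
Proof.
move=> hX hY i; have := sq_intD (hX i) (hY i); congr sq_int.
by apply/funext => o; rewrite mxE.
Qed.

Lemma sq_vecM k l (M : 'M[R]_(l, k)) (X : T -> 'cV[R]_k) :
  sq_vec X -> sq_vec (fun o => M *m X o).
Proof.
move=> hX i; have := sq_int_sum (fun j => sq_intZ (M i j) (hX j)); congr sq_int.
by apply/funext => o; rewrite mxE.
Qed.

Lemma sq_vec_qform k (M : 'M[R]_k) (X : T -> 'cV[R]_k) :
  sq_vec X -> Int P (fun o => qform M (X o)).
Proof.
move=> hX.
apply: (@eq_Int _ _ _ _ (fun o => \sum_j (M^T *m X o) j 0 * X o j 0)).
  move=> o; rewrite /qform -[(X o)^T *m M]trmxK trmx_mul trmxK [RHS]mxE.
  by apply: eq_bigr => j _; congr (_ * _); rewrite [RHS]mxE.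
by apply: Int_sum => j _; apply: sq_int_mul => //; exact: sq_vecM.
Qed.

End SquareIntegrable.

Section Norms.
Context {R : realType}.

Definition norm1 k (v : 'cV[R]_k) : R := \sum_i `|v i 0|.

Lemma norm1_ge0 k (v : 'cV[R]_k) : 0 <= norm1 v.
Proof. exact: sumr_ge0. Qed.

Lemma norm1D k (u v : 'cV[R]_k) : norm1 (u + v) <= norm1 u + norm1 v.
Proof. by rewrite /norm1 -big_split /=; apply: ler_sum => i _; rewrite mxE ler_normD. Qed.

Lemma norm1_le k (v : 'cV[R]_k) c : (forall i, `|v i 0| <= c) -> norm1 v <= k%:R * c.
Proof.
move=> h; apply: (le_trans (ler_sum _ (fun i _ => h i))).
by rewrite sumr_const card_ord mulr_natl.
Qed.

Definition mxnorm1 k l (M : 'M[R]_(k, l)) : R := \sum_i \sum_j `|M i j|.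

Lemma mxnorm1_ge0 k l (M : 'M[R]_(k, l)) : 0 <= mxnorm1 M.
Proof. by apply: sumr_ge0 => i _; exact: sumr_ge0. Qed.

Lemma bilinear_le k l (M : 'M[R]_(k, l)) (v : 'cV[R]_k) (u : 'cV[R]_l) (c : R) : (forall j, `|u j 0| <= c) ->
  `|(v^T *m M *m u) 0 0| <= mxnorm1 M * c * norm1 v.
Proof.
move=> hu; rewrite -mulmxA mxE; apply: (le_trans (ler_norm_sum _ _ _)).
rewrite /norm1 mulr_sumr; apply: ler_sum => i _; rewrite normrM mxE mulrC.
apply: ler_wpM2r => //; rewrite mxE; apply: (le_trans (ler_norm_sum _ _ _)).
rewrite /mxnorm1 (bigD1 i) //= mulrDl -[leLHS]addr0; apply: lerD.
  by rewrite mulr_suml; apply: ler_sum => j _; rewrite normrM ler_wpM2l.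
rewrite mulr_suml; apply: sumr_ge0 => a _; rewrite mulr_suml; apply: sumr_ge0 => b _.
by rewrite mulr_ge0 // (le_trans _ (hu b)).
Qed.

End Norms.

(** * The cost with past and future at separate sample points *)

Section FrozenCost.
Context {R : realType} {d m q n : nat}.
Context {dsp : measure_display} {T : measurableType dsp}.
Variables (P : probability T R) (S : plant R d m q) (U : uncertainty R d q T).
Variables (ps pc : R).
Hypothesis hS : plant_ok S.
Hypothesis hU : uncertainty_ok P S U ps pc.
Variables (W : weights R d m).
Hypothesis hW : weights_ok W.
Variables (psi : 'I_n.+1 -> 'cV[R]_q -> 'cV[R]_q) (psimax : R).
Hypothesis hpsi : psi_ok psi psimax.
Variables (Nr t : nat) (umax : R).

Let past := past_info S U t.
Let future := future_info S U t.
Let past_meas : all_meas past. Proof. exact: (past_info_meas hU). Qed.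
Let future_meas : all_meas future. Proof. exact: (future_info_meas hS hU). Qed.
Let gen_m J : all_meas (gen U J). Proof. exact: (gen_meas hU). Qed.

Variables (eta a : T -> 'cV[R]_(stacked m n.+1)).
Variables (Th : T -> 'M[R]_(stacked m n.+1, stacked q n)) (xh : T -> 'cV[R]_d).
Hypotheses (meta : mxmw past eta) (ma : mxmw past a) (mTh : mxmw past Th).
Hypotheses (mxh : mxmw past xh) (ixh : mxInt P xh).

Let al := alpha (n := n) S W.
Let QA := calQA (n := n) S W.
Let QD := calQD (n := n) S W.
Let G := rG (n := n) (m := m) U Nr t.
Let S' := rS (n := n) (m := m) U Nr t.
Let psi' := ideal_tail S U psi t.
Let e := post_err S U t.
Let wv := w_stack (n := n) U t.

Definition frozen_control x y := control (eta x) (a x) (Th x) (G y) (S' y) (psi' y).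

(** Demanded for all pairs and not just on the diagonal: Fubini sees every combination of a past [x]
    with a future [y]. *)
Hypothesis bu : forall x y i, `|frozen_control x y i 0| <= umax.

Definition frozen_cost x y := let u := frozen_control x y in
  qform al u + 2 * (((xh x + e y)^T *m QA + (wv y)^T *m QD) *m u) 0 0.

Definition frozen_mean x :=
  ((eta x)^T *m SigmaG P S W U Nr t *m eta x) 0 0
  + ((a x)^T *m SigmaS P S W U Nr t *m a x) 0 0
  + \tr (SigmaS P S W U Nr t *m Th x *m mean_mx P (fun o => psi' o *m (psi' o)^T) *m (Th x)^T)
  + 2 * ((eta x)^T *m SigmaGS P S W U Nr t *m a x) 0 0
  + 2 * ((xh x)^T *m QA *m (muG P U Nr t *m eta x + muS P U Nr t *m a x)) 0 0
  + 2 * \tr (QD *m muS P U Nr t *m Th x *m mean_mx P (fun o => psi' o *m (wv o)^T))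
  + 2 * \tr (QA *m muS P U Nr t *m Th x *m mean_mx P (fun o => psi' o *m (e o)^T)).

Let nuC : forall k, (t <= k)%N -> mw (gen U control_source) (fun o => (nu U k o)%:R : R).
Proof. by move=> k; exact: (nu_control U). Qed.

Let nuF : forall k, (t <= k)%N -> mw future (fun o => (nu U k o)%:R : R).
Proof. by move=> k; exact: (nu_future S U). Qed.

Lemma frozen_meanP x : has_mean P (frozen_cost x) (frozen_mean x).
Proof.
have [tal _] := alpha_psd (n := n) S hW.
exact: (inner_mean (@gen_m control_source) (@gen_m other_source) (control_other_indep hU)
  QA QD (rG_mw Nr nuC) (rG_mxbd U Nr t) (rS_mw Nr nuC) (rS_mxbd U Nr t)
  (ideal_tail_other S U hpsi t) (ideal_tail_mxbd S U hpsi t)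
  (post_err_other S U t) (w_stack_other U t)
  (ideal_tail_mean hS hU hpsi t) (post_err_mean hS hU t) (w_stack_mean hS hU t) tal).
Qed.

Hypothesis umax0 : 0 <= umax.

(** With a bounded control the cost grows at most linearly in the estimate, the error and the noise,
    so it fits under the product of a past and a future function that [freeze] asks for. *)
Let bnd1 x := 1 + norm1 (xh x).
Let K1 := mxnorm1 al * umax * ((stacked m n.+1)%:R * umax).
Let K2 := 2 * (mxnorm1 QA * umax) + 2 * (mxnorm1 QD * umax).
Let bnd2 y := (K1 + K2) * (1 + (norm1 (e y) + norm1 (wv y))).

Let K10 : 0 <= K1.
Proof. by rewrite /K1 !mulr_ge0 // mxnorm1_ge0. Qed.

Lemma frozen_le x y : `|frozen_cost x y| <= bnd1 x * bnd2 y.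
Proof.
pose u := frozen_control x y; have hu : forall i, `|u i 0| <= umax by exact: bu.
have q1 : `|qform al u| <= K1.
  apply: (le_trans (bilinear_le al u hu)).
  by apply: ler_wpM2l; [rewrite mulr_ge0 // mxnorm1_ge0|exact: norm1_le].
have q2 : `|((xh x + e y)^T *m QA *m u) 0 0| <= mxnorm1 QA * umax * (norm1 (xh x) + norm1 (e y)).
  apply: (le_trans (bilinear_le _ _ hu)); apply: ler_wpM2l; last exact: norm1D.
  by rewrite mulr_ge0 // mxnorm1_ge0.
have q3 : `|((wv y)^T *m QD *m u) 0 0| <= mxnorm1 QD * umax * norm1 (wv y).
  exact: bilinear_le.
have E : frozen_cost x y = qform al u + (2 * ((xh x + e y)^T *m QA *m u) 0 0 +
    2 * ((wv y)^T *m QD *m u) 0 0).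
  by rewrite /frozen_cost -/u mulmxDl -mulrDr; congr (_ + 2 * _); rewrite mxE.
rewrite E; apply: (le_trans (ler_normD _ _)); apply: (le_trans (lerD (lexx _) (ler_normD _ _))).
rewrite !normrM [`|2|]ger0_norm // /bnd1 /bnd2 /K2.
have xa0 := norm1_ge0 (xh x); have xb0 := norm1_ge0 (e y); have xc0 := norm1_ge0 (wv y).
have A0 : 0 <= mxnorm1 QA * umax by rewrite mulr_ge0 // mxnorm1_ge0.
have D0 : 0 <= mxnorm1 QD * umax by rewrite mulr_ge0 // mxnorm1_ge0.
move: (K10) q1 q2 q3 A0 D0 xa0 xb0 xc0.
set KA := mxnorm1 QA * umax; set KD := mxnorm1 QD * umax.
set c1 := `|qform _ _|; set c2 := `|_|; set c3 := `|_|.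
set xa := norm1 (xh x); set xb := norm1 (e y); set xc := norm1 (wv y).
move=> k0 q1 q2 q3 A0 D0 xa0 xb0 xc0.
have h1 : 0 <= xa * (xb + xc) by rewrite mulr_ge0 // addr_ge0.
have h2 : K1 <= K1 * ((1 + xa) * (1 + (xb + xc))).
  by rewrite ler_peMr //; nra.
have h3 : KA * (xa + xb) <= KA * ((1 + xa) * (1 + (xb + xc))).
  by apply: ler_wpM2l => //; nra.
have h4 : KD * xc <= KD * ((1 + xa) * (1 + (xb + xc))).
  by apply: ler_wpM2l => //; nra.
have -> : (1 + xa) * ((K1 + (2 * KA + 2 * KD)) * (1 + (xb + xc))) =
  K1 * ((1 + xa) * (1 + (xb + xc))) + 2 * (KA * ((1 + xa) * (1 + (xb + xc)))) +
  2 * (KD * ((1 + xa) * (1 + (xb + xc)))) by ring.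
lra.
Qed.

(** The weight by a past event turns freezing into a statement about conditional expectations. *)
Let fA A x y := (\1_A x : R) * frozen_cost x y.

Let mfA A : sigma_of past A ->
  measurable_fun [set: sigT past * sigT future] (fun z => fA A z.1 z.2).
Proof.
move=> hA.
pose PG := @prod_gen _ _ _ past future.
have fst_ k l (X : T -> 'M[R]_(k, l)) : mxmw past X -> mxmw PG (fun z => X z.1) by exact: mxmw_fst.
have snd_ k l (X : T -> 'M[R]_(k, l)) : mxmw future X -> mxmw PG (fun z => X z.2) by exact: mxmw_snd.
have cst_ k l (X : 'M[R]_(k, l)) : mxmw PG (fun=> X) by exact: mxmw_cst.
have me : mxmw future e by have := post_err_future S U t 0; rewrite addn0.
have mu : mxmw PG (fun z => frozen_control z.1 z.2).
  apply: mxmwD; apply: mxmwM.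
  - exact/(snd_ _ _ G)/rG_mw.
  - exact: fst_.
  - exact/(snd_ _ _ S')/rS_mw.
  apply: mxmwD; first exact: fst_.
  by apply: mxmwM; [exact: fst_|apply: (snd_ _ _ psi'); exact: ideal_tail_future].
apply: mw_prod; apply: mwM.
  have m1 : mxmw past (fun x => \1_A x *: (1 : 'M[R]_1)).
    by apply: mxmwZ; [exact: mw_set|exact: mxmw_cst].
  by apply: eq_mw (fst_ _ _ _ m1 0 0) => z0; rewrite !mxE mulr1.
apply: mwD.
  have h : mxmw PG (fun z => (frozen_control z.1 z.2)^T *m al *m frozen_control z.1 z.2).
    by apply: mxmwM => //; apply: mxmwM => //; exact: mxmwT.
  exact: (h 0 0).
apply: mwM; first exact: mw_cst.
have h : mxmw PG (fun z => (((xh z.1 + e z.2)^T *m QA + (wv z.2)^T *m QD) *m frozen_control z.1 z.2)).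
  apply: mxmwM => //; apply: mxmwD; apply: mxmwM => //; apply: mxmwT.
    by apply: mxmwD; [exact: fst_|exact: snd_].
  apply: (snd_ _ _ wv); exact: w_stack_future.
exact: (h 0 0).
Qed.

Let norm1_mw F k (X : T -> 'cV[R]_k) : mxmw F X -> mw F (fun o => norm1 (X o)).
Proof. by move=> mX; apply: mw_sum => i _; apply: mw_comp. Qed.

Let norm1_Int k (X : T -> 'cV[R]_k) : mxInt P X -> Int P (fun o => norm1 (X o)).
Proof. by move=> iX; apply: Int_sum => i _; apply: Int_norm. Qed.

Let bnd1_ok : mw past bnd1 /\ Int P bnd1.
Proof.
split; first by apply: mwD; [exact: mw_cst|exact: norm1_mw].
by apply: IntD; [exact: Int_cst|exact: norm1_Int].
Qed.

Let bnd2_ok : mw future bnd2 /\ Int P bnd2.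
Proof.
have me : mxmw future e by have := post_err_future S U t 0; rewrite addn0.
have [ie _] := post_err_mean hS hU t; have [iw _] := w_stack_mean (n := n) hS hU t.
split.
  apply: mwM; first exact: mw_cst.
  apply: mwD; first exact: mw_cst.
  by apply: mwD; apply: norm1_mw => //; exact: w_stack_future.
apply: IntZ; apply: IntD; first exact: Int_cst.
by apply: IntD; exact: norm1_Int.
Qed.

Let fA_le A x y : `|fA A x y| <= bnd1 x * bnd2 y.
Proof.
rewrite normrM; apply: le_trans (frozen_le x y).
by rewrite ler_piMl // norm_indic.
Qed.

Let iPF : indep P (sigma_of past) (sigma_of future).
Proof. exact: (past_future_indep hS hU (t := t)). Qed.

Let inner A x : Ex P (fA A x) = \1_A x * frozen_mean x.
Proof. by have [iX <-] := frozen_meanP x; rewrite -ExZ. Qed.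

Lemma frozen_mean_Int : Int P frozen_mean.
Proof.
have [m1 i1] := bnd1_ok; have [m2 i2] := bnd2_ok.
have := freeze_inner_Int past_meas future_meas (mfA (@sigma_of_setT _ _ past)) m1 i1 m2 i2 (@fA_le setT).
by apply: eq_Int => x; rewrite inner indicT mul1r.
Qed.

Lemma frozen_cost_Int : Int P (fun o => frozen_cost o o).
Proof.
have [m1 i1] := bnd1_ok; have [m2 i2] := bnd2_ok.
have := freeze_diag_Int past_meas future_meas iPF (mfA (@sigma_of_setT _ _ past)) m1 i1 m2 i2 (@fA_le setT).
by apply: eq_Int => x; rewrite /fA indicT mul1r.
Qed.

Lemma frozen_expectation A : sigma_of past A ->
  Ex P (fun o => \1_A o * frozen_cost o o) = Ex P (fun o => \1_A o * frozen_mean o).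
Proof.
move=> hA; have [m1 i1] := bnd1_ok; have [m2 i2] := bnd2_ok.
rewrite (freeze (f := fA A) past_meas future_meas iPF (mfA hA) m1 i1 m2 i2 (@fA_le A)).
by apply: eq_Ex => x; rewrite inner.
Qed.

End FrozenCost.

(** * The objective regrouped around the known part of the feedback *)

Section ProgramCost.
Context {R : realType} {d m q n : nat}.
Context {dsp : measure_display} {T : measurableType dsp}.
Variables (P : probability T R) (S : plant R d m q) (U : uncertainty R d q T).
Variables (W : weights R d m).
Variables (psi : 'I_n.+1 -> 'cV[R]_q -> 'cV[R]_q) (Nr t : nat).

Lemma feedback_split (Th : 'M[R]_(stacked m n.+1, stacked q n.+1)) zeta :
  Th *m stack_psi psi zeta = head_cols Th *m psi ord0 (zeta ord0) +
    tail_cols Th *m \mxcol_(i < n) psi (lift ord0 i) (zeta (lift ord0 i)).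
Proof.
by rewrite -{1}(submxrowK Th) !mul_mxrow_mxcol [LHS]big_ord_recl.
Qed.

Lemma applied_control (z : decision R m q n) nu zeta :
  applied Nr z nu t (stack_psi psi zeta) =
  control z.1 (head_cols z.2 *m psi ord0 (zeta ord0)) (tail_cols z.2)
    (calG Nr nu t) (calS Nr nu t) (\mxcol_(i < n) psi (lift ord0 i) (zeta (lift ord0 i))).
Proof. by rewrite /applied /control -mulmxA feedback_split. Qed.

(** Brings the objective to the shape of [frozen_mean], where the first feedback column occurs only
    through its product with the known [p]. *)
Lemma program_costE L x p (z : decision R m q n) :
  program_cost P S W U Nr t psi L x p z =
  let a := head_cols z.2 *m p in let eta := z.1 in let Th := tail_cols z.2 in
  (eta^T *m SigmaG P S W U Nr t *m eta) 0 0
  + (a^T *m SigmaS P S W U Nr t *m a) 0 0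
  + \tr (SigmaS P S W U Nr t *m Th *m Sigma_psi P S U t psi L *m Th^T)
  + 2 * (eta^T *m SigmaGS P S W U Nr t *m a) 0 0
  + 2 * (x^T *m calQA S W *m (muG P U Nr t *m eta + muS P U Nr t *m a)) 0 0
  + 2 * \tr (calQD S W *m muS P U Nr t *m Th *m Sigma_psi_w P S U t psi L)
  + 2 * \tr (calQA S W *m muS P U Nr t *m Th *m Sigma_e_psi P S U t psi L).
Proof.
rewrite /program_cost /=; set a := head_cols z.2 *m p.
have -> : \tr (SigmaS P S W U Nr t *m head_cols z.2 *m (p *m p^T) *m (head_cols z.2)^T) =
    (a^T *m SigmaS P S W U Nr t *m a) 0 0.
  rewrite -trace_mx11 -[a^T *m _ *m a]mulmxA [RHS]mxtrace_mulC /a trmx_mul !mulmxA.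
  by [].
have D (X Y : 'M[R]_1) : (X + Y) 0 0 = X 0 0 + Y 0 0 by rewrite mxE.
have E (u v : 'rV[R]_(stacked m n.+1)) :
    ((u + v) *m head_cols z.2 *m p) 0 0 = (u *m a) 0 0 + (v *m a) 0 0.
  by rewrite -mulmxA mulmxDl D.
have E' (k : nat) (u : 'rV[R]_k) (M N : 'M[R]_(k, stacked m n.+1)) (eta : 'cV[R]_(stacked m n.+1)) b :
    (u *m (M *m eta + N *m b)) 0 0 = (u *m M *m eta) 0 0 + (u *m N *m b) 0 0.
  by rewrite mulmxDr D !mulmxA.
rewrite E E'.
have r (a1 a2 a3 b1 b2 c1 d1 d2 : R) :
  a1 + a2 + a3 + 2 * (b1 + b2) + 2 * c1 + d1 + d2 = a1 + a2 + a3 + 2 * b1 + 2 * (c1 + b2) + d1 + d2.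
  by ring.
exact: r.
Qed.

End ProgramCost.

(** * Conditional expectation of the horizon cost *)

Section HorizonExpectation.
Context {R : realType} {d m q n : nat}.
Context {dsp : measure_display} {T : measurableType dsp}.
Variables (P : probability T R) (S : plant R d m q) (U : uncertainty R d q T).
Variables (ps pc : R).
Hypothesis hS : plant_ok S.
Hypothesis hU : uncertainty_ok P S U ps pc.
Variables (umax : R) (W : weights R d m).
Hypotheses (umax0 : 0 < umax) (hW : weights_ok W).
Variables (psi : 'I_n.+1 -> 'cV[R]_q -> 'cV[R]_q) (psimax : R).
Hypothesis hpsi : psi_ok psi psimax.
Variables (Nr t : nat).

Let past := past_info S U t.
Let past_meas k : all_meas (past_info S U k). Proof. exact: (past_info_meas hU). Qed.

Definition all_measurable : set (T -> R) := [set f | measurable_fun setT f].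

Lemma all_measurable_meas : all_meas all_measurable. Proof. by []. Qed.

Lemma mxmw_all F k l (X : T -> 'M[R]_(k, l)) : all_meas F -> mxmw F X -> mxmw all_measurable X.
Proof. by move=> mF mX i j; apply: mw_gen; exact: mw_measurable (mX i j). Qed.

Section Tail.
Variable M : loop R d m q T.
Hypothesis hM : is_loop P S U M (t + n.+1).
Hypothesis causal : forall k, (k < t + n.+1)%N ->
  (forall j, (j <= k)%N -> adapted_obs S U M j) ->
  (forall j, (j < k)%N -> adapted_act S U M j) -> adapted_act S U M k.

(** Proved for an arbitrary causal loop, since it is applied both to [L], whose moments define the
    program, and to the continuation [L'], whose cost is evaluated. *)
Lemma psi_tail_ideal : {ae P, forall o, psi_tail S U t psi M o = ideal_tail S U psi t o}.
Proof.
have h (i : 'I_n) : {ae P, forall o, innov S U M (t + lift ord0 i) o =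
    ideal_innov S U (t + lift ord0 i) o}.
  by apply: (innov_ideal hS hU hM causal); rewrite leq_add2l ltnW.
have := ae_forall_ord h; apply: filterS => o ho.
by apply/mxcolP => i; rewrite !mxcolK ho.
Qed.

Lemma psi_tail_mw : mxmw all_measurable (psi_tail S U t psi M).
Proof.
apply: mxmw_col => i; have [bpsi _ _] := hpsi (lift ord0 i).
apply: (mxmw_borel bpsi); apply: mxmw_all (@past_meas (t + lift ord0 i)) _.
by apply: (innov_past hM causal); rewrite leq_add2l ltnW.
Qed.

Lemma est_err_mw : mxmw all_measurable (est_err M t).
Proof.
have tN : (t <= t + n.+1)%N by exact: leq_addr.
have [[_ me] _] := loop_adapted hM causal tN.
have hact j : (j < t)%N -> adapted_act S U M j.
  move=> jt; have jN := leq_trans jt tN.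
  by have [_] := loop_adapted hM causal (ltnW jN); apply.
have mst : mxmw all_measurable (st M t).
  have -> : st M t = fun o => ideal_est S U M t o + post_err S U t o.
    by apply/funext => o; rewrite /ideal_est subrK.
  apply: mxmwD; first exact: mxmw_all (@past_meas t) (ideal_est_mw hM tN hact).
  by apply: mxmw_all (post_err_mw S U t); exact: (gen_meas hU).
by apply: mxmwB => //; exact: mxmw_all (@past_meas t) me.
Qed.

Let ideal_tail_all : mxmw all_measurable (ideal_tail S U psi t).
Proof. by apply: mxmw_all (ideal_tail_other S U hpsi t); exact: (gen_meas hU). Qed.

Let w_stack_all : mxmw all_measurable (w_stack (n := n) U t).
Proof. by apply: mxmw_all (w_stack_other U t); exact: (gen_meas hU). Qed.

Lemma Sigma_psi_ideal : Sigma_psi P S U t psi M =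
  mean_mx P (fun o => ideal_tail S U psi t o *m (ideal_tail S U psi t o)^T).
Proof.
apply: (mean_ae all_measurable_meas all_measurable_meas).
- by apply: mxmwM; [|apply: mxmwT]; exact: psi_tail_mw.
- by apply: mxmwM => //; exact: mxmwT.
- by apply: filterS psi_tail_ideal => o ->.
Qed.

Lemma Sigma_psi_w_ideal : Sigma_psi_w P S U t psi M =
  mean_mx P (fun o => ideal_tail S U psi t o *m (w_stack (n := n) U t o)^T).
Proof.
apply: (mean_ae all_measurable_meas all_measurable_meas).
- by apply: mxmwM; [exact: psi_tail_mw|exact: mxmwT].
- by apply: mxmwM => //; exact: mxmwT.
- by apply: filterS psi_tail_ideal => o ->.
Qed.

Lemma Sigma_e_psi_ideal : Sigma_e_psi P S U t psi M =
  mean_mx P (fun o => ideal_tail S U psi t o *m (post_err S U t o)^T).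
Proof.
have he := est_err_ideal hS hU hM causal (leq_addr n.+1 t).
apply: (mean_ae all_measurable_meas all_measurable_meas).
- by apply: mxmwM; [exact: psi_tail_mw|apply: mxmwT; exact: est_err_mw].
- apply: mxmwM => //; apply: mxmwT.
  by apply: mxmw_all (post_err_mw S U t); exact: (gen_meas hU).
- by apply: filterS2 psi_tail_ideal he => o -> ->.
Qed.

End Tail.

Variable L : loop R d m q T.
Hypothesis hL : is_loop P S U L (t + n.+1).
Hypothesis hLadm : admissible_operation U L umax (t + n.+1).
Let hLc := admissible_causal (S := S) hLadm.
Let ctrl := controller_data U L t.
Let tN : (t <= t + n.+1)%N. Proof. exact: leq_addr. Qed.

Let ctrl_past f : mw ctrl f -> mw past f.
Proof. by apply: mw_sub; exact: (controller_data_past hL hLc tN). Qed.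

Let ctrl_meas : all_meas ctrl.
Proof. by move=> f fc; apply: (mw_measurable (@past_meas t)); apply: ctrl_past; exact: mw_gen. Qed.

Lemma state_sq k : (k <= t)%N -> sq_vec P (st L k).
Proof.
have [st0 stS _ _] := hL; have [_ _ _ _ [hx _ _]] := hS.
elim: k => [_|k IH kt].
  rewrite st0 => i; have [i2 i1 _] := gauss_moments i hx (gauss_prior_err hS hU 0).
  by split; [exact: Int_meas i1|exact: i2].
have kN : (k < t + n.+1)%N by rewrite (leq_trans kt).
have -> : st L k.+1 = fun o => mA S *m st L k o + mB S *m act L k o + w U k o.
  by apply/funext => o; rewrite stS.
apply: sq_vecD; last first.
  move=> i; have [i2 i1 _] := w_moments hS hU k i.
  by split; [exact: Int_meas i1|exact: i2].
apply: sq_vecD; apply: sq_vecM; first exact/IH/ltnW.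
move=> i; have [_ bk] := hLadm kN; apply: (@sq_int_bounded _ _ _ _ umax) => [|o]; last exact: bk.
have [_ /(_ kN) ma] := loop_adapted hL hLc (ltnW kN).
exact: mw_measurable (@past_meas k.+1) (ma i 0).
Qed.

(** Refers to the state of [L] at time [t], hence is common to all policies and continuations. *)
Let free_cost o := qform (calQ (n := n) W) (calA S *m st L t o + calD S *m w_stack U t o).

Lemma free_cost_Int : Int P free_cost.
Proof.
apply: sq_vec_qform; apply: sq_vecD; apply: sq_vecM; first exact: state_sq.
move=> i; have [] := w_moments hS hU (t + tagnat.sig1 i) (tagnat.sig2 i) => i2 i1 _.
have E : (fun o => w_stack (n := n) U t o i 0) =
    fun o => w U (t + tagnat.sig1 i) o (tagnat.sig2 i) 0.
  by apply/funext => o; rewrite mxE.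
by rewrite E; split; [exact: Int_meas i1|exact: i2].
Qed.

Variable xt : T -> 'cV[R]_d.
Hypothesis hxt : is_condexp_vec P (controller_sigma U L t) (st L t) xt.

Variable c : T -> R.
Hypothesis hc : is_condexp P (controller_sigma U L t) free_cost c.
Variables (z : T -> decision R m q n) (L' : loop R d m q T).
Hypothesis hz : data_dependent U t L z.
Hypothesis hh : forall o, hard_constraint Nr psi umax t (z o).
Hypothesis hL' : continues_with P S U Nr t psi L z L'.

Let al := alpha (n := n) S W.
Let QA := calQA (n := n) S W.
Let QD := calQD (n := n) S W.
Let xh := ideal_est S U L t.
Let eta o := (z o).1.
Let a o := head_cols (z o).2 *m psi_head S U t psi L o.
Let Th o := tail_cols (z o).2.
Let G := rG (n := n) (m := m) U Nr t.
Let S' := rS (n := n) (m := m) U Nr t.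

Let hbl o : block_lower (z o).2. Proof. by have [] := hh o. Qed.
Let hLc' := continuation_causal (S := S) hpsi hL hLadm hz hbl hL'.
Let hL'loop : is_loop P S U L' (t + n.+1). Proof. by have [] := hL'. Qed.

Let meta : mxmw ctrl eta. Proof. by have [] := decision_mw hz. Qed.

Let mTh0 : mxmw ctrl (fun o => head_cols (z o).2).
Proof.
have [_ h] := decision_mw hz => i j; apply: eq_mw (h i (tagnat.Rank ord0 j)) => o.
by rewrite [RHS]mxE.
Qed.

Let mTh : mxmw ctrl Th.
Proof.
have [_ h] := decision_mw hz => i j.
apply: eq_mw (h i (tagnat.Rank (lift ord0 (tagnat.sig1 j)) (tagnat.sig2 j))) => o.
by rewrite [RHS]mxE [RHS]mxE.
Qed.

Let mhead : mxmw ctrl (psi_head S U t psi L).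
Proof.
have [bpsi _ _] := hpsi ord0; apply: (mxmw_borel bpsi).
have -> : innov S U L t = fun o => (sd U t o)%:R *: out L t o - mC S *m ((sd U t o)%:R *: est L t o).
  by apply/funext => o; rewrite /innov scalerBr scalemxAr.
have ts : (`I_t.+1 t : Prop) by exact: ltnSn.
apply: mxmwB; last (apply: mxmwM; first exact: mxmw_cst).
  by apply: mxmw_entries => f fe; left; exists t => //; left; left.
by apply: mxmw_entries => f fe; left; exists t => //; left; right.
Qed.

Let ma : mxmw ctrl a. Proof. exact: mxmwM. Qed.

Let mxh : mxmw past xh.
Proof.
apply: (ideal_est_mw hL tN) => j jt; have jN := leq_trans jt tN.
by have [_] := loop_adapted hL hLc (ltnW jN); apply.
Qed.

Let ixh : mxInt P xh.
Proof.
move=> i j; rewrite (ord1 j).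
have [is' _ _ _] := hxt i; have [ie _] := post_err_Int hS hU t i.
by apply: eq_Int (IntB is' ie) => o; rewrite !mxE.
Qed.

Let ctrl_past_mx k l (X : T -> 'M[R]_(k, l)) : mxmw ctrl X -> mxmw past X.
Proof. by move=> mX i j; exact: ctrl_past. Qed.

Let bu x y i : `|frozen_control S U psi Nr t eta a Th x y i 0| <= umax.
Proof.
have [_ h] := hh x.
(* A fictitious realization with the first innovation taken at [x] and the later ones at [y]; the
   hard constraint covers it because it quantifies over all received innovations. *)
pose zeta (k : 'I_n.+1) := if unlift ord0 k is Some j
  then ideal_innov S U (t + lift ord0 j) y else innov S U L t x.
have := h (fun k => nu U k y) zeta i; rewrite applied_control; congr (`|(_ : 'cV_ _) i 0| <= _).
rewrite /frozen_control /control /a /zeta unlift_none; congr (_ + _ *m (_ + _ *m _)).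
by congr mxcol; apply/funext => j; rewrite liftK.
Qed.

Let act_applied l o i : act L' (t + (l : 'I_n.+1)) o i 0 =
  act_stack (n := n) t L' o (tagnat.Rank (p_ := fun=> m) l i) 0.
Proof.
by rewrite /act_stack -[in LHS](mxcolK (fun i : 'I_n.+1 => act L' (t + i) o) l) mxE.
Qed.

Let act_stack_le o i : `|act_stack (n := n) t L' o i 0| <= umax.
Proof. by have [_ _ _ ->] := hL'; have [_ h] := hh o; exact: h. Qed.

Lemma continuation_bounded o (l : 'I_n.+1) i : `|act L' (t + l) o i 0| <= umax.
Proof. by rewrite act_applied; exact: act_stack_le. Qed.

Let act_stackE o : act_stack t L' o =
  control (eta o) (a o) (Th o) (G o) (S' o) (psi_tail S U t psi L' o).
Proof.
have [_ _ _ ->] := hL'; have [_ _ iE] := continuation_past hL hL'.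
by rewrite /psi_stack applied_control addn0 iE.
Qed.

Let true_cost o := qform al (act_stack t L' o) +
  2 * (((st L t o)^T *m QA + (w_stack (n := n) U t o)^T *m QD) *m act_stack t L' o) 0 0.

Let horizon_costE o : horizon_cost W t L' (n := n) o = free_cost o + true_cost o.
Proof.
have [_ stS _ _] := hL'loop; have [stE _ _] := continuation_past hL hL'.
rewrite /horizon_cost /st_stack (@stack_expand _ _ _ _ n S (fun k => st L' (t + k) o)
  (fun k => act L' (t + k) o) (fun k => w U (t + k) o)); last first.
  by move=> k kn; rewrite addnS stS // ltn_add2l.
by rewrite addn0 stE // (cost_expand S hW) -addrA.
Qed.

Let true_frozen : {ae P, forall o, true_cost o = frozen_cost S U W psi Nr t eta a Th xh o o}.
Proof.
apply: filterS (psi_tail_ideal hL'loop hLc') => o E.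
rewrite /true_cost /frozen_cost /frozen_control act_stackE E.
by rewrite /xh /ideal_est subrK.
Qed.

Let mact : mxmw all_measurable (act_stack (n := n) t L').
Proof.
apply: mxmw_col => l; have kN : (t + l < t + n.+1)%N by rewrite ltn_add2l.
have [_ /(_ kN) h] := loop_adapted hL'loop hLc' (ltnW kN).
exact: mxmw_all (@past_meas (t + l).+1) h.
Qed.

Let bact : mxbd (act_stack (n := n) t L' : T -> 'cV_(stacked m n.+1)).
Proof. by exists umax => o i j; rewrite (ord1 j). Qed.

Let true_cost_Int : Int P true_cost.
Proof.
have iq : Int P (fun o => qform al (act_stack t L' o)).
  apply: (@mxbd_Int _ _ _ P all_measurable _ _
    (fun o => (act_stack t L' o)^T *m al *m act_stack t L' o)) => //.
    by apply: mxmwM => //; apply: mxmwM; [exact: mxmwT|exact: mxmw_cst].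
  by apply: mxbdM => //; apply: mxbdM; [exact: mxbd_tr|exact: mxbd_cst].
have ist : mxInt P (st L t) by move=> i j; rewrite (ord1 j); have [] := hxt i.
have [iw _] := w_stack_mean (n := n) hS hU t.
apply: IntD => //; apply: IntZ.
have ir : mxInt P (fun o => (st L t o)^T *m QA + (w_stack (n := n) U t o)^T *m QD).
  by apply: mxInt_D; apply: mxInt_mulr; exact: mxInt_tr.
have := mxInt_bdM all_measurable_meas (mxmwT mact) (mxbd_tr bact) (mxInt_tr ir).
by move=> /(_ 0 0); apply: eq_Int => o; rewrite -trmx_mul mxE.
Qed.

Let frozen_Int : Int P (fun o => frozen_cost S U W psi Nr t eta a Th xh o o).
Proof.
exact: (frozen_cost_Int hS hU W hpsi (ctrl_past_mx meta) (ctrl_past_mx ma)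
  (ctrl_past_mx mTh) mxh ixh bu (ltW umax0)).
Qed.

Let fmean := frozen_mean P S U W psi Nr t eta a Th xh.

Let fmean_Int : Int P fmean.
Proof.
exact: (frozen_mean_Int hS hU hW hpsi (ctrl_past_mx meta) (ctrl_past_mx ma)
  (ctrl_past_mx mTh) mxh ixh bu (ltW umax0)).
Qed.

Let fmeanE A : sigma_of past A -> Ex P (fun o => \1_A o * true_cost o) = Ex P (fun o => \1_A o * fmean o).
Proof.
move=> hA; have mA := sigma_of_measurable (@past_meas t) hA.
rewrite -(frozen_expectation hS hU hW hpsi (ctrl_past_mx meta) (ctrl_past_mx ma)
  (ctrl_past_mx mTh) mxh ixh bu (ltW umax0) hA).
apply: ae_eq_Ex.
- exact: Int_meas (Int_indicM mA true_cost_Int).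
- exact: Int_meas (Int_indicM mA frozen_Int).
- by apply: filterS true_frozen => o ->.
Qed.

Let b o := QA *m (muG P U Nr t *m eta o + muS P U Nr t *m a o).

Let a_le o i : `|a o i 0| <= umax + umax.
Proof.
have e := eta_le hpsi (hh o) i; have [_ h] := hh o.
(* Later innovations set to 0 leave offset plus known feedback below [umax]; the offset alone obeys
   the same bound, whence twice [umax]. *)
pose zeta (k : 'I_n.+1) := if unlift ord0 k is Some j then 0 else innov S U L t o.
have := h (fun=> true) zeta i; rewrite applied_true feedback_split /zeta unlift_none.
have -> : \mxcol_(j < n) psi (lift ord0 j) (if unlift ord0 (lift ord0 j) is Some _ then 0
    else innov S U L t o) = 0.
  rewrite -[RHS](mxcol0 (p_ := fun=> q)); congr mxcol; apply/funext => j.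
  by rewrite liftK (psi0 hpsi).
rewrite mulmx0 addr0 -/(a o) => h1.
rewrite -[a o i 0](addKr ((z o).1 i 0)); apply: (le_trans (ler_normD _ _)).
by apply: lerD => //; rewrite normrN.
Qed.

Let mb : mxmw ctrl b.
Proof.
apply: mxmwM; first exact: mxmw_cst.
by apply: mxmwD; apply: mxmwM => //; exact: mxmw_cst.
Qed.

Let bb : mxbd (b : T -> 'cV_d).
Proof.
apply: mxbdM; first exact: mxbd_cst.
apply: mxbdD; apply: mxbdM; try exact: mxbd_cst.
  by exists umax => o i j; rewrite (ord1 j); exact: (eta_le hpsi (hh o) i).
by exists (umax + umax) => o i j; rewrite (ord1 j).
Qed.

Let gap o := \sum_k b o k 0 * (xt o k 0 - xh o k 0).

Let gap_Int : Int P gap.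
Proof.
have [K hK] := bb; apply: Int_sum => k _.
have [_ ix _ _] := hxt k.
apply: (@Int_boundedM _ _ _ _ K) => //; first exact: (mw_measurable ctrl_meas (mb k 0)).
by apply: IntB.
Qed.

(** Both estimates differ from the state by something orthogonal to bounded functions of the
    controller's data: [xt] by definition, [xh] because its error is independent of the past. The
    coefficient [b] is such a function. *)
Let gap0 A : sigma_of ctrl A -> Ex P (fun o => \1_A o * gap o) = 0.
Proof.
move=> hA; have mA := sigma_of_measurable ctrl_meas hA; have [K hK] := bb.
rewrite (@eq_Ex _ _ _ P _ (fun o => \sum_k (\1_A o * b o k 0) * (xt o k 0 - xh o k 0))); last first.
  by move=> o; rewrite /gap mulr_sumr; apply: eq_bigr => k _; rewrite mulrA.
have mz k : mw ctrl (fun o => \1_A o * b o k 0) by apply: mwM => //; exact: mw_set.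
have bz k o : `|\1_A o * b o k 0| <= K.
  by rewrite normrM -[leRHS]mul1r; apply: ler_pM => //; exact: norm_indic.
have Iz k X : Int P X -> Int P (fun o => (\1_A o * b o k 0) * X o).
  by apply: (@Int_boundedM _ _ _ _ K) => //; exact: (mw_measurable ctrl_meas (mz k)).
rewrite Ex_sum; last first.
  by move=> k _; have [_ ix _ _] := hxt k; apply: Iz; exact: IntB.
rewrite big1 // => k _; have [is' ix _ _] := hxt k; have [ie _] := post_err_Int hS hU t k.
rewrite (@eq_Ex _ _ _ P _ (fun o => (\1_A o * b o k 0) * xt o k 0 -
  ((\1_A o * b o k 0) * st L t o k 0 - (\1_A o * b o k 0) * post_err S U t o k 0))); last first.
  by move=> o; rewrite -!mulrBr /xh /ideal_est !mxE.
rewrite ExB; [|exact: Iz|by apply: IntB; exact: Iz].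
rewrite ExB; [|exact: Iz|exact: Iz].
rewrite -(condexp_pull ctrl_meas (hxt k) (mz k) (bz k)).
rewrite (orthogonal_bounded (@past_meas t) ie _ (ctrl_past (mz k)) (bz k)); last first.
  by move=> B hB; exact: (post_err_orthogonal hS hU).
by rewrite subr0 subrr.
Qed.

Let program_gap o :
  program_cost P S W U Nr t psi L (xt o) (psi_head S U t psi L o) (z o) = fmean o + 2 * gap o.
Proof.
rewrite program_costE /= (Sigma_psi_ideal hL hLc) (Sigma_psi_w_ideal hL hLc) (Sigma_e_psi_ideal hL hLc).
rewrite /fmean /frozen_mean -/(a o) -/(eta o) -/(Th o).
have E (x : 'cV[R]_d) : (x^T *m calQA S W *m (muG P U Nr t *m eta o + muS P U Nr t *m a o)) 0 0 =
    \sum_k x k 0 * b o k 0.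
  by rewrite -mulmxA mxE; apply: eq_bigr => k _; rewrite [_^T _ _]mxE.
have -> : ((xt o)^T *m calQA S W *m (muG P U Nr t *m eta o + muS P U Nr t *m a o)) 0 0 =
   ((xh o)^T *m calQA S W *m (muG P U Nr t *m eta o + muS P U Nr t *m a o)) 0 0 + gap o.
  by rewrite !E /gap -big_split /=; apply: eq_bigr => k _; ring.
have r (a1 a2 a3 b1 c1 g d1 d2 : R) :
  a1 + a2 + a3 + b1 + 2 * (c1 + g) + d1 + d2 = a1 + a2 + a3 + b1 + 2 * c1 + d1 + d2 + 2 * g by ring.
exact: r.
Qed.

Lemma program_cost_condexp : is_condexp P (controller_sigma U L t) (horizon_cost W t L' (n := n))
  (fun o => program_cost P S W U Nr t psi L (xt o) (psi_head S U t psi L o) (z o) + c o).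
Proof.
have [_ ic mc _] := hc.
have iH : Int P (horizon_cost W t L' (n := n)).
  by apply: eq_Int (fun o => esym (horizon_costE o)) _; apply: IntD => //; exact: free_cost_Int.
have ipc : Int P (fun o => program_cost P S W U Nr t psi L (xt o) (psi_head S U t psi L o) (z o)).
  by apply: eq_Int (fun o => esym (program_gap o)) _; apply: IntD => //; exact: IntZ.
split => //.
- exact: IntD.
- apply: mw_preimage; apply: mwD; last by split.
  have mxt : mxmw ctrl xt by move=> i j; rewrite (ord1 j); exact: condexp_mw (hxt i).
  have cst_ k l (X : 'M[R]_(k, l)) : mxmw ctrl (fun=> X) by exact: mxmw_cst.
  have m2 f : mw ctrl f -> mw ctrl (fun o => 2 * f o) by move=> mf; apply: mwM => //; exact: mw_cst.
  have me (X : T -> 'M[R]_1) : mxmw ctrl X -> mw ctrl (fun o => X o 0 0) by exact.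
  apply: eq_mw (fun o => esym (program_costE P S U W psi Nr t L (xt o)
    (psi_head S U t psi L o) (z o))) _ => /=.
  repeat apply: mwD.
  + by apply: me; apply: mxmwM => //; apply: mxmwM => //; exact: mxmwT.
  + by apply: me; apply: mxmwM => //; apply: mxmwM => //; exact: mxmwT.
  + apply: mw_tr; apply: mxmwM; last exact: mxmwT.
    by apply: mxmwM => //; apply: mxmwM.
  + by apply: m2; apply: me; apply: mxmwM => //; apply: mxmwM => //; exact: mxmwT.
  + apply: m2; apply: me; apply: mxmwM.
      by apply: mxmwM => //; exact: mxmwT.
    by apply: mxmwD; apply: mxmwM.
  + by apply: m2; apply: mw_tr; apply: mxmwM => //; apply: mxmwM.
  + by apply: m2; apply: mw_tr; apply: mxmwM => //; apply: mxmwM.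
- move=> A hA; have mA := sigma_of_measurable ctrl_meas hA.
  rewrite !integral_setE //; last exact: IntD.
  congr (_%:E).
  (* A controller event is a past event, so the freezing identity applies to it; only the [gap] term
     needs the smaller sigma-algebra. *)
  have hA' : sigma_of past A.
    by apply: sigma_of_sub hA => f fc; apply: ctrl_past; exact: mw_gen.
  have iA X : Int P X -> Int P (fun o => \1_A o * X o) by exact: Int_indicM.
  rewrite (@eq_Ex _ _ _ P _ (fun o => (\1_A o * fmean o + 2 * (\1_A o * gap o)) + \1_A o * c o)); last first.
    by move=> o; rewrite program_gap; ring.
  rewrite [RHS](@eq_Ex _ _ _ P _ (fun o => \1_A o * free_cost o + \1_A o * true_cost o)); last first.
    by move=> o; rewrite horizon_costE mulrDr.
  rewrite ExD; [|apply: IntD; [exact: iA|apply: IntZ; exact: iA]|exact: iA].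
  rewrite ExD; [|exact: iA|by apply: IntZ; exact: iA].
  rewrite ExD; [|apply: iA; exact: free_cost_Int|exact: iA].
  rewrite (ExZ _ (iA _ gap_Int)) gap0 // mulr0 addr0 fmeanE //.
  by rewrite (condexp_Ex ctrl_meas hc hA) addrC.
Qed.

End HorizonExpectation.

(** * Positivity of the moment matrices *)

Section Convexity.
Context {R : realType} {d m q n : nat}.
Context {dsp : measure_display} {T : measurableType dsp}.
Variables (P : probability T R) (S : plant R d m q) (U : uncertainty R d q T).
Variables (ps pc : R).
Hypothesis hU : uncertainty_ok P S U ps pc.
Variables (W : weights R d m).
Hypothesis hW : weights_ok W.
Variables (psi : 'I_n.+1 -> 'cV[R]_q -> 'cV[R]_q) (psimax : R).
Hypothesis hpsi : psi_ok psi psimax.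
Variables (Nr t : nat) (L : loop R d m q T).

Let G := rG (n := n) (m := m) U Nr t.
Let S' := rS (n := n) (m := m) U Nr t.
Let al := alpha (n := n) S W.

Lemma control_moments_psd (eta a : 'cV[R]_(stacked m n.+1)) :
  0 <= (eta^T *m SigmaG P S W U Nr t *m eta) 0 0 +
    2 * (eta^T *m SigmaGS P S W U Nr t *m a) 0 0 +
    (a^T *m SigmaS P S W U Nr t *m a) 0 0.
Proof.
have nuC : forall k, (t <= k)%N -> mw (gen U control_source) (fun o => (nu U k o)%:R : R).
  by move=> k; exact: (nu_control U).
have mG : mxmw (gen U control_source) G := rG_mw Nr nuC.
have mS : mxmw (gen U control_source) S' := rS_mw Nr nuC.
have quad (X Y : T -> 'M[R]_(stacked m n.+1)) : mxmw (gen U control_source) X -> mxbd X ->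
    mxmw (gen U control_source) Y -> mxbd Y -> mxInt P (fun o => (X o)^T *m al *m Y o).
  move=> mX bX mY bY; apply: (@mxbd_Int _ _ _ P (gen U control_source)).
  - exact: (gen_meas hU).
  - by apply: mxmwM => //; apply: mxmwM; [exact: mxmwT|exact: mxmw_cst].
  - by apply: mxbdM => //; apply: mxbdM; [exact: mxbd_tr|exact: mxbd_cst].
have mean (X Y : T -> 'M[R]_(stacked m n.+1)) (u v : 'cV[R]_(stacked m n.+1)) :
    mxInt P (fun o => (X o)^T *m al *m Y o) ->
    has_mean P (fun o => ((X o *m u)^T *m al *m (Y o *m v)) 0 0)
      ((u^T *m mean_mx P (fun o => (X o)^T *m al *m Y o) *m v) 0 0).
  move=> iXY; have [i1 e1] := has_mxmean_mulr v (has_mxmean_mull u^T (conj iXY erefl)).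
  have E o : (u^T *m ((X o)^T *m al *m Y o) *m v) 0 0 = ((X o *m u)^T *m al *m (Y o *m v)) 0 0.
    by rewrite trmx_mul !mulmxA.
  by apply: eq_has_mean E _ (conj (i1 0 0) erefl); rewrite -e1 mean_mxE.
have [tal pal] := alpha_psd (n := n) S hW.
have bG : mxbd G := rG_mxbd U Nr t.
have bS : mxbd S' := rS_mxbd U Nr t.
have h := has_meanD (has_meanD (mean _ _ eta eta (quad _ _ mG bG mG bG))
  (has_meanZ 2 (mean _ _ eta a (quad _ _ mG bG mS bS)))) (mean _ _ a a (quad _ _ mS bS mS bS)).
have [_ <-] := h; apply: Ex_ge0 => o.
have := pal (G o *m eta + S' o *m a); rewrite -/(qform _ _) qform_add // /qform.
by congr (0 <= _); rewrite addrAC.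
Qed.

Lemma feedback_moments_psd (Th' : 'M[R]_(stacked m n.+1, stacked q n)) :
  mxmw all_measurable (psi_tail S U t psi L) ->
  0 <= \tr (SigmaS P S W U Nr t *m Th' *m Sigma_psi P S U t psi L *m Th'^T).
Proof.
move=> mp; set SS := SigmaS P S W U Nr t.
have ipp : mxInt P (fun o => psi_tail S U t psi L o *m (psi_tail S U t psi L o)^T).
  apply: (@mxbd_Int _ _ _ P all_measurable) => //; first by apply: mxmwM => //; exact: mxmwT.
  have bp : mxbd (psi_tail S U t psi L).
    exists psimax => o i j; rewrite mxE (ord1 j).
    by have [_ _] := hpsi (lift ord0 (tagnat.sig1 i)); exact.
  by apply: mxbdM => //; exact: mxbd_tr.
have [i1 <-] := has_mxmean_mulr Th'^T (has_mxmean_mull (SS *m Th') (conj ipp erefl)).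
have [_ <-] := has_mean_tr i1; apply: Ex_ge0 => o.
set v := psi_tail S U t psi L o.
have -> : \tr (SS *m Th' *m (v *m v^T) *m Th'^T) = ((Th' *m v)^T *m SS *m (Th' *m v)) 0 0.
  by rewrite -trace_mx11 -[in RHS]mulmxA [RHS]mxtrace_mulC trmx_mul !mulmxA.
(* A zero offset reduces the joint positivity to that of [SigmaS]. *)
have := control_moments_psd 0 (Th' *m v).
have Z : (0 : 'M[R]_1) 0 0 = 0 by rewrite mxE.
by rewrite trmx0 !mul0mx !Z mulr0 !add0r.
Qed.

Lemma program_cost_convex x p : mxmw all_measurable (psi_tail S U t psi L) ->
  convex_quadratic (program_cost P S W U Nr t psi L x p).
Proof.
move=> mp.
apply: (quadratic_cost_convex (x^T *m calQA S W *m muS P U Nr t)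
  (x^T *m calQA S W *m muG P U Nr t) p (calQD S W *m muS P U Nr t)
  (Sigma_psi_w P S U t psi L) (calQA S W *m muS P U Nr t) (Sigma_e_psi P S U t psi L)).
  exact: control_moments_psd.
by move=> Th'; exact: feedback_moments_psd.
Qed.

End Convexity.

Theorem proposition6
  (R : realType) (d m q : nat)
  (dsp : measure_display) (Omega : measurableType dsp)
  (P : probability Omega R)
  (S : plant R d m q) (hS : plant_ok S)
  (ps pc : R) (hps : 0 < ps) (hpc : 0 < pc)
  (U : uncertainty R d q Omega) (hU : uncertainty_ok P S U ps pc)
  (umax : R) (humax : 0 < umax)
  (n Nr : nat) (hNr : (0 < Nr <= n.+1)%N)
  (W : weights R d m) (hW : weights_ok W)
  (psi : 'I_n.+1 -> 'cV[R]_q -> 'cV[R]_q) (psimax : R)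
  (hpsi : psi_ok psi psimax)
  (t : nat) (ht : (Nr %| t)%N)
  (L : loop R d m q Omega)
  (hL : is_loop P S U L (t + n.+1))
  (hLadm : admissible_operation U L umax (t + n.+1))
  (xt : Omega -> 'cV[R]_d)
  (hxt : is_condexp_vec P (controller_sigma U L t) (st L t) xt) :
  let prog : 'cV[R]_d -> 'cV[R]_q -> program (decision R m q n) :=
    mpc_program P S W U Nr t psi psimax umax L in
  [/\ forall x p z,
        [/\ feasible (prog x p) z <->
              robust_hard_constraint Nr psimax umax t z,
            feasible (prog x p) z -> hard_constraint Nr psi umax t z &
            psi_tight psi psimax ->
              (feasible (prog x p) z <-> hard_constraint Nr psi umax t z)],
      exists c : Omega -> R,
        forall (z : Omega -> decision R m q n) (L' : loop R d m q Omega),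
          data_dependent U t L z ->
          (forall o, hard_constraint Nr psi umax t (z o)) ->
          continues_with P S U Nr t psi L z L' ->
          (forall o (l : 'I_n.+1) i, `|act L' (t + l) o i 0| <= umax) /\
          is_condexp P (controller_sigma U L t) (horizon_cost W t L' (n := n))
            (fun o =>
              objective (prog (xt o) (psi_head S U t psi L o)) (z o) + c o),
      forall x p, convex_quadratic_program (prog x p) &
      forall x p, exists z, feasible (prog x p) z].
Proof.
move=> prog.
have causal := admissible_causal (S := S) hLadm.
have robust (z : decision R m q n) :
    program_constraint psimax umax z <-> robust_hard_constraint Nr psimax umax t z.
  exact: (robust_program Nr umax hpsi).
have hard (z : decision R m q n) : program_constraint psimax umax z -> hard_constraint Nr psi umax t z.
  by move=> /robust; exact: (robust_hard hpsi).
split => [x p z||x p|x p].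
- split; [exact: robust|exact: hard|move=> tight].
  by split; [exact: hard|exact: tight_hard_program].
- have mF : all_meas (controller_data U L t).
    move=> f fc; apply: (mw_measurable (past_info_meas hU (t := t))).
    exact: (controller_data_past hL causal (leq_addr _ _)).
  (* The constant is produced before any policy is introduced, as the order of quantifiers
     requires. *)
  have [c hc] := condexp_exists mF (free_cost_Int hS hU W hL hLadm).
  exists c => z L' hz hh hL'; split; first exact: (continuation_bounded hh hL').
  exact: (program_cost_condexp hS hU humax hW hpsi hL hLadm hxt hc hz hh hL').
- split; last by apply: program_polyhedral => j; exact: (psimax_ge0 hpsi).
  exact: (program_cost_convex hU hW hpsi _ _ _ (psi_tail_mw hU hpsi hL causal)).
- by exists (0, 0); exact: zero_program.
Qed.
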